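(* Let $B\in\mathbb Z^+$, $r\in\{1,\dots,B+1\}$, $x\ge0$ with $F(x)<1$, $s>0$. Let $b_r(x)=\inf\{t:d_{r,x}(t)=0\}$ be the busy period of type $(r,x)$ of the $\mathrm{M}^{\varkappa}|\mathrm{G}^{\delta}|1|B$ system, and $b_r^s(x)=\mathbf E\left[e^{-sb_r(x)};\,b_r(x)<\infty\right]$. Then $$b_r^s(x)=\frac{\tilde f_x(s)+(1-\tilde f(s))\,S_{B-r}^s(x)}{\tilde f(s)+(1-\tilde f(s))\,\mathbf E\,S_{\delta+B-1}^s},\qquad \mathbf E\,S_{\delta+B-1}^s=(1-\lambda)\sum_{i=1}^\infty\lambda^{i-1}S_{i-1+B}^s(0).$$ The random variable $b_r(x)$ is proper, i.e. $\mathbf P[b_r(x)<\infty]=1$, and $$\mathbf E\,b_r(x)=\mathbf E\eta_x-\mathbf E\eta+\mathbf E\eta\left[\mathbf E S_{\delta+B-1}-S_{B-r}(x)\right]<\infty,$$ where $S_k(x)=S_k^0(x)$ and $\mathbf E S_{\delta+B-1}=\mathbf E S_{\delta+B-1}^0$.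
   Context: Notation: $\mathbb N=\{1,2,\dots\}$, $\mathbb Z^{+}=\{0,1,\dots\}$, $\mathbf E[Y;\mathfrak A]=\mathbf E[Y\,\mathbf I_{\mathfrak A}]$, $0^0=1$. The process. $\varkappa,\delta\in\mathbb N$ and $\eta\in(0,\infty)$ are independent random variables with finite means; $F(x)=\mathbf P[\eta\le x]$; $\delta$ is geometric: $\mathbf P[\delta=n]=(1-\lambda)\lambda^{n-1}$, $n\in\mathbb N$, $\lambda\in[0,1)$. For $x\ge0$ with $F(x)<1$, $\eta_x$ has distribution $\mathbf P[\eta_x\le u]=\frac{F(x+u)-F(x)}{1-F(x)}$, $u\ge 0$. Let $\eta_0(x)=0$, $\eta_1(x)=\eta_x$, $\eta_{n+1}(x)=\eta_x+\eta_1'+\dots+\eta_n'$ with $\eta_i'$ i.i.d. copies of $\eta$; $N_x(t)=\max\{n\in\mathbb Z^+:\eta_n(x)\le t\}$; $\delta_0=0$, $\delta_n=\delta_1'+\dots+\delta_n'$ with $\delta_i'$ i.i.d. copies of $\delta$. $\pi(t)$ is a compound Poisson process with intensity $\mu>0$ and jumps distributed as $\varkappa$: $\mathbf E\theta^{\pi(t)}=e^{tk(\theta)}$, $k(\theta)=\mu(\mathbf E\theta^{\varkappa}-1)$, $|\theta|\le 1$. All sequences and $\pi$ are independent. Define $D_x(t)=\pi(t)-\delta_{N_x(t)}$, the age process $\eta_x^+(t)=t+x$ for $0\le t<\eta_x$ and $\eta_x^+(t)=t-\eta_{N_x(t)}(x)$ for $t\ge\eta_x$, and the reflected process $\overline D_r^{B+1}(x,t)=r+D_x(t)-\max\{0,\sup_{[0,t]}(r+D_x(\cdot))-(B+1)\}$.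 The queue $\mathrm{M}^{\varkappa}|\mathrm{G}^{\delta}|1|B$. The Markov process $Y_{r,x}(t)=(d_{r,x}(t),\eta_{r,x}(t))$, with initial state $(r,x)$, is defined as follows. For $r\in\{1,\dots,B+1\}$ let $\tilde\tau=\inf\{t:\overline D_r^{B+1}(x,t)<1\}$; then $Y_{r,x}(t)=(\overline D_r^{B+1}(x,t),\eta_x^+(t))$ for $0\le t<\tilde\tau$, and from time $\tilde\tau$ on it continues as a fresh copy $Y_{0,0}(t-\tilde\tau)$. The process $Y_{0,0}$ stays at $(0,0)$ for an exponential time $\tilde\mu$ with parameter $\mu$, and then continues as $Y_{i,0}(t-\tilde\mu)$ with probability $\mathbf P[\varkappa=i]$, $i=1,\dots,B$, and as $Y_{B+1,0}(t-\tilde\mu)$ with probability $\mathbf P[\varkappa\ge B+1]$. Interpretation: batches of size $\varkappa$ arrive at Poisson rate $\mu$ to a waiting room of size $B+1$ with partial rejection; at the end of each service cycle (of duration distributed as $\eta$) the content $r$ is reduced by $\min\{r,\delta\}$; $d_{r,x}(t)$ is the number of customers at time $t$ and $\eta_{r,x}(t)$ the elapsed service time. Auxiliary functions. $\tilde f_x(s)=\mathbf Ee^{-s\eta_x}$, $\tilde f(s)=\mathbf Ee^{-s\eta}=\tilde f_0(s)$. For $s>0$, $c(s)\in(\lambda,1)$ is the unique solution in $|\theta|<1$ of $\theta-\lambda=(1-\lambda)\tilde f(s-k(\theta))$, and $c(0)=\lim_{s\to0}c(s)$. For $s\ge0$ the resolvent sequence $\{Q_k^s(x)\}_{k\in\mathbb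 Z^+}$ is defined by $$\sum_{k\in\mathbb Z^+}\theta^kQ_k^s(x)=\frac{(1-\lambda)\tilde f_x(s-k(\theta))}{(1-\lambda)\tilde f(s-k(\theta))+\lambda-\theta},\qquad |\theta|<c(s).$$ $S_k^s(x)=\sum_{i=0}^kQ_i^s(x)$ for $k\ge0$, $S_{-1}^s(x)=0$. *)

(* Defs.v *)
From HB Require Import structures.
From mathcomp Require Import all_boot all_order all_algebra.
From mathcomp Require Import all_classical all_reals all_analysis.

Set Implicit Arguments.
Unset Strict Implicit.
Unset Printing Implicit Defensive.
Import Order.TTheory GRing.Theory Num.Theory.
Import numFieldNormedType.Exports.

Local Open Scope classical_set_scope.
Local Open Scope ring_scope.

(** * Probability *)

Definition same_law d (T : measurableType d) (R : realType)
    (P : probability T R) d' (U : measurableType d') (X Y : {RV P >-> U}) : Prop :=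
  forall A : set U, measurable A -> P (X @^-1` A) = P (Y @^-1` A).

(* Independence of a family of set systems, meant for sigma-algebras.  Finite
   subfamilies are given by injections, so the index type is arbitrary. *)
Definition mutual_independence d (T : measurableType d) (R : realType)
    (P : probability T R) (I : Type) (G : I -> set (set T)) : Prop :=
  forall (n : nat) (f : 'I_n -> I), injective f ->
  forall A : 'I_n -> set T, (forall i, G (f i) (A i)) ->
    P (\bigcap_(i in [set: 'I_n]) A i) = (\prod_(i < n) P (A i))%E.

Definition sigma_fun (T : Type) d' (U : measurableType d') (X : T -> U) :
  set (set T) := preimage_set_system setT X measurable.

Definition sigma_process (T : Type) (R : realType) d' (U : measurableType d')
    (X : R -> T -> U) : set (set T) :=
  <<s \bigcup_(t in [set t | 0 <= t]) sigma_fun (X t) >>.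

Definition laplace d (T : measurableType d) (R : realType)
    (P : probability T R) (X : T -> R) (s : R) : R :=
  fine ('E_P[fun w => expR (- (s * X w))%R])%E.

(* k(theta) = mu (E theta^kappa - 1) *)
Definition cumulant d (T : measurableType d) (R : realType)
    (P : probability T R) (mu : R) (kappa : T -> nat) (theta : R) : R :=
  mu * (fine ('E_P[fun w => (theta ^+ kappa w)%R])%E - 1).

(* A compound Poisson process is the Levy process started at 0 whose increments
   have the compound Poisson distributions.  Since the jumps are positive
   integers, the paths are right-continuous and nondecreasing in nat; left
   limits are then automatic and the subtraction below never truncates.  A
   nat-valued law is determined by its generating function on [-1, 1]. *)
Record compound_poisson d (T : measurableType d) (R : realType)
    (P : probability T R) (mu : R) (kappa : {RV P >-> nat})
    (X : R -> {RV P >-> nat}) : Prop := {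
  cp_start : forall w, X 0 w = 0%N;
  cp_nondecreasing : forall w (t u : R), 0 <= t -> t <= u -> (X t w <= X u w)%N;
  cp_right_continuous : forall w (t : R), 0 <= t ->
    exists2 e : R, 0 < e & forall u, t <= u < t + e -> X u w = X t w;
  cp_independent_increments : forall (n : nat) (t : nat -> R),
    0 <= t 0%N -> {homo t : i j / (i <= j)%N >-> i <= j} ->
    mutual_independence P
      (fun i : 'I_n => sigma_fun (fun w => (X (t i.+1) w - X (t i) w)%N));
  cp_increments : forall (t u theta : R), 0 <= t -> t <= u -> `|theta| <= 1 ->
    ('E_P[fun w => (theta ^+ (X u w - X t w))%R])%E
    = (expR ((u - t) * cumulant P mu kappa theta))%:E
}.

(** * The parameters of the queue *)

Definition distrfun d (T : measurableType d) (R : realType)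
    (P : probability T R) (X : {RV P >-> R}) (u : R) : R := fine (cdf X u).

Record model d (T : measurableType d) (R : realType)
    (P : probability T R) := Model {
  m_lam : R;
  m_mu : R;
  m_kappa : {RV P >-> nat};
  m_delta : {RV P >-> nat};
  m_eta : {RV P >-> R};
  (* the residual service time eta_x; only constrained if x >= 0, F(x) < 1 *)
  m_eta_res : R -> {RV P >-> R};
  lam_ge0 : 0 <= m_lam;
  lam_lt1 : m_lam < 1;
  mu_gt0 : 0 < m_mu;
  kappa_gt0 : forall w, (0 < m_kappa w)%N;
  delta_gt0 : forall w, (0 < m_delta w)%N;
  eta_gt0 : forall w, 0 < m_eta w;
  kappa_delta_eta_independent :
    forall (A C : set nat) (D : set R), measurable A -> measurable C -> measurable D ->
    P (m_kappa @^-1` A `&` m_delta @^-1` C `&` m_eta @^-1` D)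
    = (P (m_kappa @^-1` A) * P (m_delta @^-1` C) * P (m_eta @^-1` D))%E;
  kappa_mean : ('E_P[fun w => (m_kappa w)%:R%R] < +oo)%E;
  eta_mean : ('E_P[m_eta] < +oo)%E;
  delta_geometric : forall n, (0 < n)%N ->
    P [set w | m_delta w = n] = ((1 - m_lam) * m_lam ^+ n.-1)%:E;
  eta_resP : forall x u : R, 0 <= x -> distrfun m_eta x < 1 -> 0 <= u ->
    P [set w | m_eta_res x w <= u]
    = ((distrfun m_eta (x + u) - distrfun m_eta x) / (1 - distrfun m_eta x))%:E
}.

(** * Auxiliary functions *)

Definition k_fun d (T : measurableType d) (R : realType)
    (P : probability T R) (M : model P) (theta : R) : R :=
  cumulant P (m_mu M) (m_kappa M) theta.

Definition c_root d (T : measurableType d) (R : realType)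
    (P : probability T R) (M : model P) (s : R) : R :=
  xget 0 [set theta | `|theta| < 1 /\
    theta - m_lam M = (1 - m_lam M) * laplace P (m_eta M) (s - k_fun M theta)].

Definition c_fun d (T : measurableType d) (R : realType)
    (P : probability T R) (M : model P) (s : R) : R :=
  if 0 < s then c_root M s else lim (c_root M u @[u --> 0^'+]).

(* Q_k^s(x) *)
Definition resolvent d (T : measurableType d) (R : realType)
    (P : probability T R) (M : model P) (s x : R) : nat -> R :=
  xget (fun=> 0) [set q : nat -> R | forall theta : R, `|theta| < c_fun M s ->
    series (fun k => theta ^+ k * q k) @ \oo -->
      (1 - m_lam M) * laplace P (m_eta_res M x) (s - k_fun M theta)
      / ((1 - m_lam M) * laplace P (m_eta M) (s - k_fun M theta) + m_lam M - theta)].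

(* S_k^s(x), with value 0 at k = -1 *)
Definition resolvent_sum d (T : measurableType d) (R : realType)
    (P : probability T R) (M : model P) (s x : R) (k : int) : R :=
  if k is Posz n then \sum_(0 <= i < n.+1) resolvent M s x i else 0.

(* E S_{delta + B - 1}^s *)
Definition mean_resolvent_sum d (T : measurableType d) (R : realType)
    (P : probability T R) (M : model P) (B : nat) (s : R) : \bar R :=
  ('E_P[fun w => resolvent_sum M s 0 ((m_delta M w)%:Z + B%:Z - 1)%R])%E.

(** * Paths within one busy cycle *)

(* eta_n(x), from eta_x = h and eta'_1, eta'_2, ... = e 0, e 1, ... *)
Definition epoch (R : realType) (h : R) (e : nat -> R) (n : nat) : R :=
  if n is m.+1 then h + \sum_(0 <= i < m) e i else 0.

(* N_x(t); the maximum exists almost surely *)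
Definition completed (R : realType) (h : R) (e : nat -> R) (t : R) : nat :=
  xget 0%N [set n | epoch h e n <= t /\
                    forall m, epoch h e m <= t -> (m <= n)%N].

(* D_x(t) *)
Definition net_input (R : realType) (a : R -> nat) (dl : nat -> nat)
    (h : R) (e : nat -> R) (t : R) : R :=
  (a t)%:R - (\sum_(0 <= i < completed h e t) dl i)%N%:R.

(* eta_x^+(t) *)
Definition age (R : realType) (x h : R) (e : nat -> R) (t : R) : R :=
  if t < h then t + x else t - epoch h e (completed h e t).

(* the path r + D reflected from above at B + 1 *)
Definition reflected (R : realType) (B r : nat) (D : R -> R) (t : R) : R :=
  r%:R + D t - Num.max 0 (sup [set r%:R + D u | u in `[0, t]] - B.+1%:R).

Definition first_below1 (R : realType) (p : R -> R) : \bar R :=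
  ereal_inf [set t%:E | t in [set t | 0 <= t /\ p t < 1]].

(** * The queueing process *)

(* Cycle 0 starts in state (r, x).  Cycle n > 0 is a fresh copy of the process
   started at (0, 0), up to its next return to that state: an idle period
   followed by a busy period. *)
Inductive source :=
| Arrivals of nat | Residual of nat | Service of nat & nat
| Reduction of nat & nat | Idle of nat | Batch of nat.

Record driver d (T : measurableType d) (R : realType)
    (P : probability T R) (M : model P) (x : R) := Driver {
  arrivals : nat -> R -> {RV P >-> nat};
  residual : nat -> {RV P >-> R};
  service : nat -> nat -> {RV P >-> R};
  reduction : nat -> nat -> {RV P >-> nat};
  idle : nat -> {RV P >-> R};
  batch : nat -> {RV P >-> nat};
  arrivalsP : forall n, compound_poisson (m_mu M) (m_kappa M) (arrivals n);
  residual0P : same_law (residual 0%N) (m_eta_res M x);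
  residualP : forall n, same_law (residual n.+1) (m_eta_res M 0);
  serviceP : forall n i, same_law (service n i) (m_eta M);
  reductionP : forall n i, same_law (reduction n i) (m_delta M);
  idleP : forall n (A : set R), measurable A ->
    P (idle n @^-1` A) = exponential_prob (m_mu M) A;
  batchP : forall n, same_law (batch n) (m_kappa M);
  driver_independent : mutual_independence P (fun j : source =>
    match j with
    | Arrivals n => sigma_process (arrivals n)
    | Residual n => sigma_fun (residual n)
    | Service n i => sigma_fun (service n i)
    | Reduction n i => sigma_fun (reduction n i)
    | Idle n => sigma_fun (idle n)
    | Batch n => sigma_fun (batch n)
    end)
}.

Section queue.
Context d (T : measurableType d) (R : realType) (P : probability T R)
  (M : model P) (x : R) (W : driver M x) (B r : nat) (w : T).

Definition cycle_idle (n : nat) : R := if n is 0%N then 0 else idle W n w.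

(* content and age at the beginning of the busy part of cycle n *)
Definition cycle_level (n : nat) : nat :=
  if n is 0%N then r else minn (batch W n w) B.+1.

Definition cycle_start_age (n : nat) : R := if n is 0%N then x else 0.

Definition cycle_content (n : nat) : R -> R :=
  reflected B (cycle_level n)
    (net_input (fun t => arrivals W n t w) (fun i => reduction W n i w)
               (residual W n w) (fun i => service W n i w)).

Definition cycle_age (n : nat) : R -> R :=
  age (cycle_start_age n) (residual W n w) (fun i => service W n i w).

Definition cycle_begin (n : nat) : \bar R :=
  (\sum_(0 <= i < n) ((cycle_idle i)%:E + first_below1 (cycle_content i)))%E.

(* the cycle in progress at time t; it exists almost surely *)
Definition current_cycle (t : R) : nat :=
  xget 0%N [set n | (cycle_begin n <= t%:E < cycle_begin n.+1)%E].

(* Y_{r,x}(t) = (d_{r,x}(t), eta_{r,x}(t)) *)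
Definition queue (t : R) : R * R :=
  let n := current_cycle t in
  let u := t - fine (cycle_begin n) in
  if u < cycle_idle n then (0, 0)
  else (cycle_content n (u - cycle_idle n), cycle_age n (u - cycle_idle n)).

(* b_r(x) *)
Definition busy_period : \bar R :=
  ereal_inf [set t%:E | t in [set t | 0 <= t /\ (queue t).1 = 0]].

End queue.

(* Main.v *)
Require Import Defs.
From HB Require Import structures.
From mathcomp Require Import all_boot all_order all_algebra.
From mathcomp Require Import all_classical all_reals all_analysis.
From mathcomp Require Import measurable_realfun.
From mathcomp Require Import ring lra zify.
Set Implicit Arguments.
Unset Strict Implicit.
Unset Printing Implicit Defensive.
Import Order.TTheory GRing.Theory Num.Theory.
Import numFieldNormedType.Exports.
Local Open Scope classical_set_scope.
Local Open Scope ring_scope.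

(** Let T_n be the time at which the nth service of the first cycle is completed and
    L_n the content at that time, L_0 = r.  The arrivals are independent of the
    services, so almost surely they do not jump at the times T_n; moreover T_n tends
    to infinity.  Between two completions the reflected content only grows, hence
    L_(n+1) = max (0, min (L_n + k_n, B + 1) - d_n) with k_n arrivals during the
    service and a reduction d_n, and the busy period is T_n for the first n with
    L_n = 0 ([first_below1_level], [busy_period_first]).

    Let a_k be the expectation of exp (- s eta) on the event that k customers arrive
    during a time eta.  The product
    exp (- s T_(n+1)) 1(k_n = k) 1(d_n = d) h(L_0, ..., L_n) has mean
    a_k P(delta = d) E[exp (- s T_n) h(L_0, ..., L_n)], with the analogous
    coefficients of eta_x in place of a_k for n = 0 ([mean_next_service]).  So if b is
    a bounded solution of b(0) = 1, b(j) = sum over k, d of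
    a_k P(delta = d) b(min (j + k, B + 1) - d), then the mean of exp (- s T_n) b(L_n)
    on L_n > 0 plus the mean of exp (- s T) on the event that the busy period T is at
    most T_n does not depend on n >= 1, and the first term tends to 0
    ([end_mass_series]).  Hence the transform from (r, x) is the sum over k, d of
    a'_k P(delta = d) b(min (r + k, B + 1) - d), with the coefficients a'_k of eta_x,
    for any bounded solution b.

    The solution comes from the power series inverse e of the denominator
    d(t) = (1 - lam) (sum of a_k t^k) + lam - t of the generating function.  The
    resolvent sequence is 1 - lam times the convolution of e with the coefficients of
    eta_x ([resolventE]), and E S_(delta+B-1) = 1 + (1 - lam) (e_0 + ... + e_(B-1))
    ([mean_resolvent_sumE]).  The two averages in the system, over d and over k, are
    computed in [cvg_service_end] and [cvg_service_start].

    The resolvent sequence is defined by its generating function on |t| < c(s), so the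
    series of e must converge there.  The coefficients of d of order at least 2 are
    nonnegative and d vanishes in (0, 1]; such a series has an inverse with
    nonnegative coefficients, which converges as far as d stays positive
    ([recip_zero_ge0], [cvg_recip_zero]).

    For every measurable Y with values in [0, +oo], 2^n (1 - E exp (- 2^-n Y))
    increases to E Y ([laplace_slope]).  Since all coefficients are continuous at
    s = 0, this gives the mean of the busy period; its finiteness implies that the busy
    period is proper.  The busy period equals a measurable function outside a null
    set, which is enough for its integrals
    ([ge0_ae_eq_integral_nonmeasurable]). *)

(** * Power series *)

Section convolution.
Context {R : realType}.
Implicit Types (u v w : nat -> R) (t : R).

Definition conv u v n : R := \sum_(i < n.+1) u i * v (n - i)%N.
Definition conv_one (n : nat) : R := (n == 0%N)%:R.
Definition scaled t u n : R := t ^+ n * u n.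

(** Up to any order the convolution is a product of polynomials, whose ring laws
    give associativity and commutativity. *)
Lemma conv_coef N u v n : (n < N)%N ->
  conv u v n = (\poly_(i < N) u i * \poly_(i < N) v i)`_n.
Proof.
move=> nN; rewrite coefM; apply: eq_bigr => i _.
have iN : (i < N)%N by rewrite (leq_ltn_trans _ nN)// -ltnS.
by rewrite !coef_poly iN (leq_ltn_trans (leq_subr _ _) nN).
Qed.

Lemma convC u v : conv u v = conv v u.
Proof. by apply/funext => n; rewrite !(@conv_coef n.+1)// mulrC. Qed.

Lemma convA u v w : conv u (conv v w) = conv (conv u v) w.
Proof.
apply/funext => n; rewrite (@conv_coef n.+1)// [RHS](@conv_coef n.+1)//.
transitivity ((\poly_(i < n.+1) u i * (\poly_(i < n.+1) v i * \poly_(i < n.+1) w i))`_n).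
  rewrite !coefM; apply: eq_bigr => i _; congr (_ * _).
  by rewrite coef_poly ltnS leq_subr (@conv_coef n.+1) ?ltnS ?leq_subr.
rewrite mulrA [LHS]coefM [RHS]coefM; apply: eq_bigr => i _; congr (_ * _).
by rewrite coef_poly ltn_ord (@conv_coef n.+1).
Qed.

Lemma conv1 u : conv u conv_one = u.
Proof.
apply/funext => n; rewrite /conv big_ord_recr /= subnn /conv_one eqxx mulr1.
rewrite big1 ?add0r// => i _.
by rewrite subn_eq0 leqNgt ltn_ord mulr0.
Qed.

Lemma conv_ge0 u v : (forall n, 0 <= u n) -> (forall n, 0 <= v n) ->
  forall n, 0 <= conv u v n.
Proof. by move=> u0 v0 n; apply: sumr_ge0 => i _; rewrite mulr_ge0. Qed.

Lemma conv_scaled t u v : conv (scaled t u) (scaled t v) = scaled t (conv u v).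
Proof.
apply/funext => n; rewrite /conv /scaled mulr_sumr; apply: eq_bigr => i _.
have -> : t ^+ n = t ^+ i * t ^+ (n - i) by rewrite -exprD subnKC// -ltnS.
ring.
Qed.

(* Both sides sum u i * v j over the triangle i + j < n. *)
Lemma series_conv u v n : series (conv u v) n = \sum_(i < n) u i * series v (n - i)%N.
Proof.
elim: n => [|n IH]; first by rewrite /series /= big_geq// big_ord0.
rewrite seriesSr IH big_ord_recr /= subSnn.
have -> : series v 1%N = v 0%N by rewrite /series /= big_nat1.
rewrite /conv big_ord_recr /= subnn addrA; congr (_ + _).
rewrite -big_split /=; apply: eq_bigr => i _.
by rewrite subSn ?(ltnW (ltn_ord i))// seriesSr mulrDr.
Qed.

Lemma conv_cst1 u n : conv u (fun=> 1) n = series u n.+1.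
Proof. by rewrite /conv /series /= big_mkord; apply: eq_bigr => i _; rewrite mulr1. Qed.

Lemma series_ge0 u n : (forall n, 0 <= u n) -> 0 <= series u n.
Proof. by move=> u0; apply: sumr_ge0. Qed.

Lemma le_series u m n : (forall n, 0 <= u n) -> (m <= n)%N -> series u m <= series u n.
Proof.
move=> u0 mn; rewrite /series /= (big_cat_nat (leq0n m) mn)//= lerDl.
by apply: sumr_ge0.
Qed.

Lemma series_cvg_le (u : nat -> R) (l : R) n : (forall n, 0 <= u n) ->
  series u @ \oo --> l -> series u n <= l.
Proof.
move=> u0 ul; rewrite -(cvg_lim _ ul)//; apply: nondecreasing_cvgn_le.
  by move=> i j ij; exact: le_series.
by apply/cvg_ex; exists l.
Qed.

(** Mertens: the error is dominated by the same error for the absolute values,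
    which vanishes since the square [0, n)^2 lies between two triangles. *)
Lemma cvg_conv u v (a b : R) :
  cvgn (series (fun n => `|u n|)) -> cvgn (series (fun n => `|v n|)) ->
  series u @ \oo --> a -> series v @ \oo --> b ->
  series (conv u v) @ \oo --> a * b.
Proof.
pose U n : R := `|u n|; pose V n : R := `|v n|.
rewrite -/U -/V => cU cV ua vb.
have U0 n : 0 <= U n by exact: normr_ge0.
have V0 n : 0 <= V n by exact: normr_ge0.
have W0 := conv_ge0 U0 V0.
have CAB n : series (conv U V) n <= series U n * series V n.
  rewrite series_conv /series /= [X in _ <= X * _]big_mkord mulr_suml.
  apply: ler_sum => i _; apply: ler_wpM2l => //.
  by apply: le_series; rewrite ?leq_subr.
have ABC n : series U n * series V n <= series (conv U V) (n + n)%N.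
  rewrite series_conv [X in X * _]/series /= big_mkord mulr_suml.
  rewrite big_split_ord /= -[leLHS]addr0; apply: lerD.
    apply: ler_sum => i _; apply: ler_wpM2l => //.
    by apply: le_series => //; rewrite leq_subRL; have := ltn_ord i; lia.
  by apply: sumr_ge0 => i _; rewrite mulr_ge0// series_ge0.
have cAB : series U \* series V @ \oo --> limn (series U) * limn (series V).
  exact: cvgM.
have cC : cvgn (series (conv U V)).
  apply: nondecreasing_is_cvgn; first by move=> i j ij; exact: le_series.
  exists (limn (series U) * limn (series V)) => _ [n _ <-].
  rewrite (le_trans (CAB n))// ler_pM ?series_ge0//.
    by apply: nondecreasing_cvgn_le => // i j ij; exact: le_series.
  by apply: nondecreasing_cvgn_le => // i j ij; exact: le_series.
have eC : limn (series (conv U V)) = limn (series U) * limn (series V).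
  apply/eqP; rewrite eq_le; apply/andP; split.
    apply: (ler_cvg_to cC cAB); near=> n; exact: CAB.
  apply: (ler_cvg_to cAB (cvg_cst (limn (series (conv U V))))); near=> n.
  apply: (le_trans (ABC n)); apply: nondecreasing_cvgn_le => //.
  by move=> i j ij; exact: le_series.
have err n : `|series u n * series v n - series (conv u v) n| <=
    series U n * series V n - series (conv U V) n.
  rewrite !series_conv [X in `|X * _ - _|]/series [X in _ <= X * _ - _]/series /=.
  rewrite !big_mkord !mulr_suml -!sumrB; apply: le_trans (ler_norm_sum _ _ _) _.
  apply: ler_sum => i _; rewrite -!mulrBr normrM; apply: ler_wpM2l => //.
  by rewrite !sub_series_geq ?leq_subr// ler_norm_sum.
have errl : (fun n => series u n * series v n - series (conv u v) n) @ \oo --> (0 : R).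
  apply/norm_cvg0P.
  apply: (@squeeze_cvgr _ _ _ _ (cst 0) (fun n => series U n * series V n - series (conv U V) n)).
  - by near=> n; rewrite normr_ge0 err.
  - exact: cvg_cst.
  - rewrite -(subrr (limn (series (conv U V)))) {1}eC; apply: cvgB => //.
have -> : series (conv u v) = (fun n => series u n * series v n -
    (series u n * series v n - series (conv u v) n)).
  by apply/funext => n; rewrite subKr.
rewrite -[a * b]subr0; apply: cvgB => //; exact: cvgM.
Unshelve. all: by end_near.
Qed.

(** The coefficients of the reciprocal of a power series; the recursion keeps
    the coefficients found so far, last one first. *)
Fixpoint recip_rev (v : nat -> R) n : seq R :=
  if n is m.+1 then
    - (v 0%N)^-1 * (\sum_(i < m.+1) v i.+1 * (recip_rev v m)`_i) :: recip_rev v m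
  else [:: (v 0%N)^-1].

Definition recip v n : R := head 0 (recip_rev v n).

Lemma nth_recip_rev v n i : (i <= n)%N -> (recip_rev v n)`_i = recip v (n - i).
Proof.
elim: n i => [|n IH] [|i]//.
by rewrite ltnS subSS => /IH <-.
Qed.

Lemma recipS v n : recip v n.+1 =
  - (v 0%N)^-1 * (\sum_(i < n.+1) v i.+1 * recip v (n - i)%N).
Proof.
rewrite {1}/recip /=; congr (_ * _); apply: eq_bigr => i _.
by rewrite nth_recip_rev// -ltnS.
Qed.

Lemma conv_recip v : v 0%N != 0 -> conv v (recip v) = conv_one.
Proof.
move=> v0; apply/funext => -[|n].
  by rewrite /conv big_ord1 /= subnn /recip/= divff.
rewrite /conv big_ord_recl subn0 recipS mulrA mulrN divff// mulN1r.
by rewrite /conv_one /= -[RHS](addNr (\sum_(i < n.+1) v i.+1 * recip v (n - i)%N)).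
Qed.

Lemma recip_unique v w : v 0%N != 0 -> conv v w = conv_one -> w = recip v.
Proof.
move=> v0 vw; rewrite -[LHS]conv1 -(conv_recip v0) convA [conv w v]convC vw.
by rewrite convC conv1.
Qed.

Lemma recip_ge0 v : 0 < v 0%N -> (forall n, v n.+1 <= 0) -> forall n, 0 <= recip v n.
Proof.
move=> v0 vn n; elim/ltn_ind: n => -[|n] IH; first by rewrite /recip/= invr_ge0 ltW.
rewrite recipS mulNr -mulrN mulr_ge0 ?invr_ge0 ?(ltW v0)// -sumrN sumr_ge0//.
move=> i _; rewrite -mulNr mulr_ge0 ?oppr_ge0 ?vn// IH//.
by rewrite ltnS leq_subr.
Qed.

Lemma scaled_ge0 t u : 0 <= t -> (forall n, 0 <= u n) -> forall n, 0 <= scaled t u n.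
Proof. by move=> t0 u0 n; rewrite mulr_ge0// exprn_ge0. Qed.

Lemma scaledM t1 t2 u : scaled t1 (scaled t2 u) = scaled (t1 * t2) u.
Proof. by apply/funext => n; rewrite /scaled mulrA exprMn. Qed.

Lemma scaled_recip t v : v 0%N != 0 -> recip (scaled t v) = scaled t (recip v).
Proof.
move=> v0; apply/esym/recip_unique; first by rewrite /scaled expr0 mul1r.
rewrite conv_scaled conv_recip//; apply/funext => -[|n]; rewrite /scaled /conv_one /=.
  by rewrite expr0 mulr1.
by rewrite mulr0.
Qed.

End convolution.

Section power_series.
Context {R : realType}.
Implicit Types (u v w : nat -> R) (t : R).

(** Close to 0 the terms beyond the first coefficient where two series differ are
    too small to compensate that difference. *)
Lemma power_series_unique (c : R) u v (f : R -> R) : 0 < c ->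
  (forall t, `|t| < c -> series (scaled t u) @ \oo --> f t) ->
  (forall t, `|t| < c -> series (scaled t v) @ \oo --> f t) -> u = v.
Proof.
move=> c0 uf vf; pose w n := u n - v n.
suff w0 n : w n = 0 by apply/funext => m; apply/eqP; rewrite -subr_eq0; apply/eqP/w0.
have wt t : `|t| < c -> series (scaled t w) @ \oo --> (0 : R).
  move=> tc; rewrite -(subrr (f t)).
  have -> : series (scaled t w) = (fun n => series (scaled t u) n - series (scaled t v) n).
    apply/funext => k; rewrite /series /= -sumrB; apply: eq_bigr => i _.
    by rewrite /scaled /w mulrBr.
  by apply: cvgB; [exact: uf|exact: vf].
pose rho := c / 2.
have rho0 : 0 < rho by rewrite divr_gt0.
have [C C0 wC] : exists2 C, 0 < C & forall n, `|w n| * rho ^+ n <= C.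
  have /wt wrho : `|rho| < c by rewrite gtr0_norm// /rho; lra.
  have /cvg_series_cvg_0 /cvgP/cvg_seq_bounded [M [_ MP]] :
    cvgn (series (scaled rho w)) by exact: cvgP wrho.
  exists (Num.max (M + 1) 1); first by rewrite lt_max ltr01 orbT.
  move=> k; have M1 : M < M + 1 by rewrite ltrDl.
  have /= := MP (M + 1) M1 k Logic.I; rewrite /scaled normrM normrX (gtr0_norm rho0) mulrC.
  by move=> h; rewrite le_max h.
elim/ltn_ind: n => m IH; apply/eqP; rewrite -normr_le0; apply/ler_addgt0Pr => e e0.
rewrite add0r.
(* with t = rho * q, the tail after m is at most C q^(m+1) / (1 - q) *)
pose q := Num.min (2^-1) (e * rho ^+ m / (2 * C)).
have q0 : 0 < q by rewrite lt_min invr_gt0 ltr0n/= divr_gt0 ?mulr_gt0 ?exprn_gt0.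
have q2 : q <= 2^-1 by rewrite ge_min lexx.
have qe : q <= e * rho ^+ m / (2 * C) by rewrite ge_min lexx orbT.
have tc : `|rho * q| < c.
  by rewrite gtr0_norm ?mulr_gt0// /rho; nra.
have tail k : `|series (scaled (rho * q) w) (m.+1 + k)%N - (rho * q) ^+ m * w m| <=
     C * q ^+ m.+1 * 2.
  rewrite /series /= (big_cat_nat (leq0n m.+1) (leq_addr _ _))/= big_nat_recr//=.
  rewrite big_nat big1 ?add0r; last first.
    by move=> i /andP[_ im]; rewrite /scaled IH// mulr0.
  rewrite [X in X + _ - _]/scaled addrC addKr.
  apply: le_trans (ler_norm_sum _ _ _) _.
  apply: (@le_trans _ _ (\sum_(m.+1 <= i < m.+1 + k) C * q ^+ i)).
    apply: ler_sum_nat => i _; rewrite /scaled normrM exprMn normrM.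
    rewrite !normrX (gtr0_norm rho0) (gtr0_norm q0).
    have := wC i; have : 0 <= q ^+ i by rewrite exprn_ge0// ltW.
    by move=> ? ?; rewrite -mulrA mulrCA [leRHS]mulrC ler_wpM2l// mulrC.
  rewrite -mulr_sumr -mulrA; apply: ler_wpM2l; first exact: ltW.
  rewrite addnC -[X in \sum_(X <= _ < _) _]add0n big_addn addnK.
  under eq_bigr do rewrite exprD mulrC.
  rewrite -mulr_sumr; apply: ler_wpM2l; first by rewrite exprn_ge0// ltW.
  have := @geometric_seriesE R 1 q.
  rewrite lt_eqF; last by lra.
  move=> /(_ isT) /(congr1 (fun f => f k)); rewrite /series/= /geometric/=.
  under eq_bigr do rewrite mul1r.
  move=> ->; rewrite mul1r ler_pdivrMr; last by lra.
  have : 0 <= q ^+ k by rewrite exprn_ge0// ltW.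
  by lra.
have lim0 : (fun k => `|series (scaled (rho * q) w) (m.+1 + k)%N - (rho * q) ^+ m * w m|)
    @ \oo --> `|0 - (rho * q) ^+ m * w m|.
  apply: cvg_norm; apply: cvgB; last exact: cvg_cst.
  under eq_fun do rewrite addnC.
  have := wt _ tc; rewrite -(cvg_shiftn m.+1); apply.
have : `|0 - (rho * q) ^+ m * w m| <= C * q ^+ m.+1 * 2.
  by apply: (ler_cvg_to lim0 (cvg_cst _)); near=> k; exact: tail.
rewrite sub0r normrN normrM normrX.
rewrite gtr0_norm ?mulr_gt0// exprMn exprS => h.
have qm : 0 < q ^+ m by rewrite exprn_gt0.
have rm : 0 < rho ^+ m by rewrite exprn_gt0.
have : rho ^+ m * `|w m| <= C * q * 2.
  rewrite -(ler_pM2l qm); nra.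
move=> h2; rewrite -(ler_pM2l rm) (le_trans h2)//.
have : q * (2 * C) <= e * rho ^+ m by rewrite -ler_pdivlMr// mulr_gt0.
by nra.
Unshelve. all: by end_near.
Qed.

Lemma cvg_series_norm2 u : (forall n, 0 <= u n.+2) -> cvgn (series u) ->
  cvgn (series (fun n => `|u n|)).
Proof.
move=> u2 cu; rewrite -(is_cvg_series_restrict 2).
have -> : [sequence \sum_(2 <= k < n) `|u k|]_n = [sequence \sum_(2 <= k < n) u k]_n.
  apply/funext => n; apply: eq_big_nat => -[|[|k]]// _.
  by rewrite ger0_norm.
by rewrite is_cvg_series_restrict.
Qed.

(** Positivity and summability of the reciprocal of a power series with a zero
    at c > 0 whose coefficients of order at least 2 are nonnegative: with t = c z
    it equals (1 - z) times a series P whose coefficients of positive order are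
    at most 0, because they are partial sums that increase to 0.  So 1 / P has
    nonnegative coefficients, and so has 1 / (1 - z) 1 / P. *)
Section recip_zero.
Variables (v : nat -> R) (c : R).
Hypotheses (c0 : 0 < c) (v0 : 0 < v 0%N) (v2 : forall n, 0 <= v n.+2)
  (vc : series (scaled c v) @ \oo --> (0 : R)).

Let P := conv (scaled c v) (fun=> 1).

Let P0 : P 0%N = v 0%N.
Proof. by rewrite /P conv_cst1 /series /= big_nat1 /scaled expr0 mul1r. Qed.

Let PS n : P n.+1 <= 0.
Proof.
rewrite /P conv_cst1.
have : (fun k => series (scaled c v) (k + n.+2)%N) @ \oo --> (0 : R).
  by rewrite (cvg_shiftn _ (series _)).
move=> h; rewrite -(cvg_lim _ h)//; apply: limr_ge; first exact: cvgP h.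
near=> k; rewrite /series /= (big_cat_nat (leq0n n.+2) (leq_addl k _))/= lerDl.
rewrite big_nat sumr_ge0// => -[|[|i]]//.
by rewrite mulr_ge0// exprn_ge0// ltW.
Unshelve. all: by end_near.
Qed.

Let w := recip P.

Let w0 n : 0 <= w n.
Proof. by apply: recip_ge0 => [|k]; [rewrite P0|exact: PS]. Qed.

Let recip_eq : scaled c (recip v) = conv w (fun=> 1).
Proof.
have vn0 : scaled c v 0%N != 0 by rewrite /scaled expr0 mul1r gt_eqF.
rewrite -scaled_recip ?gt_eqF//; apply/esym/recip_unique => //.
rewrite [conv w _]convC convA -/P /w conv_recip//.
by rewrite P0 gt_eqF.
Qed.

Lemma recip_zero_ge0 n : 0 <= recip v n.
Proof.
have : 0 <= scaled c (recip v) n by rewrite recip_eq; apply: conv_ge0.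
by rewrite /scaled pmulr_rge0// exprn_gt0.
Qed.

Lemma cvg_recip_zero t (L : R) : 0 <= t < c -> 0 < L ->
  series (scaled t v) @ \oo --> L -> cvgn (series (scaled t (recip v))).
Proof.
move=> /andP[t0 tc] L0 vL; pose z := t / c.
have z0 : 0 <= z by rewrite divr_ge0// ltW.
have z1 : z < 1 by rewrite ltr_pdivrMr// mul1r.
have zc u : scaled z (scaled c u) = scaled t u by rewrite scaledM /z divfK// gt_eqF.
have geom : series (scaled z (fun=> 1)) @ \oo --> (1 - z)^-1.
  have -> : series (scaled z (fun=> 1)) = series (geometric 1 z).
    by congr series; apply/funext => n; rewrite /scaled /geometric/= mulr1 mul1r.
  by have := @cvg_geometric_series R 1 z; rewrite mul1r ger0_norm//; apply.
have geomA : cvgn (series (fun n => `|scaled z (fun=> 1) n|)).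
  apply/cvgP; rewrite (_ : (fun n => _) = scaled z (fun=> 1)); first exact: geom.
  by apply/funext => n; rewrite ger0_norm// scaled_ge0.
have vA : cvgn (series (fun n => `|scaled t v n|)).
  apply: cvg_series_norm2; last exact: cvgP vL.
  by move=> n; rewrite mulr_ge0// exprn_ge0.
have PL : series (scaled z P) @ \oo --> L * (1 - z)^-1.
  rewrite /P -conv_scaled zc; exact: cvg_conv.
have PLn n : L * (1 - z)^-1 <= series (scaled z P) n.+1.
  rewrite -(cvg_lim _ PL)//.
  have h : (fun k => series (scaled z P) (k + n.+1)%N) @ \oo --> L * (1 - z)^-1.
    by rewrite (cvg_shiftn _ (series _)).
  rewrite (cvg_lim _ PL)// -(cvg_lim _ h)//; apply: limr_le; first exact: cvgP h.
  near=> k; rewrite /series /= (big_cat_nat (leq0n n.+1) (leq_addl k _))/= gerDl.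
  rewrite big_nat sumr_le0// => -[|i]// _.
  by rewrite /scaled mulr_ge0_le0// exprn_ge0.
have wz0 := scaled_ge0 z0 w0.
have wb n : series (scaled z w) n <= (L * (1 - z)^-1)^-1.
  have K0 : 0 < L * (1 - z)^-1 by rewrite mulr_gt0// invr_gt0 subr_gt0.
  case: n => [|n]; first by rewrite /series /= big_geq// invr_ge0 ltW.
  rewrite -[leRHS]mul1r ler_pdivlMr//.
  apply: (@le_trans _ _ (series (scaled z w) n.+1 * series (scaled z P) n.+1)).
    by apply: ler_wpM2l; [exact: series_ge0|exact: PLn].
  have <- : series (conv (scaled z P) (scaled z w)) n.+1 = 1.
    rewrite conv_scaled /w conv_recip ?P0 ?gt_eqF// /series /= big_nat_recl//.
    rewrite big1 ?addr0; last by move=> i _; rewrite /scaled /conv_one mulr0.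
    by rewrite /scaled /conv_one expr0 mulr1.
  rewrite series_conv mulrC [X in X * _]/series/= big_mkord mulr_suml.
  apply: ler_sum => -[[|i] hi] _ /=; first by rewrite subn0.
  apply: ler_wnM2l.
    by rewrite /scaled mulr_ge0_le0// exprn_ge0.
  by apply: le_series; rewrite ?leq_subr.
have wA : cvgn (series (fun n => `|scaled z w n|)).
  have -> : (fun n => `|scaled z w n|) = scaled z w by apply/funext => n; rewrite ger0_norm.
  apply: nondecreasing_is_cvgn; first by move=> i j ij; exact: le_series.
  by exists (L * (1 - z)^-1)^-1 => _ [n _ <-].
have wc : cvgn (series (scaled z w)) by exact: normed_cvg.
rewrite -zc recip_eq -conv_scaled; apply/cvgP; exact: (cvg_conv wA geomA wc geom).
Unshelve. all: by end_near.
Qed.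

End recip_zero.

End power_series.

(** * Independence *)

Section freezing.
Local Open Scope ereal_scope.
Context d (T : measurableType d) (R : realType) (P : probability T R).

Section sub_sigma_algebra.
Variables (G : set (set T)) (mG : G `<=` measurable).

Lemma measurable_to_sub : measurable_fun setT (idfun : T -> g_sigma_algebraType G).
Proof.
move=> _ A mA; rewrite setTI preimage_id.
by have := smallest_sub (@sigma_algebra_measurable _ T) mG; apply.
Qed.

(** Product measures need probabilities on the two sub-sigma-algebras; they are
    laws of the identity map. *)
Definition restricted_prob : probability (g_sigma_algebraType G) R :=
  distribution P (HB.pack_for {mfun T >-> g_sigma_algebraType G}
    (idfun : T -> g_sigma_algebraType G) (isMeasurableFun.Build _ _ _ _ _ measurable_to_sub)).

Lemma integral_restricted_prob (f : g_sigma_algebraType G -> \bar R) :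
  measurable_fun setT f -> (forall x, 0 <= f x) ->
  \int[restricted_prob]_x f x = \int[P]_x f x.
Proof. by move=> mf f0; rewrite ge0_integral_distribution. Qed.

End sub_sigma_algebra.

Variables (G1 G2 : set (set T)).
Hypotheses (mG1 : G1 `<=` measurable) (mG2 : G2 `<=` measurable).
Hypotheses (G1I : setI_closed G1) (G2I : setI_closed G2).
Hypotheses (G1T : G1 setT) (G2T : G2 setT).
Hypothesis ind : forall A B, G1 A -> G2 B -> P (A `&` B) = P A * P B.

(** Measures that agree on a pi-system agree on the sigma-algebra it generates;
    this is used for one of the two events at a time. *)
Lemma independent_generated A B : <<s G1 >> A -> <<s G2 >> B ->
  P (A `&` B) = P A * P B.
Proof.
have m1 : <<s G1 >> `<=` measurable.
  exact: smallest_sub (@sigma_algebra_measurable _ T) mG1.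
have m2 : <<s G2 >> `<=` measurable.
  exact: smallest_sub (@sigma_algebra_measurable _ T) mG2.
have cover : \bigcup_(k : nat) [set: T] = setT by rewrite bigcup_const//; exists 0%N.
have step1 C : G2 C -> forall A, <<s G1 >> A -> P (A `&` C) = P A * P C.
  move=> GC X GX; have mC := mG2 GC.
  have PC0 : (0 <= fine (P C))%R by rewrite fine_ge0.
  have u := @g_sigma_algebra_measure_unique _ R T G1 mG1 (fun=> setT) (fun=> G1T)
    cover (mrestr P mC) (mscale (NngNum PC0) P) G1I.
  transitivity (mscale (NngNum PC0) P X).
    apply: u => // [E GE|_].
      change (P (E `&` C) = (fine (P C))%:E * P E).
      by rewrite ind// fineK ?fin_num_measure// muleC.
    change (P (setT `&` C) < +oo).
    by rewrite setTI ltey_eq fin_num_measure.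
  change ((fine (P C))%:E * P X = P X * P C).
  by rewrite fineK ?fin_num_measure// muleC.
move=> GA GB; have mA := m1 _ GA.
have PA0 : (0 <= fine (P A))%R by rewrite fine_ge0.
have u := @g_sigma_algebra_measure_unique _ R T G2 mG2 (fun=> setT) (fun=> G2T)
    cover (mrestr P mA) (mscale (NngNum PA0) P) G2I.
transitivity (mscale (NngNum PA0) P B).
  rewrite setIC; apply: u => // [E GE|_].
    change (P (E `&` A) = (fine (P A))%:E * P E).
    by rewrite setIC step1// fineK ?fin_num_measure.
  change (P (setT `&` A) < +oo).
  by rewrite setTI ltey_eq fin_num_measure.
change ((fine (P A))%:E * P B = P A * P B).
by rewrite fineK ?fin_num_measure.
Qed.

(** The diagonal map sends P to the product of its restrictions to two independent
    sigma-algebras; hence one argument may be integrated while the other is frozen. *)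
Lemma freezing (f : g_sigma_algebraType G1 * g_sigma_algebraType G2 -> \bar R) :
  measurable_fun setT f -> (forall z, 0 <= f z) ->
  \int[P]_w f (w, w) = \int[P]_y \int[P]_x f (x, y).
Proof.
move=> mf f0.
pose diag (w : T) : g_sigma_algebraType G1 * g_sigma_algebraType G2 := (w, w).
have mdiag : measurable_fun setT diag.
  by apply/measurable_fun_pairP; split; exact: measurable_to_sub.
pose D : {RV P >-> (g_sigma_algebraType G1 * g_sigma_algebraType G2)%type} :=
  HB.pack_for {mfun T >-> _} diag (isMeasurableFun.Build _ _ _ _ _ mdiag).
transitivity (\int[distribution P D]_z f z).
  by rewrite ge0_integral_distribution.
transitivity (\int[restricted_prob mG1 \x restricted_prob mG2]_z f z).
  apply: eq_measure_integral => A mA _.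
  apply/esym/product_measure_unique => // A1 A2 mA1 mA2.
  exact: independent_generated.
rewrite fubini_tonelli2//.
rewrite integral_restricted_prob//; last 2 first.
- exact: measurable_fun_fubini_tonelli_G.
- by move=> y; apply: integral_ge0.
apply: eq_integral => y _; rewrite /fubini_G integral_restricted_prob//.
exact: measurableT_comp.
Qed.

End freezing.

Section independent_sequence.
Local Open Scope ereal_scope.
Context d (T : measurableType d) (R : realType) (P : probability T R).
Variable G : nat -> set (set T).
Hypotheses (mG : forall i, G i `<=` measurable) (GI : forall i, setI_closed (G i))
  (GT : forall i, G i setT).
Hypothesis ind : forall n (A : nat -> set T), (forall i, G i (A i)) ->
  P (\bigcap_(i < n) A i) = \prod_(i < n) P (A i).

(** A pi-system that generates the sigma-algebra of the sources i < n with p i. *)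
Definition cylinders (p : pred nat) n : set (set T) :=
  [set C | exists2 A : nat -> set T,
    forall i, G i (A i) /\ (~~ p i -> A i = setT) & C = \bigcap_(i < n) A i].

Lemma cylinders_measurable p n : cylinders p n `<=` measurable.
Proof. by move=> _ [A AG ->]; apply: bigcap_measurableType => i _; apply: (mG (AG i).1). Qed.

Lemma cylindersI p n : setI_closed (cylinders p n).
Proof.
move=> _ _ [A AG ->] [B BG ->]; exists (fun i => A i `&` B i).
  move=> i; have [GA pA] := AG i; have [GB pB] := BG i; split; first exact: GI.
  by move=> pi; rewrite pA// pB// setIT.
by rewrite bigcapI.
Qed.

Lemma cylindersT p n : cylinders p n setT.
Proof.
exists (fun=> setT) => //.
by apply/seteqP; split => // x _ i _.
Qed.

Lemma cylinders_source (p : pred nat) n i : (i < n)%N -> p i -> G i `<=` cylinders p n.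
Proof.
move=> ni pi A GA; exists (fun j => if j == i then A else setT).
  move=> j; case: eqVneq => [->|_]; split => //.
  by rewrite pi.
apply/seteqP; split => [x Ax j _|x]; first by case: eqVneq.
by move=> /(_ i ni); rewrite eqxx.
Qed.

Lemma cylinders_independent (p q : pred nat) n A B : (forall i, ~~ (p i && q i)) ->
  cylinders p n A -> cylinders q n B -> P (A `&` B) = P A * P B.
Proof.
move=> pq [C CG ->] [D DG ->]; rewrite -bigcapI ind; last first.
  by move=> i; apply: GI; [have [] := CG i|have [] := DG i].
rewrite ind; last by move=> i; have [] := CG i.
rewrite ind; last by move=> i; have [] := DG i.
rewrite -big_split; apply: eq_bigr => i _ /=.
have [_ Ci] := CG i; have [_ Di] := DG i.
have [/Ci ->|pi] := boolP (~~ p i); first by rewrite setTI probability_setT mul1e.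
have /Di -> : ~~ q i by have := pq i; rewrite (negbNE pi).
by rewrite setIT probability_setT mule1.
Qed.

Lemma measurable_cylinders (p : pred nat) n i d' (U : measurableType d') (f : T -> U) :
  (i < n)%N -> p i -> (forall A, measurable A -> G i (f @^-1` A)) ->
  measurable_fun setT (f : g_sigma_algebraType (cylinders p n) -> U).
Proof.
move=> ni pi fG _ A mA; rewrite setTI; apply: sub_sigma_algebra.
exact: (cylinders_source ni pi (fG _ mA)).
Qed.

(** The last factor is independent of the cylinders over the earlier sources, so
    it may be integrated while they are frozen. *)
Lemma independent_prod n (f : nat -> T -> R) :
  (forall i, (i < n)%N -> forall A, measurable A -> G i (f i @^-1` A)) ->
  (forall i w, 0 <= f i w)%R ->
  \int[P]_w (\prod_(i < n) f i w)%:E = \prod_(i < n) \int[P]_w (f i w)%:E.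
Proof.
elim: n => [|n IH] fG f0.
  rewrite big_ord0; under eq_integral do rewrite big_ord0.
  by have := expectation_cst P 1%R; rewrite unlock; apply.
pose p i := (i < n)%N; pose q i := i == n.
have mp : measurable_fun setT ((fun w => \prod_(i < n) f i w)%R :
    g_sigma_algebraType (cylinders p n.+1) -> R).
  rewrite (_ : (fun w => _) = fun w => (\prod_(i <- index_enum 'I_n) f i w)%R)//.
  apply: measurable_prod => i _ /=.
  apply: (@measurable_cylinders _ _ i) => //; [by rewrite ltnS ltnW|exact: ltn_ord|].
  by apply: fG; rewrite ltnS ltnW.
have mq : measurable_fun setT (f n : g_sigma_algebraType (cylinders q n.+1) -> R).
  by apply: (@measurable_cylinders _ _ n) => //; [rewrite /q|exact: fG].
have prod0 w : (0 <= \prod_(i < n) f i w)%R by apply: prodr_ge0.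
pose F (z : g_sigma_algebraType (cylinders p n.+1) * g_sigma_algebraType (cylinders q n.+1)) :=
  ((\prod_(i < n) f i z.1) * f n z.2)%:E.
transitivity (\int[P]_w F (w, w)).
  by apply: eq_integral => w _; rewrite big_ord_recr.
rewrite (@freezing _ _ _ _ (cylinders p n.+1) (cylinders q n.+1)) //; first last.
- by move=> z; rewrite lee_fin mulr_ge0.
- apply/measurable_EFinP; apply: measurable_funM.
    exact: (measurableT_comp mp (@measurable_fst _ _ _ _)).
  exact: (measurableT_comp mq (@measurable_snd _ _ _ _)).
- move=> A B; apply: cylinders_independent => i; rewrite /p /q.
  by case: eqVneq => [->|]; rewrite ?ltnn// andbF.
- exact: cylindersT.
- exact: cylindersT.
- exact: cylindersI.
- exact: cylindersI.
- exact: cylinders_measurable.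
- exact: cylinders_measurable.
have mf i : (i < n.+1)%N -> measurable_fun setT (f i : T -> R).
  by move=> ni _ A mA; rewrite setTI; apply: (mG (fG _ _ _ mA)).
have mp' : measurable_fun setT (fun w : T => \prod_(i < n) f i w)%R.
  rewrite (_ : (fun w => _) = fun w => (\prod_(i <- index_enum 'I_n) f i w)%R)//.
  by apply: measurable_prod => i _; apply: mf; rewrite ltnS ltnW.
under eq_integral => y _.
  rewrite /F/=; under eq_integral do rewrite EFinM.
  rewrite ge0_integralZr//; last 3 first.
  - exact/measurable_EFinP.
  - by move=> x _; rewrite lee_fin.
  - by rewrite lee_fin.
  over.
rewrite ge0_integralZl//; last 3 first.
- by apply/measurable_EFinP; apply: mf.
- by move=> x _; rewrite lee_fin.
- by apply: integral_ge0 => x _; rewrite lee_fin.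
rewrite IH; first by rewrite big_ord_recr.
  by move=> i ni; apply: fG; rewrite ltnS ltnW.
by [].
Qed.

End independent_sequence.

(** * Expectations *)

Section nonmeasurable.
Local Open Scope ereal_scope.
Context d (T : measurableType d) (R : realType) (mu : {measure set T -> \bar R}).

(** The integral of a nonnegative function is a supremum over the simple functions
    below it, which makes sense and is monotone without measurability. *)
Lemma ge0_le_integral_nonmeasurable (f g : T -> \bar R) :
  (forall x, 0 <= f x) -> (forall x, f x <= g x) ->
  \int[mu]_x f x <= \int[mu]_x g x.
Proof.
move=> f0 fg; have g0 x : 0 <= g x by exact: le_trans (fg x).
rewrite !ge0_integralTE//; apply: ub_ereal_sup => _ [h hf <-].
by apply: ereal_sup_ubound; exists h => // x; apply: le_trans (fg x).
Qed.

(** The function f, measurable or not, is squeezed between the measurable functions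
    that equal g outside a null set and are 0 or +oo on it. *)
Lemma ge0_ae_eq_integral_nonmeasurable (f g : T -> \bar R) :
  (forall x, 0 <= f x) -> (forall x, 0 <= g x) -> measurable_fun setT g ->
  {ae mu, forall x, f x = g x} -> \int[mu]_x f x = \int[mu]_x g x.
Proof.
move=> f0 g0 mg [N [mN N0 subN]].
have mb : measurable_fun setT (fun x => x \in N).
  by apply: (measurable_fun_bool true); rewrite setTI preimage_mem_true.
have H c : 0 <= c -> \int[mu]_x (if x \in N then c else g x) = \int[mu]_x g x.
  move=> c0; apply: ge0_ae_eq_integral => //.
  - by apply: measurable_fun_ifT => //; exact: measurable_cst.
  - by move=> x _; case: ifP.
  - exists N; split => // x /= /not_implyP[_]; case: ifPn => //.
    by rewrite inE.
have fgN x : x \notin N -> f x = g x.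
  by move=> xN; apply: contrapT => fg; move/negP: xN; apply; rewrite inE; exact: subN.
apply/eqP; rewrite eq_le; apply/andP; split.
  rewrite -(H +oo)//; apply: ge0_le_integral_nonmeasurable => // x.
  by case: ifPn => [_|/fgN ->//]; rewrite leey.
rewrite -(H 0)//; apply: ge0_le_integral_nonmeasurable => [x|x].
  by case: ifP.
by case: ifPn => [//|/fgN ->].
Qed.

End nonmeasurable.

Section discrete.
Local Open Scope ereal_scope.
Context d (T : measurableType d) (R : realType) (P : {measure set T -> \bar R}).

Lemma measurable_natb (b : T -> bool) : measurable_fun setT b ->
  measurable_fun setT (fun w => (b w)%:R : R).
Proof.
move=> mb; rewrite (_ : (fun w => _) = fun w => if b w then 1%R else 0%R).
  by apply: measurable_fun_ifT => //; exact: measurable_cst.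
by apply/funext => w; case: (b w).
Qed.

Lemma ge0_integralZl_real (c : R) (f : T -> R) : (0 <= c)%R -> measurable_fun setT f ->
  (forall w, 0 <= f w)%R -> \int[P]_w (c * f w)%:E = c%:E * \int[P]_w (f w)%:E.
Proof.
move=> c0 mf f0; under eq_integral do rewrite EFinM.
apply: ge0_integralZl => //; first exact/measurable_EFinP.
by move=> w _; rewrite lee_fin.
Qed.

Lemma measurable_fiber (Y : T -> nat) k : measurable_fun setT Y ->
  measurable [set w | Y w = k].
Proof. by move=> mY; rewrite -[X in measurable X]setTI; exact: (mY measurableT [set k]). Qed.

Lemma measurable_sublevel (Y : T -> R) (u : R) : measurable_fun setT Y ->
  measurable [set w | (Y w <= u)%R].
Proof.
move=> mY; rewrite -[X in measurable X]setTI (_ : [set w | _] = Y @^-1` `]-oo, u]%classic).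
  exact: mY.
by apply/seteqP; split => w /=; rewrite in_itv.
Qed.

Lemma integral_fiber (Y : T -> nat) k : measurable_fun setT Y ->
  \int[P]_w ((Y w == k)%:R : R)%:E = P [set w | Y w = k].
Proof.
move=> mY; have mS := measurable_fiber k mY.
rewrite -[X in P X]setIT -integral_indic//; apply: eq_integral => w _.
rewrite indicE; case: eqVneq => [e|/eqP ne]; first by rewrite mem_set.
by rewrite memNset.
Qed.

Lemma ge0_integral_real (f : T -> R) : (forall w, 0 <= f w)%R -> 0 <= \int[P]_w (f w)%:E.
Proof. by move=> f0; apply: integral_ge0 => w _; rewrite lee_fin. Qed.

Lemma ge0_le_integral_real (f g : T -> R) : (forall w, 0 <= f w)%R -> (forall w, f w <= g w)%R ->
  \int[P]_w (f w)%:E <= \int[P]_w (g w)%:E.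
Proof.
by move=> f0 fg; apply: ge0_le_integral_nonmeasurable => w; rewrite lee_fin.
Qed.

Lemma sum_indicator (f : R) (k n : nat) :
  (\sum_(0 <= i < n) f * (k == i)%:R = f * (k < n)%N%:R)%R.
Proof.
elim: n => [|n IH]; first by rewrite big_geq// mulr0.
rewrite big_nat_recr//= IH -mulrDr -natrD; congr (_ * _%:R)%R.
by rewrite ltnS; case: ltngtP.
Qed.

Lemma nneseries_indicator (f : R) (k : nat) :
  \sum_(n <oo) (f * (k == n)%:R)%:E = f%:E.
Proof.
apply/cvg_lim => //; apply: cvg_near_cst.
near=> n; rewrite sumEFin sum_indicator.
have -> : (k < n)%N by near: n; exact: nbhs_infty_gt.
by rewrite mulr1.
Unshelve. all: by end_near.
Qed.

Lemma integral_fibers (X : T -> nat) (f : T -> R) :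
  measurable_fun setT X -> measurable_fun setT f -> (forall w, 0 <= f w)%R ->
  \int[P]_w (f w)%:E = \sum_(n <oo) \int[P]_w (f w * (X w == n)%:R)%:E.
Proof.
move=> mX mf f0; rewrite -integral_nneseries//.
- by apply: eq_integral => w _; rewrite nneseries_indicator.
- move=> n; apply/measurable_EFinP; apply: measurable_funM => //.
  apply: measurable_natb.
  exact: (measurable_fun_eqn mX (measurable_cst n)).
- by move=> n w _; rewrite lee_fin mulr_ge0.
Qed.

Lemma measurable_preimage_countable (C : countType) (X : T -> C) (B : set C) :
  (forall c, measurable [set w | X w = c]) -> measurable (X @^-1` B).
Proof.
move=> mX; rewrite (_ : _ @^-1` B = \bigcup_c [set w | B c /\ X w = c]).
  apply: countable_bigcupT_measurable => // c.
  have [Bc|Bc] := pselect (B c).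
    rewrite (_ : [set _ | _] = [set w | X w = c])//.
    by apply/seteqP; split => w //= -[].
  by rewrite (_ : [set _ | _] = set0)//; apply/seteqP; split => w // -[].
by apply/seteqP; split => [w /= Bw|w [c _ /= [Bc Xc]]]; [exists (X w)|rewrite Xc].
Qed.

Lemma measurable_all_neq (Y : nat -> T -> nat) (Z : T -> nat) :
  (forall m, measurable_fun setT (Y m)) -> measurable_fun setT Z ->
  measurable [set w | forall m, Y m w <> Z w].
Proof.
move=> mY mZ; rewrite (_ : [set w | _] = \bigcap_m ~` [set w | Y m w == Z w]).
  apply: bigcapT_measurable => m; apply: measurableC.
  rewrite -[X in measurable X]setTI.
  have h : measurable_fun setT (fun w => Y m w == Z w) by exact: measurable_fun_eqn.
  exact: (h measurableT [set true] Logic.I).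
by apply/seteqP; split => w /= h m; [move=> _ /eqP; exact: h|move=> /eqP; exact: h].
Qed.

(** The event A (X w) is a countable union of fibers of X. *)
Lemma eq_integral_fibers (C : countType) (X : T -> C) (f g : T -> R) (A : pred C) :
  (forall c, measurable [set w | X w = c]) ->
  measurable_fun setT f -> measurable_fun setT g ->
  (forall w, 0 <= f w)%R -> (forall w, 0 <= g w)%R ->
  (forall c, \int[P]_w (f w * (X w == c)%:R)%:E = \int[P]_w (g w * (X w == c)%:R)%:E) ->
  \int[P]_w (f w * (A (X w))%:R)%:E = \int[P]_w (g w * (A (X w))%:R)%:E.
Proof.
move=> mX mf mg f0 g0 fg.
have mXA (B : set C) := measurable_preimage_countable B mX.
have mXp : measurable_fun setT (fun w => pickle (X w)).
  by move=> _ B _; rewrite setTI; exact: (mXA (pickle @^-1` B)).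
have mAX : measurable_fun setT (fun w => A (X w)).
  by move=> _ B _; rewrite setTI; exact: (mXA (A @^-1` B)).
have step (h : T -> R) : measurable_fun setT h -> (forall w, 0 <= h w)%R ->
   \int[P]_w (h w * (A (X w))%:R)%:E = \sum_(n <oo)
     \int[P]_w (h w * (A (X w))%:R * (pickle (X w) == n)%:R)%:E.
  move=> mh h0; apply: (integral_fibers mXp).
    by apply: measurable_funM => //; exact: measurable_natb.
  by move=> w; rewrite mulr_ge0.
rewrite !step//; apply: eq_eseriesr => n _.
have [[c <-]|nc] := pselect (exists c : C, pickle c = n); last first.
  have z w : (pickle (X w) == n) = false by apply/negP => /eqP h; apply: nc; exists (X w).
  by apply: eq_integral => w _; rewrite z !mulr0.
have z w : (pickle (X w) == pickle c) = (X w == c) by rewrite (inj_eq (pcan_inj pickleK)).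
have [Ac|Ac] := boolP (A c).
  transitivity (\int[P]_w (f w * (X w == c)%:R)%:E).
    by apply: eq_integral => w _; rewrite z; case: eqVneq => [->|_]; rewrite ?mulr0// Ac !mulr1.
  rewrite fg; apply: eq_integral => w _; rewrite z.
  by case: eqVneq => [->|_]; rewrite ?mulr0// Ac !mulr1.
apply: eq_integral => w _; rewrite z.
by case: eqVneq => [->|_]; rewrite ?mulr0// (negbTE Ac) !mulr0 !mul0r.
Qed.

End discrete.

Section laws.
Local Open Scope ereal_scope.
Context d (T : measurableType d) (R : realType) (P : probability T R).

Lemma integral_same_law d' (U : measurableType d') (X Y : {RV P >-> U}) (f : U -> \bar R) :
  (forall A, measurable A -> P (X @^-1` A) = P (Y @^-1` A)) ->
  measurable_fun setT f -> (forall u, 0 <= f u) ->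
  \int[P]_w f (X w) = \int[P]_w f (Y w).
Proof.
move=> XY mf f0; rewrite -(ge0_integral_distribution X)// -(ge0_integral_distribution Y)//.
by apply: eq_measure_integral => A mA _; exact: XY.
Qed.

Lemma same_law_cdf (X Y : {RV P >-> R}) :
  (forall u : R, P [set w | (X w <= u)%R] = P [set w | (Y w <= u)%R]) ->
  forall A, measurable A -> P (X @^-1` A) = P (Y @^-1` A).
Proof.
move=> XY A mA.
change (distribution P X A = distribution P Y A).
pose G := [set B : set R | exists x, B = `]x, +oo[%classic].
have GR : @measurable _ R = <<s G >>.
  by have := RGenOInfty.measurableE R.
have gt u (Z : {RV P >-> R}) : distribution P Z `]u, +oo[ = 1 - P [set w | (Z w <= u)%R].
  rewrite -probability_setC.
    congr (P _); apply/seteqP; split => w /=; rewrite in_itv/= andbT ltNge; by move/negP.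
  rewrite (_ : [set _ | _] = Z @^-1` `]-oo, u]%classic).
    by rewrite -[_ @^-1` _]setTI; exact: measurable_funP.
  by apply/seteqP; split => w /=; rewrite in_itv.
apply: (@g_sigma_algebra_measure_unique _ R _ G _ (fun n => `](- n%:R)%R, +oo[%classic)) => //.
- by move=> _ [x ->]; exact: measurable_itv.
- by move=> n; exists (- n%:R)%R.
- apply/seteqP; split => // x _; have [n xn] : exists n : nat, (- x < n%:R)%R.
    by exists (Num.truncn `|x|).+1; rewrite (le_lt_trans (ler_norm _))// normrN truncnS_gt.
  by exists n => //=; rewrite in_itv/= andbT ltrNl.
- move=> _ _ [x ->] [y ->]; exists (Num.max x y).
  apply/seteqP; split => z /=; rewrite !in_itv/= !andbT gt_max.
    by move=> [-> ->].
  by move=> /andP[-> ->].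
- by move=> _ [x ->]; rewrite [LHS]gt [RHS]gt XY.
- by move=> n; rewrite ltey_eq fin_num_measure//; exact: measurable_itv.
- by rewrite -GR.
Qed.

(** The tail of Y at u is p times the tail of X at x + u, hence at most p times the
    tail of X at u; the means are the integrals of the tails. *)
Lemma mean_residual (X Y : {RV P >-> R}) (x p : R) :
  (forall w, 0 <= X w)%R -> (forall w, 0 <= Y w)%R -> (0 <= x)%R -> (0 <= p)%R ->
  (forall u : R, (0 <= u)%R ->
    P [set w | (Y w > u)%R] = P [set w | (X w > x + u)%R] * p%:E) ->
  'E_P[Y] <= 'E_P[X] * p%:E.
Proof.
move=> X0 Y0 x0 p0 YX; rewrite !ge0_expectation_ccdf// -ge0_integralZr//; last first.
  by apply: measurable_funTS; exact: ccdf_measurable.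
apply: ge0_le_integral => //.
- by apply: measurable_funTS; exact: ccdf_measurable.
- apply: emeasurable_funM; last exact: measurable_cst.
  by apply: measurable_funTS; exact: ccdf_measurable.
move=> u /=; rewrite in_itv/= andbT => u0.
have E (Z : {RV P >-> R}) v : ccdf Z v = P [set w | (Z w > v)%R].
  by congr (P _); apply/seteqP; split => w /=; rewrite in_itv/= andbT.
rewrite [leLHS]E YX// -E; apply: lee_wpmul2r; first by rewrite lee_fin.
by apply: ccdf_nonincreasing; rewrite lerDr.
Qed.

Definition elaplace (Y : T -> \bar R) (s : R) : T -> R :=
  fun w => (expR (- (s * fine (Y w))) * (Y w < +oo)%E%:R)%R.

Lemma measurable_elaplace (Y : T -> \bar R) s : measurable_fun setT Y ->
  measurable_fun setT (elaplace Y s).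
Proof.
move=> mY; apply: measurable_funM.
  apply: measurableT_comp => //; apply: measurableT_comp => //.
  by apply: measurable_funM => //; apply: measurableT_comp.
by apply: measurable_natb; apply: measurable_fun_lte => //; exact: measurable_cst.
Qed.

Let mgf_step (y : R) n : (2 ^+ n * (1 - expR (- (2 ^- n * y))) <=
  2 ^+ n.+1 * (1 - expR (- (2 ^- n.+1 * y))))%R.
Proof.
have e : (2 ^- n * y = 2 ^- n.+1 * y + 2 ^- n.+1 * y :> R)%R.
  by rewrite exprS invfM; field; rewrite expf_neq0.
rewrite e opprD expRD exprS -mulrA mulrCA; apply: ler_wpM2l.
  by rewrite exprn_ge0.
set z := expR _; have := sqr_ge0 (1 - z)%R; rewrite expr2; nra.
Qed.

Let mgf_lim (y : R) : (0 <= y)%R ->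
  (fun n => 2 ^+ n * (1 - expR (- (2 ^- n * y))))%R @ \oo --> y.
Proof.
move=> y0.
have h2 : (fun n => (2 ^- n * y)%R) @ \oo --> 0%R.
  have -> : (fun n => (2 ^- n * y)%R) = geometric y 2^-1.
    by apply/funext => n; rewrite /geometric/= exprVn mulrC.
  by apply: cvg_geometric; rewrite ger0_norm ?invr_ge0// invf_lt1// ltr1n.
apply: (@squeeze_cvgr _ _ _ _ (fun n => y / (1 + 2 ^- n * y))%R (cst y)).
- near=> n.
  have z0 : (0 <= 2 ^- n * y)%R by rewrite mulr_ge0// invr_ge0 ltW.
  have hy : (y = 2 ^+ n * (2 ^- n * y))%R by rewrite mulrA divff ?mul1r// gt_eqF.
  set z := (2 ^- n * y)%R in z0 hy *; rewrite {1 2}hy.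
  rewrite -mulrA !ler_pM2l//.
  have e1 := expR_ge1Dx z; have e2 := expR_ge1Dx (- z)%R.
  apply/andP; split; last by lra.
  rewrite expRN ler_pdivrMr; last by lra.
  have zp : (0 < expR z)%R by exact: expR_gt0.
  have : ((expR z)^-1 * (1 + z) <= 1)%R by rewrite mulrC ler_pdivrMr// mul1r.
  by nra.
- rewrite -[X in _ --> X]divr1; apply: cvgM; first exact: cvg_cst.
  apply: cvgV; first by rewrite oner_neq0.
  by rewrite -[X in _ --> X]addr0; apply: cvgD => //; exact: cvg_cst.
- exact: cvg_cst.
Unshelve. all: by end_near.
Qed.

(** The expectation is minus the slope at 0 of the Laplace transform; along
    s = 2^-n the difference quotients increase, so that monotone convergence applies. *)
Lemma laplace_slope (Y : T -> \bar R) : measurable_fun setT Y -> (forall w, 0 <= Y w) ->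
  (fun n => (2 ^+ n)%:E * (1 - \int[P]_w (elaplace Y (2 ^- n) w)%:E)) @ \oo -->
    \int[P]_w Y w.
Proof.
move=> mY Y0.
pose g n w : \bar R := (2 ^+ n * (1 - elaplace Y (2 ^- n) w))%:E.
have ml s := measurable_elaplace s mY.
have l0 s w : (0 <= elaplace Y s w)%R by rewrite mulr_ge0// expR_ge0.
have l1 n w : (elaplace Y (2 ^- n) w <= 1)%R.
  rewrite /elaplace -[leRHS]mulr1 ler_pM// ?expR_ge0//; last by case: (_ < _).
  by rewrite -expR0 ler_expR oppr_le0 mulr_ge0// ?invr_ge0 ?exprn_ge0// fine_ge0.
have mg n : measurable_fun setT (g n).
  by apply/measurable_EFinP; apply: measurable_funM => //; apply: measurable_funB.
have -> : (fun n => (2 ^+ n)%:E * (1 - \int[P]_w (elaplace Y (2 ^- n) w)%:E)) =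
    (fun n => \int[P]_w g n w).
  apply/funext => n; rewrite /g; under [RHS]eq_integral do rewrite EFinM.
  rewrite ge0_integralZl//; last 2 first.
  - by apply/measurable_EFinP; apply: measurable_funB.
  - by move=> w _; rewrite lee_fin subr_ge0.
  congr (_ * _).
  have e : \int[P]_w (1 - elaplace Y (2 ^- n) w)%:E + \int[P]_w (elaplace Y (2 ^- n) w)%:E = 1.
    rewrite -ge0_integralD//.
    - under eq_integral do rewrite -EFinD subrK.
      by have := expectation_cst P 1%R; rewrite unlock; apply.
    - by move=> w _; rewrite lee_fin subr_ge0.
    - by apply/measurable_EFinP; apply: measurable_funB.
    - by move=> w _; rewrite lee_fin.
    - exact/measurable_EFinP.
  have fl : \int[P]_w (elaplace Y (2 ^- n) w)%:E \is a fin_num.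
    rewrite ge0_fin_numE; last by apply: integral_ge0 => w _; rewrite lee_fin.
    rewrite (le_lt_trans _ (ltry 1))// -e leeDr//.
    by apply: integral_ge0 => w _; rewrite lee_fin subr_ge0.
  by rewrite -e addeK.
have gY w : g ^~ w @ \oo --> Y w.
  rewrite /g /elaplace; have := Y0 w; case: (Y w) => [y| |]//=; last first.
    move=> _; under eq_fun do rewrite mulr0 subr0.
    apply/cvgeryP/cvgryPge => A; near=> n.
    apply: (@le_trans _ _ n%:R); first by near: n; exact: nbhs_infty_ger.
    by rewrite mulr1 -natrX ler_nat ltnW// ltn_expl.
  rewrite lee_fin => y0; under eq_fun do rewrite ltry mulr1.
  by apply/fine_cvgP; split; [near=> n|exact: mgf_lim].
have -> : \int[P]_w Y w = \int[P]_w limn (g ^~ w).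
  by apply: eq_integral => w _; apply/esym/cvg_lim.
apply: cvg_monotone_convergence => //.
- by move=> n w _; rewrite lee_fin mulr_ge0// ?exprn_ge0// subr_ge0.
- move=> w _; apply/nondecreasing_seqP => n; rewrite lee_fin /elaplace.
  case: (Y w) => [y| |]/=; rewrite ?ltry ?ltNyr ?mulr1 ?ltxx ?mulr0 ?subr0 ?mulr1.
  + exact: mgf_step.
  + by rewrite exprS ler_peMl ?exprn_ge0// ler1n.
  + by rewrite oppr0 expR0 subrr !mulr0.
Unshelve. all: by end_near.
Qed.

End laws.

Section integral_series.
Local Open Scope ereal_scope.
Context d (T : measurableType d) (R : realType) (P : {measure set T -> \bar R}).

Lemma ge0_integral_series (h : nat -> T -> R) (H : T -> R) :
  (forall k, measurable_fun setT (h k)) -> (forall k w, 0 <= h k w)%R ->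
  (forall w, series (h ^~ w) @ \oo --> H w) -> \int[P]_w (H w)%:E < +oo ->
  series (fun k => fine (\int[P]_w (h k w)%:E)) @ \oo --> fine (\int[P]_w (H w)%:E).
Proof.
move=> mh h0 hH Hoo.
have HE w : (H w)%:E = \sum_(k <oo) (h k w)%:E.
  apply/esym/cvg_lim => //.
  rewrite (_ : (fun n => _) = EFin \o series (h ^~ w)).
    by apply/fine_cvgP; split; [near=> n|exact: hH].
  by apply/funext => n; rewrite /series /= sumEFin.
have e : \int[P]_w (H w)%:E = \sum_(k <oo) \int[P]_w (h k w)%:E.
  under eq_integral do rewrite HE.
  rewrite integral_nneseries// => k; first exact/measurable_EFinP.
  by move=> w _; rewrite lee_fin.
have i0 k : 0 <= \int[P]_w (h k w)%:E.
  by apply: integral_ge0 => w _; rewrite lee_fin.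
have ifin k : \int[P]_w (h k w)%:E \is a fin_num.
  rewrite ge0_fin_numE// (le_lt_trans _ Hoo)//.
  apply: ge0_le_integral_real => // w.
  apply: le_trans (series_cvg_le k.+1 (h0^~ w) (hH w)).
  by rewrite seriesSr lerDr series_ge0.
have := @is_cvg_nneseries R (fun k => \int[P]_w (h k w)%:E) xpredT 0%N (fun n _ _ => i0 n).
move=> /cvg_ex[/= l hl]; have hl' := cvg_lim (@ereal_hausdorff R) hl.
rewrite -e in hl'; rewrite -hl' in hl.
rewrite (_ : series _ = fine \o (fun n => \sum_(0 <= i < n) \int[P]_w (h i w)%:E)).
  apply: fine_cvg; rewrite fineK//.
  by rewrite ge0_fin_numE// e nneseries_ge0.
apply/funext => n /=; transitivity (fine (\sum_(0 <= i < n) (fine (\int[P]_w (h i w)%:E))%:E)).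
  by rewrite sumEFin.
by congr fine; apply: eq_bigr => k _; rewrite fineK.
Unshelve. all: by end_near.
Qed.

(** Integration term by term of a power series on [-1, 1]: the terms of
    (1 + t^k) f k are nonnegative, whatever the sign of t. *)
Lemma integral_power_series (f : nat -> T -> R) (F G : T -> R) (t : R) :
  (`|t| <= 1)%R ->
  (forall k, measurable_fun setT (f k)) -> (forall k w, 0 <= f k w)%R ->
  measurable_fun setT F -> measurable_fun setT G ->
  (forall w, series (f ^~ w) @ \oo --> F w) ->
  (forall w, series (scaled t (f ^~ w)) @ \oo --> G w) -> \int[P]_w (F w)%:E < +oo ->
  series (scaled t (fun k => fine (\int[P]_w (f k w)%:E))) @ \oo -->
    fine (\int[P]_w (G w)%:E).
Proof.
move=> t1 mf f0 mF mG fF fG Foo.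
have F0 w : (0 <= F w)%R.
  by apply: (cvgr_to_ge (fF w)); near=> n; apply: series_ge0.
have FG w : (`|G w| <= F w)%R.
  have h : (fun n => `|series (scaled t (f ^~ w)) n|)%R @ \oo --> `|G w|%R.
    exact: cvg_norm.
  apply: (ler_cvg_to h (fF w)); near=> n.
  apply: le_trans (ler_norm_sum _ _ _) _; apply: ler_sum => k _.
  rewrite /scaled normrM (ger0_norm (f0 _ _)) ler_piMl// normrX exprn_ile1//.
have s0 k : (0 <= 1 + t ^+ k)%R.
  have : (`|t ^+ k| <= 1)%R by rewrite normrX exprn_ile1.
  by rewrite ler_norml => /andP[? _]; lra.
have iF : P.-integrable setT (EFin \o F).
  apply/integrableP; split; first exact/measurable_EFinP.
  by under eq_integral => w _ do rewrite /= ger0_norm//.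
have iG : P.-integrable setT (EFin \o G).
  by apply: (le_integrable measurableT _ _ iF) => [|w _];
    [exact/measurable_EFinP|rewrite /= lee_fin (ger0_norm (F0 w))].
have FGE : \int[P]_w (F w + G w)%:E = \int[P]_w (F w)%:E + \int[P]_w (G w)%:E.
  exact: (integralD measurableT iF iG).
have fF1 := integrable_fin_num measurableT iF.
have fG1 := integrable_fin_num measurableT iG.
have i0 k : 0 <= \int[P]_w (f k w)%:E.
  by apply: integral_ge0 => w _; rewrite lee_fin.
have h1 := ge0_integral_series mf f0 fF Foo.
have h2 : series (fun k => fine (\int[P]_w ((1 + t ^+ k) * f k w)%:E)) @ \oo -->
    fine (\int[P]_w (F w + G w)%:E).
  apply: (@ge0_integral_series (fun k w => (1 + t ^+ k) * f k w)%R (fun w => F w + G w)%R).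
  - by move=> k; apply: measurable_funM.
  - by move=> k w; rewrite mulr_ge0.
  - move=> w.
    rewrite (_ : series _ = (fun n => series (f ^~ w) n + series (scaled t (f ^~ w)) n)%R).
      by apply: cvgD.
    apply/funext => n; rewrite /series/= -big_split/=; apply: eq_bigr => k _.
    by rewrite mulrDl mul1r.
  - by rewrite FGE lte_add_pinfty// ltey_eq ?fF1 ?fG1.
have fk k w : (f k w <= F w)%R.
  apply: le_trans (series_cvg_le k.+1 (f0^~ w) (fF w)).
  by rewrite seriesSr lerDr series_ge0.
have ifin k : \int[P]_w (f k w)%:E \is a fin_num.
  rewrite ge0_fin_numE// (le_lt_trans _ Foo)//.
  exact: ge0_le_integral_real.
have -> : series (scaled t (fun k => fine (\int[P]_w (f k w)%:E))) =
    (fun n => series (fun k => fine (\int[P]_w ((1 + t ^+ k) * f k w)%:E)) n -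
     series (fun k => fine (\int[P]_w (f k w)%:E)) n)%R.
  apply/funext => n; rewrite /series/= -sumrB; apply: eq_bigr => k _.
  rewrite ge0_integralZl_real//.
  by rewrite fineM// /scaled/= mulrDl mul1r addrAC subrr add0r.
suff <- : (fine (\int[P]_w (F w + G w)%:E) - fine (\int[P]_w (F w)%:E) =
    fine (\int[P]_w (G w)%:E))%R by exact: cvgB.
by rewrite FGE fineD// addrAC subrr add0r.
Unshelve. all: by end_near.
Qed.

End integral_series.

(** * The compound Poisson process *)

Section right_continuous_process.
Context d d' (T : measurableType d) (U : measurableType d') (R : realType).
Variable X : R -> T -> nat.
Hypothesis mX : forall t, 0 <= t -> measurable_fun setT (X t).
Hypothesis X_nd : forall w (t u : R), 0 <= t -> t <= u -> (X t w <= X u w)%N.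
Hypothesis X_rc : forall w (t : R), 0 <= t ->
  exists2 e : R, 0 < e & forall u, t <= u < t + e -> X u w = X t w.

(** By monotonicity and right-continuity, X t <= k if and only if X q <= k for
    some rational q > t; so the process may be stopped at a random time. *)
Lemma measurable_process_at (tau : U -> R) : measurable_fun setT tau ->
  (forall u, 0 <= tau u) -> measurable_fun setT (fun z : T * U => X (tau z.2) z.1).
Proof.
move=> mtau tau0.
have mle k : measurable [set z : T * U | (X (tau z.2) z.1 <= k)%N].
  rewrite (_ : [set z | _] = \bigcup_(q : rat)
      ([set w | 0 <= (ratr q : R) /\ (X (ratr q) w <= k)%N] `*` [set u | tau u < ratr q])).
    apply: countable_bigcupT_measurable => // q; apply: measurableX.
      have [q0|q0] := leP 0 (ratr q : R).
        rewrite (_ : [set w | _] = X (ratr q) @^-1` [set n | (n <= k)%N]).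
          by rewrite -[_ @^-1` _]setTI; exact: mX.
        by apply/seteqP; split => w //= -[].
      rewrite (_ : [set w | _] = set0)//.
      by apply/seteqP; split => w //= -[].
    have := measurable_fun_ltr mtau (measurable_cst (ratr q : R)).
    move=> /(_ measurableT [set true]); rewrite setTI.
    rewrite (_ : _ @^-1` _ = [set u | tau u < ratr q]); first exact.
    by apply/seteqP; split => u /=.
  apply/seteqP; split => [[w u]/= Xk|[w u] [q _ /= [[q0 Xk] tq]]].
    have [e e0 Xe] := X_rc w (tau0 u).
    have /rat_in_itvoo[q] : tau u < tau u + e by rewrite ltrDl.
    rewrite in_itv/= => /andP[tq qe]; exists q => //=; split => //; split.
      by rewrite (le_trans (tau0 u))// ltW.
    by rewrite Xe// (ltW tq).
  by apply: leq_trans Xk; apply: X_nd => //; exact: ltW.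
move=> _ A _; rewrite setTI.
rewrite (_ : _ @^-1` A = \bigcup_(k in A) [set z : T * U | X (tau z.2) z.1 = k]).
  apply: bigcup_measurable => -[|k] _.
    rewrite (_ : [set z | _] = [set z : T * U | (X (tau z.2) z.1 <= 0)%N])//.
    by apply/seteqP; split => z /=; rewrite leqn0 => /eqP.
  rewrite (_ : [set z | _] = [set z : T * U | (X (tau z.2) z.1 <= k.+1)%N] `\`
     [set z : T * U | (X (tau z.2) z.1 <= k)%N]); first exact: measurableD.
  apply/seteqP; split => z /=; first by move=> ->; rewrite leqnn ltnn.
  by move=> [h1 h2]; apply/eqP; rewrite eqn_leq h1 ltnNge; apply/negP.
by apply/seteqP; split => [z /= Az|z [k Ak /= ->]//]; exists (X (tau z.2) z.1).
Qed.

End right_continuous_process.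

Section compound_poisson.
Context d (T : measurableType d) (R : realType) (P : probability T R).
Variables (mu : R) (kappa : {RV P >-> nat}) (X : R -> {RV P >-> nat}).
Hypothesis HX : compound_poisson mu kappa X.

Definition poisson_mass (t : R) (k : nat) : R := fine (P [set w | X t w = k]).

Let mE (Y : {RV P >-> nat}) k : measurable [set w | Y w = k].
Proof. exact: measurable_fiber (measurable_funP Y). Qed.

Lemma pgf_series (Y : T -> nat) (t : R) : measurable_fun setT Y -> `|t| <= 1 ->
  series (scaled t (fun k => fine (P [set w | Y w = k]))) @ \oo -->
    fine ('E_P[fun w => (t ^+ Y w)%R])%E.
Proof.
move=> mY t1.
have mYk k : measurable_fun setT (fun w => (Y w == k)%:R : R).
  by apply: measurable_natb; exact: (measurable_fun_eqn mY (measurable_cst k)).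
have := @integral_power_series _ T R P (fun k w => (Y w == k)%:R) (cst 1)
  (fun w => t ^+ Y w) t t1 mYk.
rewrite (_ : (fun k => fine (P _)) = (fun k => fine (\int[P]_w ((Y w == k)%:R)%:E)%E)).
  rewrite unlock; apply.
  - by move=> k w.
  - exact: measurable_cst.
  - by move=> _ A _; rewrite setTI; have := mY measurableT ((fun n => t ^+ n) @^-1` A) Logic.I;
    rewrite setTI.
  - move=> w; apply: cvg_near_cst; near=> n; rewrite /series/=.
    rewrite (eq_bigr (fun k => 1 * (Y w == k)%:R)); last by move=> k _; rewrite mul1r.
    rewrite sum_indicator.
    have -> : (Y w < n)%N by near: n; exact: nbhs_infty_gt.
    by rewrite mulr1.
  - move=> w; apply: cvg_near_cst; near=> n; rewrite /series/=.
    rewrite (eq_bigr (fun k => t ^+ Y w * (Y w == k)%:R)).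
      rewrite sum_indicator.
      have -> : (Y w < n)%N by near: n; exact: nbhs_infty_gt.
      by rewrite mulr1.
    by move=> k _; rewrite /scaled; case: eqVneq => [->|]; rewrite ?mulr0.
  - by have := expectation_cst P 1; rewrite unlock => ->; rewrite ltry.
by apply/funext => k; rewrite integral_fiber.
Unshelve. all: by end_near.
Qed.

Lemma poisson_mass_series t theta : 0 <= t -> `|theta| <= 1 ->
  series (scaled theta (poisson_mass t)) @ \oo --> expR (t * cumulant P mu kappa theta).
Proof.
move=> t0 th1; have := pgf_series (measurable_funP (X t)) th1.
have := cp_increments HX (lexx 0) t0 th1.
have -> : (fun w => theta ^+ (X t w - X 0 w)) = (fun w => theta ^+ X t w).
  by apply/funext => w; rewrite (cp_start HX) subn0.
by move=> ->; rewrite subr0.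
Qed.

(** The generating function of an increment on [-1, 1] determines its law. *)
Lemma increment_law t u k : 0 <= t -> t <= u ->
  P [set w | (X u w - X t w)%N = k] = (poisson_mass (u - t) k)%:E.
Proof.
move=> t0 tu; have ut0 : 0 <= u - t by rewrite subr_ge0.
have mY : measurable_fun setT (fun w => (X u w - X t w)%N) by apply: measurable_fun_subn.
suff <- : (fun k => fine (P [set w | (X u w - X t w)%N = k])) = poisson_mass (u - t).
  by rewrite fineK// fin_num_measure//; exact: measurable_fiber.
apply: (@power_series_unique _ 1 _ _
    (fun theta => expR ((u - t) * cumulant P mu kappa theta))) => // theta /ltW th1.
  by have := pgf_series mY th1; rewrite (cp_increments HX t0 tu th1).
exact: poisson_mass_series.
Qed.

Lemma poisson_mass_ge0 t k : 0 <= poisson_mass t k.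
Proof. by rewrite fine_ge0. Qed.

Lemma poisson_mass_le1 t k : poisson_mass t k <= 1.
Proof. by rewrite -lee_fin fineK ?fin_num_measure//; exact: probability_le1. Qed.

Lemma poisson_mass_sum t : 0 <= t -> series (poisson_mass t) @ \oo --> (1 : R).
Proof.
move=> t0; have th1 : `|1 : R| <= 1 by rewrite normr1.
have := poisson_mass_series t0 th1.
rewrite (_ : scaled 1 _ = poisson_mass t); last first.
  by apply/funext => k; rewrite /scaled expr1n mul1r.
have -> : cumulant P mu kappa 1 = 0.
  rewrite /cumulant (_ : (fun w => _) = cst 1); last by apply/funext => w; rewrite expr1n.
  by rewrite expectation_cst subrr mulr0.
by rewrite mulr0 expR0.
Qed.

Lemma measurable_poisson_mass k :
  measurable_fun setT (fun t : R => poisson_mass (Num.max t 0) k).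
Proof.
have mt : measurable_fun setT (fun t : R => Num.max t 0).
  by apply: measurable_maxr.
have m0 (t : R) : 0 <= Num.max t 0 by rewrite le_max lexx orbT.
have mX := measurable_process_at (fun t _ => measurable_funP (X t))
  (cp_nondecreasing HX) (cp_right_continuous HX) mt m0.
have mS : measurable [set z : T * R | X (Num.max z.2 0) z.1 = k].
  exact: measurable_fiber mX.
apply: measurableT_comp => //.
have := measurable_fun_ysection P mS.
rewrite (_ : _ \o _ = (fun t => P [set w | X (Num.max t 0) w = k]))//.
apply/funext => t /=; congr (P _); apply/seteqP; split => w /=.
  by rewrite /ysection/= inE.
by rewrite /ysection/= inE.
Qed.

Lemma frozen_increments n (t : nat -> R) (k : nat -> nat) : 0 <= t 0%N ->
  {homo t : i j / (i <= j)%N >-> i <= j} ->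
  P (\bigcap_(i < n) [set w | (X (t i.+1) w - X (t i) w)%N = k i]) =
  (\prod_(i < n) poisson_mass (t i.+1 - t i) (k i))%:E.
Proof.
move=> t0 tnd.
have := cp_independent_increments HX t0 tnd => /(_ n n id (@inj_id _)
  (fun i => [set w | (X (t i.+1) w - X (t i) w)%N = k i])).
rewrite (_ : \bigcap_(i in _) _ = \bigcap_(i < n) [set w | (X (t i.+1) w - X (t i) w)%N = k i]).
  move=> ->; last first.
    by move=> i; exists [set k i] => //; rewrite setTI.
  rewrite -prodEFin; apply: eq_bigr => i _; apply: increment_law.
    by rewrite (le_trans t0)// tnd.
  exact: tnd.
by apply/seteqP; split => w h i ni; [exact: (h (Ordinal ni))|exact: (h i (ltn_ord i))].
Qed.

Lemma poisson_mass0 h : 0 <= h -> poisson_mass h 0 = expR (h * cumulant P mu kappa 0).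
Proof.
move=> h0; have t1 : `|0 : R| <= 1 by rewrite normr0.
have lim0 := poisson_mass_series h0 t1.
rewrite -(cvg_lim (@Rhausdorff R) lim0); apply/esym/cvg_lim => //.
rewrite -(cvg_shiftn 1); apply: cvg_near_cst; near=> n.
rewrite /= addn1 /series/= big_nat_recl// big1_seq ?addr0; last first.
  by move=> i _; rewrite /scaled expr0n mul0r.
by rewrite /scaled expr0 mul1r.
Unshelve. all: by end_near.
Qed.

(** The points t (m + 1) / (m + 2) increase to t, and the increment over a short
    interval vanishes with probability close to 1. *)
Lemma no_fixed_jump (t : R) : 0 < t ->
  P [set w | forall m : nat, X (t * (m.+1%:R / m.+2%:R)) w <> X t w] = 0%E.
Proof.
move=> t0; set N := [set w | _]; pose u m : R := t * (m.+1%:R / m.+2%:R).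
have uE m : t - u m = t * m.+2%:R^-1.
  rewrite /u -{1}[t]mulr1 -mulrBr; congr (_ * _).
  by rewrite -{1}[1](@divff _ (m.+2%:R : R)) ?pnatr_eq0// -mulrBl -natrB// subSnn mul1r.
have u0 m : 0 <= u m by rewrite mulr_ge0 ?(ltW t0)// divr_ge0.
have ut m : u m <= t by rewrite -subr_ge0 uE mulr_ge0// ltW.
have mY m : measurable [set w | (X t w - X (u m) w)%N = 0%N].
  by apply: measurable_fiber; apply: measurable_fun_subn.
have NE : N = \bigcap_m (~` [set w | (X t w - X (u m) w)%N = 0%N]).
  apply/seteqP; split => w /= Nw m.
    move=> _ /= /eqP; rewrite subn_eq0 => h; apply: (Nw m); apply/eqP.
    by rewrite eqn_leq h andbT; apply: (cp_nondecreasing HX); [exact: u0|exact: ut].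
  by move=> h; apply: (Nw m Logic.I) => /=; rewrite /u h subnn.
have mN : measurable N by rewrite NE; apply: bigcapT_measurable => m; exact: measurableC.
have PN m : fine (P N) <= 1 - expR (t * m.+2%:R^-1 * cumulant P mu kappa 0).
  rewrite -lee_fin fineK ?fin_num_measure// -uE -poisson_mass0 ?subr_ge0// EFinB.
  rewrite -increment_law// -probability_setC//.
  by apply: le_measure; rewrite ?inE//; [exact: measurableC|rewrite NE; exact: bigcap_inf].
have lim0 : (fun m : nat => 1 - expR (t * m.+2%:R^-1 * cumulant P mu kappa 0)) @ \oo --> (0 : R).
  suff h : (fun m : nat => expR (t * m.+2%:R^-1 * cumulant P mu kappa 0)) @ \oo --> expR 0.
    rewrite expR0 in h.
    by have := cvgB (cvg_cst (1 : R)) h; rewrite subrr; apply.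
  apply: continuous_cvg; first exact: continuous_expR.
  rewrite -[X in _ --> X](mul0r (cumulant P mu kappa 0)); apply: cvgM; last exact: cvg_cst.
  rewrite -[X in _ --> X](mulr0 t); apply: cvgM; first exact: cvg_cst.
  by have := @cvg_harmonic R; rewrite -(cvg_shiftn 1); under eq_fun do rewrite /= addn1.
have : fine (P N) <= 0 by apply: (cvgr_to_ge lim0); near=> m; exact: PN.
rewrite -lee_fin fineK ?fin_num_measure// => PN0.
by apply/eqP; rewrite eq_le PN0 measure_ge0.
Unshelve. all: by end_near.
Qed.

End compound_poisson.

(** * Paths of one busy cycle *)

Local Arguments epoch : simpl never.

Section absorbed_chain.
Variables (B r : nat) (k dl : nat -> nat).

(** Content after n completions, absorbed at 0: the chain is stopped at the end
    of the busy period. *)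
Fixpoint level n : nat :=
  if n is m.+1 then
    if level m == 0%N then 0%N else (minn (level m + k m) B.+1 - dl m)%N
  else r.

Lemma level_antitone m n : (m <= n)%N -> (0 < level n)%N -> (0 < level m)%N.
Proof.
elim: n => [|n IH]; first by rewrite leqn0 => /eqP ->.
rewrite leq_eqVlt => /orP[/eqP ->//|]; rewrite ltnS => mn /= ln; apply: IH => //.
by move: ln; rewrite (lt0n (level _)); case: eqVneq.
Qed.

End absorbed_chain.

Section busy_path.
Context {R : realType} (a : R -> nat) (dl : nat -> nat) (h : R) (e : nat -> R) (B r : nat).
Local Notation T := (epoch h e).
Local Notation D := (net_input a dl h e).
Local Notation C := (B.+1%:R : R).
Hypothesis a0 : a 0 = 0%N.
Hypothesis a_nd : forall t u : R, 0 <= t -> t <= u -> (a t <= a u)%N.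
Hypothesis h0 : 0 < h.
Hypothesis e0 : forall i, 0 < e i.
Hypothesis T_unbounded : forall t : R, exists n, t < T n.
Hypothesis no_jump : forall n, exists2 u : R, 0 <= u < T n.+1 & a u = a (T n.+1).
Hypothesis rB : (0 < r <= B.+1)%N.

Lemma epoch_lt n : T n < T n.+1.
Proof.
case: n => [|n]; rewrite /epoch; first by rewrite big_geq// addr0.
by rewrite big_nat_recr//= addrA ltrDl.
Qed.

Lemma epoch_le m n : (m <= n)%N -> T m <= T n.
Proof.
by move=> mn; apply: (homo_leq (@le_refl _ _) (@le_trans _ _)) mn => i; exact: ltW (epoch_lt i).
Qed.

Lemma epoch_ge0 n : 0 <= T n. Proof. exact: (epoch_le (leq0n n)). Qed.

Lemma epoch_interval t : 0 <= t -> exists n, T n <= t < T n.+1.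
Proof.
move=> t0; have ex : exists n, t < T n by exact: T_unbounded.
case: (ex_minnP ex) => -[|n] tn nmin; first by have := le_lt_trans t0 tn; rewrite ltxx.
exists n; rewrite tn andbT leNgt; by apply/negP => /nmin; rewrite ltnn.
Qed.

Lemma completed_eq n t : T n <= t < T n.+1 -> completed h e t = n.
Proof.
move=> /andP[nt tn].
have nmax m : T m <= t -> (m <= n)%N.
  move=> mt; rewrite leqNgt; apply/negP => /epoch_le nm.
  by have := lt_le_trans tn (le_trans nm mt); rewrite ltxx.
rewrite /completed; case: xgetP => [m -> [mt mmax]|/(_ n)]; last first.
  by move=> /(_ (conj nt nmax)).
by apply/eqP; rewrite eqn_leq nmax// mmax.
Qed.

(** The content without reflection while n services are completed. *)
Let X n t : R := r%:R + (a t)%:R - (\sum_(0 <= i < n) dl i)%N%:R.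

Let XE n t : T n <= t < T n.+1 -> r%:R + D t = X n t.
Proof. by move=> tn; rewrite /net_input (completed_eq tn) addrA. Qed.

Let X_nd n t u : 0 <= t -> t <= u -> X n t <= X n u.
Proof. by move=> t0 tu; rewrite lerD2r lerD2l ler_nat a_nd. Qed.

Let XS n t : X n.+1 t = X n t - (dl n)%:R.
Proof. by rewrite /X big_nat_recr//= natrD opprD addrA. Qed.

Fixpoint running_max n : R :=
  if n is m.+1 then Num.max (running_max m) (X m (T n)) else r%:R.

Let running_max_ub n u : 0 <= u < T n -> r%:R + D u <= running_max n.
Proof.
elim: n => [|n IH] /andP[u0 un]; first by have := le_lt_trans u0 un; rewrite ltxx.
rewrite /= le_max; have [nu|nu] := leP (T n) u; last by rewrite IH ?u0.
by rewrite (@XE n) ?nu// X_nd ?orbT// ltW.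
Qed.

(** As there is no jump at a completion, the supremum up to it is reached before
    the reduction that takes place there. *)
Let running_max_attained n : exists2 u, 0 <= u <= T n & r%:R + D u = running_max n.
Proof.
elim: n => [|n [u /andP[u0 un] IH]].
  exists 0; rewrite ?lexx// (@XE 0)/= ?lexx ?epoch_lt//.
    by rewrite /X a0 big_geq// subr0 addr0.
  by have := epoch_lt 0.
rewrite /= maxElt; case: ifPn => _; last first.
  by exists u => //; rewrite u0 (le_trans un)// ltW// epoch_lt.
have [v /andP[v0 vn] av] := no_jump n.
have vn' : Num.max v (T n) < T n.+1 by rewrite gt_max vn epoch_lt.
exists (Num.max v (T n)); first by rewrite le_max v0 (ltW vn').
rewrite (@XE n); last by rewrite le_max lexx orbT.
congr (_ + _%:R - _); apply/eqP; rewrite eqn_leq; apply/andP; split.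
  by apply: a_nd; [rewrite le_max v0|exact: ltW].
by rewrite -av; apply: a_nd; rewrite // le_max lexx.
Qed.

Let sup_path n t : T n <= t < T n.+1 ->
  sup [set r%:R + D u | u in `[0, t]] = Num.max (running_max n) (X n t).
Proof.
move=> /andP[nt tn]; have t0 : 0 <= t by exact: le_trans (epoch_ge0 n) nt.
have ub : ubound [set r%:R + D u | u in `[0, t]] (Num.max (running_max n) (X n t)).
  move=> z /= [u]; rewrite in_itv/= => /andP[u0 ut] <-; rewrite le_max.
  have [nu|nu] := leP (T n) u; last by rewrite running_max_ub ?u0.
  by rewrite (@XE n) ?nu ?(le_lt_trans ut)// X_nd ?orbT.
apply/eqP; rewrite eq_le; apply/andP; split.
  apply: ge_sup => //; exists (r%:R + D 0), 0 => //=.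
  by rewrite in_itv/= lexx.
apply: ub_le_sup; first by exists (Num.max (running_max n) (X n t)).
rewrite maxElt; case: ifPn => _.
  by exists t => /=; [rewrite in_itv/= lexx t0|rewrite (@XE n) ?nt].
have [u /andP[u0 un] <-] := running_max_attained n.
by exists u => //=; rewrite in_itv/= u0 (le_trans un).
Qed.

Fixpoint reflected_epoch n : R :=
  if n is m.+1 then
    Num.min (reflected_epoch m + ((a (T n))%:R - (a (T m))%:R)) C - (dl m)%:R
  else r%:R.

Let reflection (y m c : R) :
  y - Num.max 0 (Num.max m y - c) = Num.min (y - Num.max 0 (m - c)) c.
Proof.
rewrite minEle; case: (leP m y) => my; [case: (leP 0 (y - c)) => yc|];
  case: (leP 0 (m - c)) => mc; case: ifPn => //; rewrite -?ltNge => ?; lra.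
Qed.

(** Reflection at the overall maximum amounts to truncation at B + 1 before each
    reduction. *)
Let reflected_epochE n :
  reflected_epoch n = X n (T n) - Num.max 0 (running_max n - C).
Proof.
elim: n => [|n IH].
  rewrite /= /X a0 big_geq// subr0 addr0 max_l ?subr0// subr_le0 ler_nat.
  by case/andP: rB.
rewrite XS addrAC [running_max n.+1]/= reflection.
rewrite [LHS]/= -/(reflected_epoch n) IH; congr (Num.min _ _ - _).
by rewrite /X; ring.
Qed.

(** Between two completions the reflected content only grows, up to B + 1. *)
Lemma reflected_between n t : T n <= t < T n.+1 ->
  reflected B r D t = Num.min (reflected_epoch n + ((a t)%:R - (a (T n))%:R)) C.
Proof.
move=> tn; rewrite /reflected (XE tn) (sup_path tn) reflection reflected_epochE.
by congr Num.min; rewrite /X; ring.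
Qed.

Let k n := (a (T n.+1) - a (T n))%N.

Let reflected_levelS n : reflected_epoch n = (level B r k dl n)%:R ->
  reflected_epoch n.+1 = (minn (level B r k dl n + k n) B.+1)%:R - (dl n)%:R.
Proof.
move=> /= ->; rewrite -natrB; last by rewrite a_nd ?epoch_ge0// ltW// epoch_lt.
by rewrite -natrD -/(k n) /minn /Num.min ltr_nat; case: ifP.
Qed.

Let reflected_level n : (0 < level B r k dl n)%N -> reflected_epoch n = (level B r k dl n)%:R.
Proof.
elim: n => [//|n IH] /=; case: eqVneq => [//|]; rewrite -lt0n => /IH {}IH.
rewrite subn_gt0 => d; have := reflected_levelS IH => /= ->.
by rewrite natrB// ltnW.
Qed.

Let reflected_ge1 n t : (0 < level B r k dl n)%N -> T n <= t < T n.+1 ->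
  1 <= reflected B r D t.
Proof.
move=> ln tn; rewrite (reflected_between tn) reflected_level// le_min.
case/andP: tn => nt _; rewrite ler1n andbT -[leLHS]addr0 lerD ?ler1n//.
by rewrite subr_ge0 ler_nat a_nd ?epoch_ge0.
Qed.

(** The content is at least 1 while the level is positive, and it drops below 1
    when a reduction takes all that is there. *)
Lemma first_below1_level n : (0 < level B r k dl n)%N -> level B r k dl n.+1 = 0%N ->
  first_below1 (reflected B r D) = (T n.+1)%:E.
Proof.
move=> ln lS; apply/eqP; rewrite eq_le; apply/andP; split.
  apply: ereal_inf_lbound; exists (T n.+1) => //; split; first exact: epoch_ge0.
  rewrite (@reflected_between n.+1) ?lexx ?epoch_lt// subrr addr0.
  rewrite (reflected_levelS (reflected_level ln)) -/(k n).
  move: lS => /=; rewrite gtn_eqF// => /eqP; rewrite subn_eq0 => hd.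
  by rewrite gt_min (le_lt_trans _ (@ltr01 R))// subr_le0 ler_nat.
apply: le_ereal_inf_tmp => z /= [t [t0 pt] <-]; rewrite lee_fin leNgt; apply/negP => tn.
have [m /andP[mt tm]] := epoch_interval t0.
have mn : (m <= n)%N.
  rewrite leqNgt; apply/negP => /epoch_le nm.
  by have := lt_le_trans tn (le_trans nm mt); rewrite ltxx.
have := reflected_ge1 (level_antitone mn ln); move=> /(_ t).
by rewrite mt tm leNgt pt => /(_ isT).
Qed.

Lemma first_below1_infty : (forall n, (0 < level B r k dl n)%N) ->
  first_below1 (reflected B r D) = +oo%E.
Proof.
move=> ln; rewrite /first_below1 (_ : [set _ | _ in _] = set0) ?ereal_inf0//.
apply/seteqP; split => // z /= [t [t0 pt] _].
have [m mt] := epoch_interval t0.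
by have := reflected_ge1 (ln m) mt; rewrite leNgt pt.
Qed.

End busy_path.

(** * The scale sequence and the linear system of the busy period *)

Section scale_sequence.
Context {R : realType} (lam : R) (a : nat -> R).

(* The power series (1 - lam) a(t) + lam - t. *)
Definition char_coef n : R := (1 - lam) * a n + lam * (n == 0%N)%:R - (n == 1%N)%:R.

Definition scale_seq : nat -> R := recip char_coef.

Definition resolvent_seq (u : nat -> R) n : R := (1 - lam) * conv u scale_seq n.

Hypothesis d0 : char_coef 0 != 0.

Let conv_shift (v : nat -> R) n :
  conv (fun n => (n == 1%N)%:R) v n = if n is m.+1 then v m else 0.
Proof.
case: n => [|n]; first by rewrite /conv big_ord1 mul0r.
rewrite /conv big_ord_recl mul0r add0r big_ord_recl /= mul1r subn1 big1 ?addr0//.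
by move=> i _; rewrite mul0r.
Qed.

(** Since (1 - lam) a = d - lam + t for the series d with coefficients [char_coef],
    (1 - lam) a / d = 1 - lam / d + t / d. *)
Lemma resolvent_seq_fresh n : resolvent_seq a n =
  (n == 0%N)%:R - lam * scale_seq n + (if n is m.+1 then scale_seq m else 0).
Proof.
have e : conv char_coef scale_seq n = conv_one n by rewrite conv_recip.
have E : conv char_coef scale_seq n = (1 - lam) * conv a scale_seq n
    + lam * conv conv_one scale_seq n - conv (fun n => (n == 1%N)%:R) scale_seq n.
  rewrite /conv !mulr_sumr -big_split /= -sumrB; apply: eq_bigr => i _.
  by rewrite /char_coef /conv_one; ring.
rewrite e [conv conv_one _]convC conv1 conv_shift /conv_one in E.
have solve (x y l c : R) : y = x + l - c -> x = y - l + c by move=> ->; ring.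
exact: solve E.
Qed.

Lemma sum_resolvent_seq_fresh n : series (resolvent_seq a) n.+1 =
  1 + (1 - lam) * series scale_seq n - lam * scale_seq n.
Proof.
elim: n => [|n IH].
  by rewrite /series /= big_nat1 resolvent_seq_fresh big_geq//=; ring.
rewrite seriesSr IH resolvent_seq_fresh/= seriesSr; ring.
Qed.

(** With G n = 1 + (1 - lam) * series scale_seq n, one has
    (1 - lam) * series (resolvent_seq a) n.+1 = G n - lam * G n.+1, so that the
    geometric average telescopes. *)
Lemma mean_sum_resolvent_seq B n :
  (1 - lam) * \sum_(0 <= i < n) lam ^+ i * series (resolvent_seq a) (B + i).+1%N =
  1 + (1 - lam) * series scale_seq B
  - lam ^+ n * (1 + (1 - lam) * series scale_seq (B + n)%N).
Proof.
elim: n => [|n IH]; first by rewrite (big_geq (leqnn 0)) mulr0 addn0 expr0 mul1r subrr.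
rewrite big_nat_recr//= mulrDr IH sum_resolvent_seq_fresh addnS seriesSr exprS; ring.
Qed.

(** The busy period from level j has transform [busy_level j].  Averaged over the
    reduction at the end of a service, [busy_level] gives [transit], a function of
    the number m of free places before the reduction; averaged over the arrivals
    during the service, [transit] gives [busy], a function of the number m of free
    places at its beginning.  In the application u is the sequence of coefficients of
    that service, g is their sum, and f is the sum of a. *)
Section busy_system.
Variables (f : R) (B : nat).

Definition drain : R := (1 + (1 - f) * ((1 - lam) * series scale_seq B))^-1.

Definition transit m : R :=
  drain * (1 + (1 - f) * ((1 - lam) * series scale_seq (minn m B))).

Definition busy (u : nat -> R) (g : R) m : R :=
  drain * (g + (1 - f) * series (resolvent_seq u) m).

Definition busy_level j : R := if j is 0 then 1 else busy a f (B.+1 - j).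

Definition geometric_mass i : R := if i is j.+1 then (1 - lam) * lam ^+ j else 0.

Hypothesis drain0 : 1 + (1 - f) * ((1 - lam) * series scale_seq B) != 0.
Hypotheses (lam0 : 0 <= lam) (lam1 : lam < 1).

Lemma transit_full m : (B <= m)%N -> transit m = 1.
Proof. by move=> Bm; rewrite /transit (minn_idPr Bm) /drain mulVf. Qed.

Lemma transitS m : (m < B)%N ->
  transit m = (1 - lam) * busy a f m.+1 + lam * transit m.+1.
Proof.
move=> mB; rewrite /transit /busy (minn_idPl mB) (minn_idPl (ltnW mB)).
by rewrite sum_resolvent_seq_fresh seriesSr; ring.
Qed.

Lemma cvg_geometric_mass : series geometric_mass @ \oo --> (1 : R).
Proof.
rewrite -(cvg_shiftn 1).
have -> : (fun n => series geometric_mass (n + 1)%N) = series (geometric (1 - lam) lam).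
  apply/funext => n; rewrite addn1 /series/= big_nat_recl// add0r.
  by apply: eq_bigr.
have := @cvg_geometric_series R (1 - lam) lam.
by rewrite ger0_norm// divff ?subr_eq0 ?gt_eqF//; apply.
Qed.

(** Lack of memory: the reduction is 1, or one customer is removed and a fresh
    geometric reduction follows. *)
Lemma cvg_service_end j : (0 < j <= B.+1)%N ->
  series (fun i => geometric_mass i * busy_level (j - i)) @ \oo --> transit (B.+1 - j).
Proof.
elim: j => [//|[|j] IH] /andP[_ jB].
  rewrite subSS subn0 transit_full//.
  rewrite (_ : (fun i => _) = geometric_mass); first exact: cvg_geometric_mass.
  by apply/funext => -[|i]; rewrite ?mul0r// subSS sub0n mulr1.
rewrite -(cvg_shiftn 2).
have -> : (fun n => series (fun i => geometric_mass i * busy_level (j.+2 - i)) (n + 2)%N) =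
  (fun n => (1 - lam) * busy_level j.+1 +
     lam * series (fun i => geometric_mass i * busy_level (j.+1 - i)) (n + 1)%N).
  apply/funext => n; rewrite addn2 addn1 /series/= !big_nat_recl// !mul0r !add0r.
  rewrite (_ : geometric_mass 1 = 1 - lam); last by rewrite /= expr0 mulr1.
  rewrite subSS subn0; congr (_ + _); rewrite mulr_sumr.
  apply: eq_bigr => i _.
  have -> : geometric_mass i.+2 = lam * geometric_mass i.+1 by rewrite /= exprS; ring.
  by rewrite subSS mulrA.
have Bj : (B.+1 - j.+1 = (B.+1 - j.+2).+1)%N by rewrite -subnSK.
rewrite transitS; last by rewrite subSS ltn_subrL/=; lia.
rewrite -Bj; apply: cvgD; first exact: cvg_cst.
apply: cvgM; first exact: cvg_cst.
by rewrite (cvg_shiftn _ (series _)); apply: IH; rewrite /= ltnW.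
Qed.

(** Beyond m arrivals the waiting room is full and [transit] is the constant [drain];
    the remaining terms are the convolution that defines the resolvent sequence. *)
Lemma cvg_service_start (u : nat -> R) (g : R) m : (m <= B)%N ->
  series u @ \oo --> g ->
  series (fun n => u n * transit (m - n)) @ \oo --> busy u g m.
Proof.
move=> mB ug; rewrite -(cvg_shiftn m) /busy mulrDr.
have -> : (fun n => series (fun n => u n * transit (m - n)) (n + m)%N) =
    (fun n => drain * series u (n + m)%N +
              drain * ((1 - f) * series (resolvent_seq u) m)).
  apply/funext => n.
  have -> : drain * ((1 - f) * series (resolvent_seq u) m) =
      \sum_(i < m) u i * (transit (m - i) - drain).
    rewrite (_ : series (resolvent_seq u) m = (1 - lam) * series (conv u scale_seq) m).
      rewrite series_conv !mulr_sumr; apply: eq_bigr => i _.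
      by rewrite /transit (minn_idPl (leq_trans (leq_subr _ _) mB)); ring.
    by rewrite /series/= mulr_sumr.
  rewrite addnC /series/= !big_mkord !big_split_ord/= mulrDr.
  rewrite addrAC mulr_sumr -big_split/=; congr (_ + _).
    by apply: eq_bigr => i _; ring.
  rewrite mulr_sumr; apply: eq_bigr => i _.
  rewrite (_ : m - (m + i) = 0)%N; last by lia.
  by rewrite /transit min0n /series/= big_geq// !mulr0 addr0 mulr1 mulrC.
apply: cvgD; last exact: cvg_cst.
by apply: cvgM; [exact: cvg_cst|rewrite (cvg_shiftn _ (series _))].
Qed.

End busy_system.

End scale_sequence.

(** * Transforms of a service cycle *)

Section transforms.
Context d (T : measurableType d) (R : realType) (P : probability T R).

(** Meant for nonnegative bounded functions: their integrals are finite, whether or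
    not they are measurable. *)
Definition mean (f : T -> R) : R := fine (\int[P]_w (f w)%:E)%E.

Lemma integral_mean (f : T -> R) (c : R) :
  (forall w, 0 <= f w <= c) -> (\int[P]_w (f w)%:E)%E = (mean f)%:E.
Proof.
move=> fc; have f0 w : 0 <= f w by have /andP[] := fc w.
rewrite /mean fineK// ge0_fin_numE ?ge0_integral_real//.
apply: (@le_lt_trans _ _ (\int[P]_w ((cst c) w)%:E)%E).
  by apply: ge0_le_integral_real => // w; have /andP[] := fc w.
by have := expectation_cst P c; rewrite unlock => ->; rewrite ltry.
Qed.

Lemma mean_ge0 (f : T -> R) : (forall w, 0 <= f w) -> 0 <= mean f.
Proof. by move=> f0; rewrite fine_ge0// ge0_integral_real. Qed.

Lemma mean_cst (c : R) : mean (cst c) = c.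
Proof. by have := expectation_cst P c; rewrite unlock /mean => ->. Qed.

Lemma mean_le (f g : T -> R) (c : R) : (forall w, 0 <= f w) -> (forall w, f w <= g w) ->
  (forall w, g w <= c) -> mean f <= mean g.
Proof.
move=> f0 fg gc; have g0 w : 0 <= g w by exact: le_trans (fg w).
rewrite -lee_fin -(@integral_mean f c); last by move=> w; rewrite f0 (le_trans (fg w)).
by rewrite -(@integral_mean g c)//; [exact: ge0_le_integral_real|move=> w; rewrite g0 gc].
Qed.

Lemma mean_gt0 (f : T -> R) (c : R) : measurable_fun setT f -> (forall w, 0 < f w <= c) ->
  0 < mean f.
Proof.
move=> mf fc; have f0 w : 0 <= f w by have /andP[/ltW] := fc w.
rewrite lt_neqAle mean_ge0// andbT; apply/negP => /eqP/esym m0.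
have : (\int[P]_w `|(f w)%:E| = 0)%E.
  under eq_integral do rewrite gee0_abs ?lee_fin//.
  by rewrite (@integral_mean f c) ?m0// => w; have /andP[/ltW -> ->] := fc w.
move=> /(ae_eq_integral_abs P measurableT (proj2 (measurable_EFinP _ _) mf)).1 [N [mN N0 fN]].
have NT : N = setT.
  rewrite -subTset => w _; apply: fN => /= /(_ Logic.I) [fw].
  by have /andP[] := fc w; rewrite fw ltxx.
by have := probability_setT P; rewrite -NT N0 => /esym/eqP; rewrite onee_eq0.
Qed.

Lemma mean_onem (f : T -> R) : measurable_fun setT f -> (forall w, 0 <= f w <= 1) ->
  mean (fun w => 1 - f w) = 1 - mean f.
Proof.
move=> mf f01; apply/eqP; rewrite eq_sym subr_eq eq_sym; apply/eqP.
have b w : 0 <= 1 - f w <= 1 by have := f01 w; lra.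
have := @ge0_integralD _ _ _ P setT measurableT (fun w => (1 - f w)%:E) (fun w => (f w)%:E).
rewrite (integral_mean b) (integral_mean f01) -EFinD.
under eq_integral do rewrite -EFinD subrK.
have -> : (\int[P]_w 1%:E = 1%:E)%E by have := expectation_cst P 1; rewrite unlock.
move=> h; have {h} : (1%:E = (mean (fun w => 1 - f w) + mean f)%:E)%E.
  apply: h.
  - by move=> w _; rewrite lee_fin; have /andP[] := b w.
  - by apply/measurable_EFinP; apply: measurable_funB.
  - by move=> w _; rewrite lee_fin; have /andP[] := f01 w.
  - exact/measurable_EFinP.
by move=> [<-].
Qed.

(** Service times are positive almost surely only; their positive parts are
    nonnegative on every path. *)
Definition pos_part (Y : T -> R) w : R := Num.max (Y w) 0.

Lemma pos_part_ge0 Y w : 0 <= pos_part Y w.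
Proof. by rewrite le_max lexx orbT. Qed.

Lemma measurable_pos_part Y : measurable_fun setT Y -> measurable_fun setT (pos_part Y).
Proof. by move=> mY; apply: measurable_maxr => //; exact: measurable_cst. Qed.

Lemma ae_pos_part (Y : {RV P >-> R}) : P [set w | Y w <= 0] = 0%E ->
  {ae P, forall w, pos_part Y w = Y w}.
Proof.
move=> Y0; exists [set w | Y w <= 0]; split => //.
  by apply: measurable_sublevel; exact: measurable_funP.
move=> w /= h; rewrite leNgt; apply/negP => Yw; apply: h.
by rewrite /pos_part max_l// ltW.
Qed.

Lemma laplace_pos_part (Y : {RV P >-> R}) s : P [set w | Y w <= 0] = 0%E ->
  laplace P Y s = mean (fun w => expR (- (s * pos_part Y w))).
Proof.
move=> Y0; rewrite /laplace /mean unlock; congr fine.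
have mexp (Z : T -> R) : measurable_fun setT Z ->
    measurable_fun setT (fun w => (expR (- (s * Z w)))%:E).
  move=> mZ; apply/measurable_EFinP; apply: measurableT_comp => //.
  by apply: measurableT_comp => //; apply: measurable_funM.
apply: ge0_ae_eq_integral => //.
- by apply: mexp; exact: measurable_funP.
- by apply: mexp; apply: measurable_pos_part; exact: measurable_funP.
- by have [N [mN N0 YN]] := ae_pos_part Y0; exists N; split => // w /= h; apply: YN => /= e;
  apply: h => _; rewrite e.
Qed.

Variables (mu : R) (kappa : {RV P >-> nat}) (X : R -> {RV P >-> nat}).
Hypothesis HX : compound_poisson mu kappa X.

(** Coefficients of E[exp (- s Y) t^(X Y)] for Y independent of X. *)
Definition coef (Y : {RV P >-> R}) (s : R) (k : nat) : R :=
  mean (fun w => expR (- (s * pos_part Y w)) * poisson_mass X (pos_part Y w) k).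

Let exp_itv (s y : R) : 0 <= s -> 0 <= y -> 0 < expR (- (s * y)) <= 1.
Proof. by move=> s0 y0; rewrite expR_gt0/= -expR0 ler_expR oppr_le0 mulr_ge0. Qed.

Lemma measurable_exp_pos_part (Y : T -> R) s : measurable_fun setT Y ->
  measurable_fun setT (fun w => expR (- (s * pos_part Y w))).
Proof.
move=> mY; apply: measurableT_comp => //; apply: measurableT_comp => //.
by apply: measurable_funM => //; exact: measurable_pos_part.
Qed.

Lemma measurable_coef_fun s k : measurable_fun setT
  (fun y : R => expR (- (s * Num.max y 0)) * poisson_mass X (Num.max y 0) k).
Proof.
apply: measurable_funM; last exact: (measurable_poisson_mass HX k).
apply: measurableT_comp => //; apply: measurableT_comp => //.
by apply: measurable_funM => //; apply: measurable_maxr.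
Qed.

Lemma coef_ge0 Y s k : 0 <= coef Y s k.
Proof. by apply: mean_ge0 => w; rewrite mulr_ge0 ?expR_ge0// poisson_mass_ge0. Qed.

Lemma coef_fun_itv (s : R) k (y : R) : 0 <= s -> 0 <= y ->
  0 <= expR (- (s * y)) * poisson_mass X y k <= 1.
Proof.
move=> s0 y0; have /andP[/ltW e0 e1] := exp_itv s0 y0.
by rewrite mulr_ge0 ?poisson_mass_ge0//= mulr_ile1// ?poisson_mass_ge0 ?poisson_mass_le1.
Qed.

Lemma coef_same_law (Y Z : {RV P >-> R}) s k :
  (forall A, measurable A -> P (Y @^-1` A) = P (Z @^-1` A)) -> coef Y s k = coef Z s k.
Proof.
move=> YZ; congr fine.
apply: (@integral_same_law _ _ _ P _ _ Y Z (fun y => (expR (- (s * Num.max y 0)) *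
  poisson_mass X (Num.max y 0) k)%:E) YZ).
  by apply/measurable_EFinP; exact: measurable_coef_fun.
by move=> y; rewrite lee_fin mulr_ge0 ?expR_ge0// poisson_mass_ge0.
Qed.

Lemma coef0_gt0 Y s : 0 <= s -> 0 < coef Y s 0.
Proof.
move=> s0; apply: (@mean_gt0 _ 1).
  exact: (measurableT_comp (measurable_coef_fun s 0%N) (measurable_funP Y)).
move=> w; have y0 := pos_part_ge0 Y w; have /andP[_ ->] := coef_fun_itv 0%N s0 y0.
by rewrite andbT mulr_gt0 ?expR_gt0// (poisson_mass0 HX)// expR_gt0.
Qed.

Lemma coef_series (Y : {RV P >-> R}) s t : P [set w | Y w <= 0] = 0%E ->
  0 <= s -> `|t| <= 1 ->
  series (scaled t (coef Y s)) @ \oo --> laplace P Y (s - cumulant P mu kappa t).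
Proof.
move=> Y0 s0 t1; rewrite laplace_pos_part//.
have y0 := pos_part_ge0 Y.
have mE z : measurable_fun setT (fun w => expR (- (z * pos_part Y w))).
  by apply: measurable_exp_pos_part; exact: measurable_funP.
apply: (@integral_power_series _ _ _ P
    (fun k w => expR (- (s * pos_part Y w)) * poisson_mass X (pos_part Y w) k)
    (fun w => expR (- (s * pos_part Y w)))) => //.
- by move=> k; exact: (measurableT_comp (measurable_coef_fun s k) (measurable_funP Y)).
- by move=> k w; rewrite mulr_ge0 ?expR_ge0// poisson_mass_ge0.
- move=> w; rewrite -[X in _ --> X]mulr1.
  have -> : series (fun k => expR (- (s * pos_part Y w)) * poisson_mass X (pos_part Y w) k) =
     (fun n => expR (- (s * pos_part Y w)) * series (poisson_mass X (pos_part Y w)) n).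
    by apply/funext => n; rewrite /series/= mulr_sumr.
  by apply: cvgM; [exact: cvg_cst|exact: poisson_mass_sum HX _ (y0 w)].
- move=> w; rewrite mulrBl opprB addrC expRD [cumulant _ _ _ _ * _]mulrC.
  have -> : series (scaled t (fun k => expR (- (s * pos_part Y w)) * poisson_mass X (pos_part Y w) k)) =
     (fun n => expR (- (s * pos_part Y w)) * series (scaled t (poisson_mass X (pos_part Y w))) n).
    apply/funext => n; rewrite /series/= mulr_sumr; apply: eq_bigr => k _.
    by rewrite /scaled mulrCA.
  by apply: cvgM; [exact: cvg_cst|exact: poisson_mass_series HX _ _ (y0 w) t1].
- rewrite (@integral_mean _ 1) ?ltry// => w.
  by have /andP[/ltW -> ->] := exp_itv s0 (y0 w).
Qed.

Lemma laplace_itv (Y : {RV P >-> R}) s : P [set w | Y w <= 0] = 0%E -> 0 <= s ->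
  0 < laplace P Y s <= 1.
Proof.
move=> Y0 s0; rewrite laplace_pos_part//.
have y0 := pos_part_ge0 Y; apply/andP; split.
  apply: (@mean_gt0 _ 1); last by move=> w; exact: exp_itv.
  by apply: measurable_exp_pos_part; exact: measurable_funP.
rewrite -[leRHS]mean_cst; apply: (@mean_le _ _ 1) => // w.
by have /andP[] := exp_itv s0 (y0 w).
Qed.

Lemma laplace_lt1 (Y : {RV P >-> R}) s : (forall w, 0 < Y w) -> 0 < s -> laplace P Y s < 1.
Proof.
move=> Y0 s0.
have Yle : P [set w | Y w <= 0] = 0%E.
  rewrite (_ : [set w | _] = set0) ?measure0//.
  by apply/seteqP; split => w //=; rewrite leNgt Y0.
rewrite laplace_pos_part// -subr_gt0 -mean_onem//.
- apply: (@mean_gt0 _ 1).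
    apply: measurable_funB => //.
    by apply: measurable_exp_pos_part; exact: measurable_funP.
  move=> w; rewrite subr_gt0 gerBl expR_ge0 andbT -expR0 ltr_expR oppr_lt0.
  by rewrite mulr_gt0// lt_max Y0.
- by apply: measurable_exp_pos_part; exact: measurable_funP.
- by move=> w; have /andP[/ltW -> ->] := exp_itv (ltW s0) (pos_part_ge0 Y w).
Qed.

Lemma coef_cvg0 (Y : {RV P >-> R}) k (s : nat -> R) : (forall n, 0 <= s n) ->
  s @ \oo --> 0 -> (fun n => coef Y (s n) k) @ \oo --> coef Y 0 k.
Proof.
move=> s0 sl; apply: fine_cvg; rewrite fineK; last first.
  rewrite (@integral_mean _ 1)// => w; exact: coef_fun_itv (lexx 0) (pos_part_ge0 Y w).
apply: (@dominated_cvg _ _ _ P setT _ _ _ (cst 1%:E)) => //.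
- move=> n; apply/measurable_EFinP.
  exact: (measurableT_comp (measurable_coef_fun (s n) k) (measurable_funP Y)).
- move=> w _; apply/fine_cvgP; split; first by near=> n.
  apply: cvgM; last exact: cvg_cst.
  rewrite mul0r oppr0 -[X in _ --> expR X]oppr0 -[X in _ --> expR (- X)](mul0r (pos_part Y w)).
  apply: continuous_cvg; first exact: continuous_expR.
  by apply: cvgN; apply: cvgM => //; exact: cvg_cst.
- apply/integrableP; split; first exact: measurable_cst.
  under eq_integral do rewrite /= normr1.
  by have := expectation_cst P 1; rewrite unlock => ->; rewrite ltry.
- move=> n w _; have /andP[a0 a1] := coef_fun_itv k (s0 n) (pos_part_ge0 Y w).
  by rewrite gee0_abs lee_fin.
Unshelve. all: by end_near.
Qed.

End transforms.

(** * The resolvent sequence *)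

Section resolvent_theory.
Context d (T : measurableType d) (R : realType) (P : probability T R) (M : model P).
Variable X : R -> {RV P >-> nat}.
Hypothesis HX : compound_poisson (m_mu M) (m_kappa M) X.
Local Notation lam := (m_lam M).
Local Notation lap := (laplace P (m_eta M)).

Lemma eta_pos : P [set w | m_eta M w <= 0] = 0%E.
Proof.
rewrite (_ : [set w | _] = set0) ?measure0//.
by apply/seteqP; split => w //=; rewrite leNgt eta_gt0.
Qed.

Lemma eta_res_pos x : 0 <= x -> distrfun (m_eta M) x < 1 ->
  P [set w | m_eta_res M x w <= 0] = 0%E.
Proof. by move=> x0 Fx; rewrite (eta_resP x0 Fx (lexx 0)) addr0 subrr mul0r. Qed.

Lemma distrfun0 : distrfun (m_eta M) 0 = 0.
Proof.
rewrite /distrfun /cdf /distribution /pushforward (_ : _ @^-1` _ = [set w | m_eta M w <= 0]).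
  by rewrite eta_pos.
by apply/seteqP; split => w /=; rewrite in_itv.
Qed.

Lemma eta_res0_law A : measurable A -> P (m_eta_res M 0 @^-1` A) = P (m_eta M @^-1` A).
Proof.
have F0 : distrfun (m_eta M) 0 < 1 by rewrite distrfun0.
apply: same_law_cdf => u; have [u0|u0] := leP 0 u.
  rewrite (eta_resP (lexx 0) F0 u0) distrfun0 add0r !subr0 divr1 /distrfun fineK.
    by rewrite /cdf; congr (P _); apply/seteqP; split => w /=; rewrite in_itv.
  by rewrite fin_num_measure.
have E (Y : {RV P >-> R}) : P [set w | Y w <= 0] = 0%E -> P [set w | Y w <= u] = 0%E.
  have mY v : measurable [set w | Y w <= v].
    by apply: measurable_sublevel; exact: measurable_funP.
  move=> Y0; apply/eqP; rewrite eq_le measure_ge0 andbT -Y0.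
  by apply: le_measure; rewrite ?inE// => w /= /le_trans; apply; exact: ltW.
by rewrite !E// ?eta_pos// eta_res_pos.
Qed.

Definition service_coef s : nat -> R := coef X (m_eta M) s.
Definition residual_coef s x : nat -> R := coef X (m_eta_res M x) s.
Definition scale s : nat -> R := scale_seq lam (service_coef s).

(** The denominator of the generating function of the resolvent sequence. *)
Definition char_fun s theta : R := (1 - lam) * lap (s - k_fun M theta) + lam - theta.

Lemma residual_coef0 s : residual_coef s 0 = service_coef s.
Proof. by apply/funext => k; apply: coef_same_law HX _ _ _ _ eta_res0_law. Qed.

Let onem_lam_gt0 : 0 < 1 - lam. Proof. by rewrite subr_gt0 lam_lt1. Qed.

Lemma char_coef0_gt0 s : 0 <= s -> 0 < char_coef lam (service_coef s) 0.
Proof.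
move=> s0; rewrite /char_coef eqxx/= mulr1 subr0.
apply: ltr_wpDr; first exact: lam_ge0.
by apply: mulr_gt0 => //; exact: (coef0_gt0 HX).
Qed.

Lemma char_coef_ge0 s n : 0 <= char_coef lam (service_coef s) n.+2.
Proof.
rewrite /char_coef/= mulr0 addr0 subr0; apply: mulr_ge0; first exact: ltW.
exact: coef_ge0.
Qed.

Lemma cvg_char_coef s theta : 0 <= s -> `|theta| <= 1 ->
  series (scaled theta (char_coef lam (service_coef s))) @ \oo --> char_fun s theta.
Proof.
move=> s0 th1; have h := coef_series HX eta_pos s0 th1.
rewrite /char_fun -addrA -(cvg_shiftn 2).
have -> : (fun n => series (scaled theta (char_coef lam (service_coef s))) (n + 2)%N) =
   (fun n => (1 - lam) * series (scaled theta (service_coef s)) (n + 2)%N + (lam - theta)).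
  apply/funext => n; rewrite addn2 /series/= !big_nat_recl// /scaled /char_coef/=.
  rewrite (eq_bigr (fun i => (1 - lam) * (theta ^+ i.+2 * service_coef s i.+2))).
    by rewrite -mulr_sumr expr0 expr1; ring.
  by move=> i _; rewrite mulr0 addr0 subr0 mulrCA.
apply: cvgD; last exact: cvg_cst.
by apply: cvgM; [exact: cvg_cst|rewrite (cvg_shiftn _ (series _))].
Qed.

(** All that is used about c(s): the denominator is positive on [0, rho), and it
    vanishes at some point of [rho, 1]. *)
Definition zero_free s rho := exists c, [/\ 0 < rho <= c, c <= 1, char_fun s c = 0 &
  forall theta, 0 <= theta < rho -> 0 < char_fun s theta].

Let char_zero s c : 0 <= s -> 0 < c -> c <= 1 -> char_fun s c = 0 ->
  series (scaled c (char_coef lam (service_coef s))) @ \oo --> (0 : R).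
Proof. by move=> s0 c0 c1 <-; apply: cvg_char_coef => //; rewrite gtr0_norm. Qed.

Lemma scale_ge0 s rho n : 0 <= s -> zero_free s rho -> 0 <= scale s n.
Proof.
move=> s0 [c [/andP[r0 rc] c1 pc _]]; have c0 := lt_le_trans r0 rc.
apply: (recip_zero_ge0 c0 (char_coef0_gt0 s0)); first exact: char_coef_ge0.
exact: char_zero.
Qed.

Lemma cvg_scale s rho theta : 0 <= s -> zero_free s rho -> 0 <= theta < rho ->
  cvgn (series (scaled theta (scale s))).
Proof.
move=> s0 [c [/andP[r0 rc] c1 pc pos]] /andP[t0 tr]; have c0 := lt_le_trans r0 rc.
apply: (@cvg_recip_zero _ _ c c0 (char_coef0_gt0 s0) _ _ theta (char_fun s theta)).
- by move=> n; exact: char_coef_ge0.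
- exact: char_zero.
- by rewrite t0 (lt_le_trans tr).
- by apply: pos; rewrite t0 tr.
- apply: cvg_char_coef => //; rewrite ger0_norm// (le_trans (ltW tr))//.
  exact: le_trans rc c1.
Qed.

Lemma cvg_scale_inv s rho theta : 0 <= s -> zero_free s rho -> `|theta| < rho ->
  [/\ cvgn (series (fun n => `|scaled theta (scale s) n|)), char_fun s theta != 0 &
      series (scaled theta (scale s)) @ \oo --> (char_fun s theta)^-1].
Proof.
move=> s0 zf tr; have [c [/andP[r0 rc] c1 pc pos]] := zf.
have t1 : `|theta| <= 1 by rewrite (le_trans (ltW tr))// (le_trans rc).
have eA : cvgn (series (fun n => `|scaled theta (scale s) n|)).
  rewrite (_ : (fun n => _) = scaled `|theta| (scale s)).
    by apply: (cvg_scale s0 zf); rewrite normr_ge0.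
  by apply/funext => n; rewrite /scaled normrM normrX (ger0_norm (scale_ge0 n s0 zf)).
have vA : cvgn (series (fun n => `|scaled theta (char_coef lam (service_coef s)) n|)).
  rewrite (_ : (fun n => _) = fun n => `|scaled `|theta| (char_coef lam (service_coef s)) n|).
    apply: cvg_series_norm2.
      by move=> n; rewrite mulr_ge0 ?exprn_ge0// char_coef_ge0.
    by apply: cvgP; apply: cvg_char_coef => //; rewrite normr_id.
  by apply/funext => n; rewrite /scaled !normrM !normrX normr_id.
have ec : cvgn (series (scaled theta (scale s))) by exact: normed_cvg.
have := cvg_conv vA eA (cvg_char_coef s0 t1) ec.
rewrite conv_scaled conv_recip; last by rewrite gt_eqF// char_coef0_gt0.
move=> l1.
have e1 : char_fun s theta * limn (series (scaled theta (scale s))) = 1.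
  rewrite -(cvg_lim (@Rhausdorff R) l1); apply/cvg_lim => //.
  rewrite -(cvg_shiftn 1); apply: cvg_near_cst; near=> n.
  rewrite /= addn1 /series/= big_nat_recl// big1_seq; last first.
    by move=> i _; rewrite /scaled /conv_one mulr0.
  by rewrite /scaled /conv_one expr0 mulr1 addr0.
have p0 : char_fun s theta != 0.
  by apply/eqP => p0; move: e1; rewrite p0 mul0r => /esym/eqP; rewrite oner_eq0.
split => //; have -> // : (char_fun s theta)^-1 = limn (series (scaled theta (scale s))).
by rewrite -[LHS]mulr1 -e1 mulKf.
Unshelve. all: by end_near.
Qed.

(** The two sequences have the same generating function, which determines them. *)
Lemma resolventE s x : 0 <= s -> zero_free s (c_fun M s) -> 0 <= x ->
  distrfun (m_eta M) x < 1 ->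
  resolvent M s x = resolvent_seq lam (service_coef s) (residual_coef s x).
Proof.
move=> s0 zf x0 Fx; have Y0 := eta_res_pos x0 Fx.
have [c [/andP[r0 rc] c1 pc pos]] := zf.
have spec theta : `|theta| < c_fun M s ->
  series (scaled theta (resolvent_seq lam (service_coef s) (residual_coef s x))) @ \oo -->
   (1 - lam) * laplace P (m_eta_res M x) (s - k_fun M theta) / char_fun s theta.
  move=> tr; have t1 : `|theta| <= 1 by rewrite (le_trans (ltW tr))// (le_trans rc).
  have [eA _ eE] := cvg_scale_inv s0 zf tr.
  have xE := coef_series HX Y0 s0 t1.
  have xA : cvgn (series (fun n => `|scaled theta (residual_coef s x) n|)).
    rewrite (_ : (fun n => _) = scaled `|theta| (residual_coef s x)).
      by apply: cvgP; apply: (coef_series HX Y0 s0); rewrite normr_id.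
    by apply/funext => n; rewrite /scaled normrM normrX (ger0_norm (coef_ge0 _ _ _ _)).
  have := cvg_conv xA eA xE eE; rewrite conv_scaled -mulrA => h.
  rewrite (_ : series _ = (fun n => (1 - lam) *
      series (scaled theta (conv (residual_coef s x) (scale s))) n)).
    by apply: cvgM => //; exact: cvg_cst.
  by apply/funext => n; rewrite /series/= mulr_sumr; apply: eq_bigr => i _;
     rewrite /scaled /resolvent_seq mulrCA.
rewrite /resolvent; case: xgetP => [q _ qE|]; last first.
  move=> /(_ (resolvent_seq lam (service_coef s) (residual_coef s x))) []; exact: spec.
by apply: (power_series_unique r0) => theta tr; [exact: qE|exact: spec].
Qed.

Lemma service_coef_antitone s u k : 0 <= s -> s <= u -> service_coef u k <= service_coef s k.
Proof.
move=> s0 su; have y0 := pos_part_ge0 (m_eta M).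
apply: (@mean_le _ _ _ P _ _ 1) => w.
- by have /andP[] := coef_fun_itv X k (le_trans s0 su) (y0 w).
- rewrite ler_wpM2r ?poisson_mass_ge0// ler_expR lerN2 ler_wpM2r//.
- by have /andP[] := coef_fun_itv X k s0 (y0 w).
Qed.

Let k_fun1 : k_fun M 1 = 0.
Proof.
rewrite /k_fun /cumulant (_ : (fun w => _) = cst 1); last by apply/funext => w; rewrite expr1n.
by rewrite expectation_cst subrr mulr0.
Qed.

Let transform s theta := lap (s - k_fun M theta).

Let transformE s theta : 0 <= s -> `|theta| <= 1 ->
  series (scaled theta (service_coef s)) @ \oo --> transform s theta.
Proof. by move=> s0 t1; exact: (coef_series HX eta_pos s0 t1). Qed.

Let transform_nd s : 0 <= s -> forall t u, 0 <= t -> t <= u -> u <= 1 ->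
  transform s t <= transform s u.
Proof.
move=> s0 t u t0 tu u1; have u0 := le_trans t0 tu.
have t1 : `|t| <= 1 by rewrite ger0_norm// (le_trans tu).
have u1' : `|u| <= 1 by rewrite ger0_norm.
apply: (ler_cvg_to (transformE s0 t1) (transformE s0 u1')); near=> n.
by apply: ler_sum => i _; rewrite ler_wpM2r ?coef_ge0// lerXn2r// nnegrE.
Unshelve. all: by end_near.
Qed.

Let transform_antitone s u t : 0 <= s -> s <= u -> 0 <= t <= 1 ->
  transform u t <= transform s t.
Proof.
move=> s0 su /andP[t0 t1]; have t1' : `|t| <= 1 by rewrite ger0_norm.
apply: (ler_cvg_to (transformE (le_trans s0 su) t1') (transformE s0 t1')); near=> n.
by apply: ler_sum => i _; rewrite ler_wpM2l ?exprn_ge0// service_coef_antitone.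
Unshelve. all: by end_near.
Qed.

Let transform_gt0 s t : 0 <= s -> 0 <= t <= 1 -> 0 < transform s t.
Proof.
move=> s0 /andP[t0 t1]; have t1' : `|t| <= 1 by rewrite ger0_norm.
apply: lt_le_trans (coef0_gt0 HX (m_eta M) s0) _.
have : series (scaled t (service_coef s)) 1%N <= transform s t.
  apply: series_cvg_le (transformE s0 t1') => n.
  by rewrite mulr_ge0 ?exprn_ge0// coef_ge0.
by rewrite /series/= big_nat1 /scaled expr0 mul1r.
Qed.

Let transform1 s : transform s 1 = lap s.
Proof. by rewrite /transform k_fun1 subr0. Qed.

Let convex_exprn (p t : R) n : 0 <= p <= 1 -> 0 <= t <= 1 ->
  (p * t + (1 - p)) ^+ n <= p * t ^+ n + (1 - p).
Proof.
move=> /andP[p0 p1] /andP[t0 t1]; elim: n => [|n IH]; first by rewrite !expr0; lra.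
rewrite exprS; apply: (@le_trans _ _ ((p * t + (1 - p)) * (p * t ^+ n + (1 - p)))).
  by apply: ler_wpM2l => //; rewrite addr_ge0 ?mulr_ge0 ?subr_ge0.
rewrite exprS -subr_ge0.
have -> : p * (t * t ^+ n) + (1 - p) - (p * t + (1 - p)) * (p * t ^+ n + (1 - p)) =
   p * (1 - p) * ((1 - t) * (1 - t ^+ n)) by ring.
have tn : t ^+ n <= 1 by rewrite exprn_ile1.
by rewrite !mulr_ge0 ?subr_ge0.
Qed.

(** The denominator is convex on [0, 1] and negative at 1. *)
Let char_fun_pos s c theta : 0 < s -> 0 <= theta < c -> c < 1 -> char_fun s c = 0 ->
  0 < char_fun s theta.
Proof.
move=> s0 /andP[t0 tc] c1 pc; have s0' := ltW s0.
have t1 : theta < 1 by exact: lt_trans tc c1.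
have c0 : 0 <= c by rewrite (le_trans t0)// ltW.
pose p := (1 - c) / (1 - theta).
have t1' : 0 < 1 - theta by rewrite subr_gt0.
have p0 : 0 < p by rewrite divr_gt0// subr_gt0.
have p1 : p < 1 by rewrite ltr_pdivrMr// mul1r ltrD2l ltrN2.
have cE : c = p * theta + (1 - p).
  by rewrite /p; field; rewrite gt_eqF.
have nt : `|theta| <= 1 by rewrite ger0_norm// ltW.
have nc : `|c| <= 1 by rewrite ger0_norm// ltW.
have n1 : `|1 : R| <= 1 by rewrite normr1.
have conv : transform s c <= p * transform s theta + (1 - p) * lap s.
  rewrite -transform1.
  have h : (fun n => p * series (scaled theta (service_coef s)) n +
      (1 - p) * series (scaled 1 (service_coef s)) n) @ \oo -->
      p * transform s theta + (1 - p) * transform s 1.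
    by apply: cvgD; apply: cvgM; rewrite //; try exact: cvg_cst; exact: transformE.
  apply: (ler_cvg_to (transformE s0' nc) h); near=> n.
  rewrite /series/= !mulr_sumr -big_split/=; apply: ler_sum => i _.
  rewrite /scaled expr1n mul1r mulrA -mulrDl ler_wpM2r ?coef_ge0//.
  by rewrite cE convex_exprn// ?t0 ?(ltW t1) ?(ltW p0) ?(ltW p1).
have f1 : lap s < 1 by apply: laplace_lt1 => //; exact: eta_gt0.
move: pc conv; rewrite /char_fun -!/(transform s _) => pc conv.
have l0 := lam_ge0 M; have l1 := lam_lt1 M.
have e1 : (1 - lam) * transform s c <= (1 - lam) * (p * transform s theta + (1 - p) * lap s).
  by rewrite ler_wpM2l// ltW.
have e2 : (1 - lam) * ((1 - p) * lap s) < (1 - lam) * (1 - p).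
  by rewrite ltr_pM2l// -[ltRHS]mulr1 ltr_pM2l// subr_gt0.
have : 0 < p * ((1 - lam) * transform s theta + lam - theta) by nra.
by rewrite pmulr_rgt0.
Unshelve. all: by end_near.
Qed.

(** The root is the least point where the nondecreasing right-hand side
    lam + (1 - lam) * transform s theta does not exceed theta, as in the
    Knaster-Tarski theorem. *)
Let root_exists s : 0 < s -> exists theta, `|theta| < 1 /\
  theta - lam = (1 - lam) * transform s theta.
Proof.
move=> s0; have s0' := ltW s0.
have l0 := lam_ge0 M; have l1 := lam_lt1 M.
pose psi t := lam + (1 - lam) * transform s t.
have f1 : lap s < 1 by apply: laplace_lt1 => //; exact: eta_gt0.
have psi_nd t u : 0 <= t -> t <= u -> u <= 1 -> psi t <= psi u.
  by move=> t0 tu u1; rewrite lerD2l ler_pM2l// transform_nd.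
have psi1 : psi 1 < 1.
  have : (1 - lam) * lap s < (1 - lam) * 1 by rewrite ltr_pM2l.
  by rewrite /psi transform1; lra.
have psi0 t : 0 <= t <= 1 -> 0 <= psi t.
  by move=> t01; rewrite addr_ge0// mulr_ge0 ?(ltW onem_lam_gt0)// ltW// transform_gt0.
pose S := [set t : R | 0 <= t <= 1 /\ psi t <= t].
have S1 : S 1 by split; [rewrite ler01 lexx|exact: ltW].
have Slb : has_lbound S by exists 0 => t [/andP[]].
pose c := inf S.
have c0 : 0 <= c by apply: lb_le_inf; [exists 1|move=> t [/andP[]]].
have cle t : S t -> c <= t by move=> St; exact: ge_inf.
have c1 : c <= 1 by exact: cle.
have pc : psi c <= c.
  apply: lb_le_inf; first by exists 1.
  move=> t St; have [/andP[t0 t1] pt] := St.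
  by apply: le_trans pt; apply: psi_nd => //; exact: cle.
have cp : c <= psi c.
  apply: cle; split; first by rewrite psi0 ?c0//= (le_trans pc).
  by apply: psi_nd => //; rewrite psi0// c0.
have ce : c = psi c by apply/eqP; rewrite eq_le cp pc.
exists c; split; last by rewrite [X in X - _]ce /psi addrAC subrr add0r.
by rewrite ger0_norm// ce; apply: le_lt_trans psi1; exact: psi_nd.
Qed.

Let k_fun_le0 t : `|t| <= 1 -> k_fun M t <= 0.
Proof.
move=> t1; have n1 : `|1 : R| <= 1 by rewrite normr1.
have mk := measurable_funP (m_kappa M).
rewrite /k_fun /cumulant pmulr_rle0 ?mu_gt0// subr_le0.
have E1 : fine ('E_P[fun w => (1 ^+ m_kappa M w)%R])%E = 1.
  rewrite (_ : (fun w => _) = cst 1); last by apply/funext => w; rewrite expr1n.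
  by rewrite expectation_cst.
have h1 := pgf_series (P := P) (mk setT) t1; have h2 := pgf_series (P := P) (mk setT) n1.
rewrite E1 in h2; apply: (ler_cvg_to h1 h2); near=> n.
apply: ler_sum => i _; rewrite ler_wpM2r ?fine_ge0// expr1n.
by rewrite (le_trans (ler_norm _))// normrX exprn_ile1.
Unshelve. all: by end_near.
Qed.

Lemma c_rootP s : 0 < s ->
  [/\ lam < c_root M s, c_root M s < 1 & char_fun s (c_root M s) = 0].
Proof.
move=> s0; have [] : `|c_root M s| < 1 /\
    c_root M s - lam = (1 - lam) * transform s (c_root M s).
  exact: (xgetPex 0 (root_exists s0)).
move: (c_root M s) => c c1 ce; split.
- rewrite -subr_gt0 ce mulr_gt0//.
  have kc := k_fun_le0 (ltW c1).
  have sk : 0 <= s - k_fun M c by rewrite subr_ge0 (le_trans kc)// ltW.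
  by have /andP[] := laplace_itv eta_pos sk.
- by move: c1; rewrite ltr_norml => /andP[].
- by rewrite /char_fun -/(transform s c) -ce subrK subrr.
Qed.

Lemma zero_free_root s : 0 < s -> zero_free s (c_root M s).
Proof.
move=> s0; have [lc c1 pc] := c_rootP s0; exists (c_root M s).
have c0 : 0 < c_root M s by exact: le_lt_trans (lam_ge0 M) lc.
split=> //; [by rewrite c0 lexx|exact: ltW|].
by move=> t t0; exact: char_fun_pos pc.
Qed.

Let char_fun_antitone s u t : 0 <= s -> s <= u -> 0 <= t <= 1 -> char_fun u t <= char_fun s t.
Proof.
move=> s0 su t01; rewrite /char_fun !lerD2r ler_pM2l//.
exact: transform_antitone.
Qed.

Let c_root_antitone s u : 0 < s -> s <= u -> c_root M u <= c_root M s.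
Proof.
move=> s0 su; rewrite leNgt; apply/negP => h.
have u0 := lt_le_trans s0 su.
have [lc c1 pc] := c_rootP s0; have [_ cu1 pu] := c_rootP u0.
have c0 : 0 <= c_root M s by rewrite ltW// (le_lt_trans (lam_ge0 M) lc).
have := @char_fun_pos u _ (c_root M s) u0 _ cu1 pu; rewrite c0 h => /(_ isT).
have := @char_fun_antitone s u (c_root M s) (ltW s0) su.
by rewrite c0 (ltW c1) pc => /(_ isT) h1 h2; have := lt_le_trans h2 h1; rewrite ltxx.
Qed.

Let cvg_c_root : c_root M u @[u --> 0^'+] --> c_fun M 0.
Proof.
rewrite /c_fun ltxx; apply: nonincreasing_at_right_is_cvgr.
  near=> e => u v; rewrite !in_itv/= => /andP[u0 _] /andP[v0 _] uv.
  exact: c_root_antitone.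
near=> e; exists 1 => z /= [u]; rewrite in_itv/= => /andP[u0 _] <-.
by have [_ /ltW] := c_rootP u0.
Unshelve. all: by end_near.
Qed.

Lemma c_fun_gt_lam s : 0 <= s -> lam < c_fun M s.
Proof.
rewrite le_eqVlt => /predU1P[<-|s0]; last by rewrite /c_fun s0; have [] := c_rootP s0.
have [l _ _] := c_rootP (@ltr01 R); apply: lt_le_trans l _.
apply: (cvgr_to_ge cvg_c_root); near=> u.
by apply: c_root_antitone => //; near: u; exact: nbhs_right_le.
Unshelve. all: by end_near.
Qed.

(** For s = 0 the denominator vanishes at 1; it is positive before c(0), the limit
    of c(u), because it is at least the denominator for u > 0. *)
Lemma zero_free_c_fun s : 0 <= s -> zero_free s (c_fun M s).
Proof.
move=> s0; have lc := c_fun_gt_lam s0.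
have c0 : 0 < c_fun M s by exact: le_lt_trans (lam_ge0 M) lc.
move: s0 lc c0; rewrite le_eqVlt => /predU1P[<-|s0] lc c0; last first.
  by rewrite /c_fun s0; exact: zero_free_root.
exists 1; split => //.
- rewrite c0/=; apply: (cvgr_to_le cvg_c_root); near=> u.
  have u0 : 0 < u by [].
  by have [_ /ltW] := c_rootP u0.
- rewrite /char_fun k_fun1 subr0 laplace_pos_part ?eta_pos//.
  rewrite (_ : (fun w => _) = cst 1) ?mean_cst ?mulr1; first by rewrite subrK subrr.
  by apply/funext => w; rewrite mul0r oppr0 expR0.
- move=> t /andP[t0 tc]; near (0 : R)^'+ => u.
  have u0 : 0 < u by [].
  have tu : t < c_root M u by near: u; exact: cvgr_gt cvg_c_root _ tc.
  have [_ cu1 pu] := c_rootP u0.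
  apply: (@lt_le_trans _ _ (char_fun u t)).
    by apply: char_fun_pos pu => //; rewrite t0.
  by apply: char_fun_antitone; rewrite ?lexx ?(ltW u0)// t0 ltW// (lt_trans tu).
Unshelve. all: by end_near.
Qed.

End resolvent_theory.

(** * Sums of the resolvent sequence *)

Section recip_continuity.
Context {R : realType}.

Lemma cvg_sum_ord (n : nat) (u : nat -> 'I_n -> R) (l : 'I_n -> R) :
  (forall i, u ^~ i @ \oo --> l i) ->
  (fun m => \sum_(i < n) u m i) @ \oo --> \sum_(i < n) l i.
Proof.
elim: n u l => [|n IH] u l ul.
  by under eq_fun do rewrite big_ord0; rewrite big_ord0; exact: cvg_cst.
under eq_fun do rewrite big_ord_recr; rewrite big_ord_recr.
apply: cvgD; last exact: ul.
exact: (IH (fun m i => u m (widen_ord (leqnSn n) i))).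
Qed.

Lemma cvg_conv_coef (u v : nat -> nat -> R) (u' v' : nat -> R) n :
  (forall k, (fun m => u m k) @ \oo --> u' k) -> (forall k, (fun m => v m k) @ \oo --> v' k) ->
  (fun m => conv (u m) (v m) n) @ \oo --> conv u' v' n.
Proof. by move=> uu vv; apply: cvg_sum_ord => i; apply: cvgM. Qed.

Lemma cvg_series_coef (u : nat -> nat -> R) (u' : nat -> R) n :
  (forall k, (fun m => u m k) @ \oo --> u' k) ->
  (fun m => series (u m) n) @ \oo --> series u' n.
Proof.
move=> uu; rewrite /series/= big_mkord; under eq_fun do rewrite big_mkord.
by apply: cvg_sum_ord.
Qed.

Lemma cvg_recip_coef (v : nat -> nat -> R) (v' : nat -> R) n : v' 0%N != 0 ->
  (forall k, (fun m => v m k) @ \oo --> v' k) ->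
  (fun m => recip (v m) n) @ \oo --> recip v' n.
Proof.
move=> v0 vv; elim/ltn_ind: n => -[|n] IH; first by rewrite /recip/=; apply: cvgV.
rewrite recipS; under eq_fun do rewrite recipS.
apply: cvgM; first by apply: cvgN; apply: cvgV.
by apply: cvg_sum_ord => i; apply: cvgM; [exact: vv|apply: IH; rewrite ltnS leq_subr].
Qed.

End recip_continuity.

Section mean_sum.
Context d (T : measurableType d) (R : realType) (P : probability T R) (M : model P).
Variable X : R -> {RV P >-> nat}.
Hypothesis HX : compound_poisson (m_mu M) (m_kappa M) X.
Local Notation lam := (m_lam M).
Local Notation scale := (scale M X).
Local Notation service_coef := (service_coef M X).
Local Notation residual_coef := (residual_coef M X).

Lemma resolvent_sumE s x B r : (1 <= r <= B.+1)%N ->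
  resolvent_sum M s x (B%:Z - r%:Z) = series (resolvent M s x) (B.+1 - r)%N.
Proof.
move=> /andP[r1]; rewrite leq_eqVlt => /predU1P[->|]; last first.
  by rewrite ltnS => rB; rewrite subzn// subSn.
by rewrite subnn /series/= big_geq// (_ : B%:Z - B.+1%:Z = Negz 0)//; lia.
Qed.

(** Since lam < c(s), the scale sequence grows at most like t^-n for some t > lam. *)
Lemma cvg_mean_sum_tail s B : 0 <= s ->
  (fun n => lam ^+ n * (1 + (1 - lam) * series (scale s) (B + n)%N)) @ \oo --> (0 : R).
Proof.
move=> s0; have zf := zero_free_c_fun HX s0; have lc := c_fun_gt_lam HX s0.
have l0 := lam_ge0 M; have l1 := lam_lt1 M.
have [c [/andP[r0 rc] c1 _ _]] := zf.
pose t := (lam + c_fun M s) / 2.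
have lt : lam < t by rewrite /t; lra.
have tc : t < c_fun M s by rewrite /t; lra.
have t0 : 0 < t by exact: le_lt_trans lt.
have t1 : t < 1 by rewrite (lt_le_trans tc)// (le_trans rc).
have cs : cvgn (series (scaled t (scale s))) by apply: (cvg_scale HX s0 zf); rewrite ltW.
have e0 n : 0 <= scale s n by exact: (scale_ge0 HX n s0 zf).
set K := limn (series (scaled t (scale s))) in cs.
have sK n : series (scale s) n <= K * t^-1 ^+ n.
  have sn : series (scaled t (scale s)) n <= K.
    by apply: (series_cvg_le n _ cs) => k; rewrite mulr_ge0// exprn_ge0// ltW.
  rewrite exprVn ler_pdivlMr ?exprn_gt0//; apply: le_trans sn.
  rewrite /series/= mulr_suml; apply: ler_sum_nat => i /andP[_ iN].
  rewrite /scaled mulrC ler_wpM2r//.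
  by rewrite -(subnK (ltnW iN)) exprD ler_piMl ?exprn_ge0 ?(ltW t0)// exprn_ile1 ?ltW.
have g1 : geometric 1 lam @ \oo --> (0 : R) by apply: cvg_geometric; rewrite ger0_norm.
have g2 : geometric ((1 - lam) * (K * t^-1 ^+ B)) (lam / t) @ \oo --> (0 : R).
  have lt0 : 0 <= lam / t by apply: divr_ge0 => //; exact: ltW.
  apply: cvg_geometric; rewrite ger0_norm//.
  by rewrite ltr_pdivrMr// mul1r.
apply: (@squeeze_cvgr _ _ _ _ (cst 0)
   (fun n => geometric 1 lam n + geometric ((1 - lam) * (K * t^-1 ^+ B)) (lam / t) n)).
- near=> n; rewrite mulr_ge0 ?exprn_ge0//=; last first.
    by rewrite addr_ge0// mulr_ge0 ?subr_ge0 ?(ltW l1)// series_ge0.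
  rewrite mulrDr mulr1 mul1r lerD2l exprMn.
  have -> : (1 - lam) * (K * t^-1 ^+ B) * (lam ^+ n * t^-1 ^+ n) =
    lam ^+ n * ((1 - lam) * (K * t^-1 ^+ (B + n))) by rewrite exprD; ring.
  apply: ler_wpM2l; first exact: exprn_ge0.
  by apply: ler_wpM2l; rewrite ?subr_ge0 ?(ltW l1).
- exact: cvg_cst.
- by rewrite -[X in _ --> X]addr0; exact: cvgD.
Unshelve. all: by end_near.
Qed.

Lemma discrete_mean (Y : {RV P >-> nat}) (g : nat -> R) : (forall n, 0 <= g n) ->
  (\int[P]_w (g (Y w))%:E = \sum_(n <oo) (g n)%:E * P [set w | Y w = n])%E.
Proof.
move=> g0; have mY : measurable_fun setT Y by exact: measurable_funP.
have mg : measurable_fun setT (fun w => g (Y w)).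
  by move=> _ A _; exact: (mY measurableT (g @^-1` A) Logic.I).
rewrite (integral_fibers P mY mg)//; apply: eq_eseriesr => n _.
have mS : measurable_fun setT (fun w => (Y w == n)%:R : R).
  by apply: measurable_natb; exact: measurable_fun_eqn mY (measurable_cst n).
transitivity (\int[P]_w (g n * (Y w == n)%:R)%:E)%E.
  by apply: eq_integral => w _; case: eqVneq => [->|_]; rewrite ?mulr0.
by rewrite ge0_integralZl_real// integral_fiber.
Qed.

Lemma resolvent_fresh s : 0 <= s ->
  resolvent M s 0 = resolvent_seq lam (service_coef s) (service_coef s).
Proof.
move=> s0; rewrite (resolventE HX s0 (zero_free_c_fun HX s0) (lexx 0)) ?distrfun0//.
by rewrite (residual_coef0 HX).
Qed.

Lemma resolvent_fresh_ge0 s n : 0 <= s -> 0 <= series (resolvent M s 0) n.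
Proof.
move=> s0; apply: series_ge0 => k; rewrite resolvent_fresh//.
apply: mulr_ge0; first by rewrite subr_ge0 ltW// lam_lt1.
apply: conv_ge0 => i; first exact: coef_ge0.
exact: (scale_ge0 HX i s0 (zero_free_c_fun HX s0)).
Qed.

Lemma mean_resolvent_series s B : 0 <= s ->
  (\sum_(i <oo) ((1 - lam) * lam ^+ i * series (resolvent M s 0) (B + i).+1%N)%:E =
   (1 + (1 - lam) * series (scale s) B)%:E)%E.
Proof.
move=> s0; apply/cvg_lim => //; apply/fine_cvgP; split; first by near=> n; rewrite sumEFin.
have -> : fine \o (fun n => \sum_(0 <= i < n) ((1 - lam) * lam ^+ i *
     series (resolvent M s 0) (B + i).+1%N)%:E)%E =
   (fun n => 1 + (1 - lam) * series (scale s) B -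
     lam ^+ n * (1 + (1 - lam) * series (scale s) (B + n)%N)).
  apply/funext => n /=; rewrite sumEFin/=.
  rewrite -mean_sum_resolvent_seq; last by rewrite gt_eqF// (char_coef0_gt0 HX).
  rewrite mulr_sumr; apply: eq_bigr => i _.
  by rewrite -mulrA resolvent_fresh.
rewrite -[X in _ --> X]subr0; apply: cvgB; first exact: cvg_cst.
exact: cvg_mean_sum_tail.
Unshelve. all: by end_near.
Qed.

Lemma mean_resolvent_sumE s B : 0 <= s ->
  mean_resolvent_sum M B s = (1 + (1 - lam) * series (scale s) B)%:E.
Proof.
move=> s0; have l0 := lam_ge0 M; have l1 := lam_lt1 M.
pose g n := resolvent_sum M s 0 (n%:Z + B%:Z - 1).
have gS i : g i.+1 = series (resolvent M s 0) (B + i).+1%N.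
  by rewrite /g (_ : _ - 1 = Posz (B + i)%N)//; lia.
have t0 i : (0 <= (g i)%:E * P [set w | m_delta M w = i])%E.
  case: i => [|i]; last by rewrite mule_ge0// lee_fin gS resolvent_fresh_ge0.
  rewrite (_ : [set w | _] = set0) ?measure0 ?mule0//.
  by apply/seteqP; split => w //= h; have := delta_gt0 M w; rewrite h.
rewrite /mean_resolvent_sum unlock.
transitivity (\int[P]_w (Num.max 0 (g (m_delta M w)))%:E)%E.
  apply: eq_integral => w _; congr EFin; apply/esym/max_r.
  have := delta_gt0 M w; case: (m_delta M w) => // i _.
  by rewrite -/(g i.+1) gS resolvent_fresh_ge0.
rewrite (discrete_mean (m_delta M) (g := fun n => Num.max 0 (g n))); last first.
  by move=> n; rewrite le_max lexx.
rewrite nneseries_recl//; last first.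
  by move=> k _; rewrite mule_ge0// lee_fin le_max lexx.
rewrite (_ : [set w | m_delta M w = 0%N] = set0); last first.
  by apply/seteqP; split => w //= h; have := delta_gt0 M w; rewrite h.
rewrite measure0 mule0 add0e -nneseries_addn; last first.
  by move=> k; rewrite mule_ge0// lee_fin le_max lexx.
rewrite -mean_resolvent_series//; apply: eq_eseriesr => i _.
rewrite addn1 gS max_r ?resolvent_fresh_ge0// delta_geometric//= -EFinM.
by rewrite mulrC.
Qed.

Lemma mean_resolvent_sum_series s B : 0 <= s ->
  mean_resolvent_sum M B s = ((1 - lam)%:E * \sum_(1 <= i <oo)
     (lam ^+ i.-1 * resolvent_sum M s 0 (i%:Z - 1 + B%:Z)%R)%R%:E)%E.
Proof.
move=> s0; have l0 := lam_ge0 M; have l1 := lam_lt1 M.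
have gS i : resolvent_sum M s 0 (i.+1%:Z - 1 + B%:Z) = series (resolvent M s 0) (B + i).+1%N.
  by rewrite (_ : _ + B%:Z = Posz (B + i)%N)//; lia.
rewrite mean_resolvent_sumE// -mean_resolvent_series//.
pose h i := (lam ^+ i.-1 * Num.max 0 (resolvent_sum M s 0 (i%:Z - 1 + B%:Z)))%:E.
transitivity ((1 - lam)%:E * \sum_(1 <= i <oo) h i)%E.
  rewrite -[X in _ = (_ * X)%E]nneseries_addn; last first.
    by move=> i; rewrite lee_fin mulr_ge0 ?exprn_ge0// le_max lexx.
  rewrite -nneseriesZl; last first.
    by move=> i _; rewrite lee_fin mulr_ge0 ?exprn_ge0// le_max lexx.
  apply: eq_eseriesr => i _; rewrite /h addn1 gS max_r ?resolvent_fresh_ge0//=.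
  by rewrite -EFinM mulrA.
congr (_ * _)%E; apply/congr_lim/funext => n; apply: eq_big_nat => -[//|i] _.
by rewrite /h gS max_r// resolvent_fresh_ge0.
Qed.

Let half n : R := 2 ^- n.

Lemma cvg_half : half @ \oo --> (0 : R).
Proof.
have -> : half = geometric 1 2^-1 by apply/funext => n; rewrite /half /geometric/= mul1r exprVn.
by apply: cvg_geometric; rewrite ger0_norm ?invr_ge0// invf_lt1// ltr1n.
Qed.

Let half_ge0 n : 0 <= half n. Proof. by rewrite invr_ge0 exprn_ge0. Qed.

Lemma cvg_scale_half k : (fun n => scale (2 ^- n) k) @ \oo --> scale 0 k.
Proof.
apply: cvg_recip_coef; first by rewrite gt_eqF// (char_coef0_gt0 HX).
move=> i; apply: cvgB; last exact: cvg_cst.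
apply: cvgD; last exact: cvg_cst.
apply: cvgM; first exact: cvg_cst.
exact: (coef_cvg0 HX half_ge0 cvg_half).
Qed.

Lemma cvg_resolvent_half x n : 0 <= x -> distrfun (m_eta M) x < 1 ->
  (fun m => series (resolvent M (2 ^- m) x) n) @ \oo --> series (resolvent M 0 x) n.
Proof.
move=> x0 Fx; apply: cvg_series_coef => k.
rewrite (resolventE HX (lexx 0) (zero_free_c_fun HX (lexx 0)) x0 Fx).
have -> : (fun m => resolvent M (2 ^- m) x k) = (fun m => (1 - lam) *
    conv (residual_coef (2 ^- m) x) (scale (2 ^- m)) k).
  apply/funext => m.
  by rewrite (resolventE HX (half_ge0 m) (zero_free_c_fun HX (half_ge0 m)) x0 Fx).
apply: cvgM; first exact: cvg_cst.
apply: cvg_conv_coef => i; last exact: cvg_scale_half.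
exact: (coef_cvg0 HX half_ge0 cvg_half).
Qed.

End mean_sum.

(** * The random sources of the first cycle *)

Section sources.
Context d (T : measurableType d) (R : realType) (P : probability T R) (M : model P)
  (x : R) (W : driver M x).

Definition source_algebra (j : source) : set (set T) :=
  match j with
  | Arrivals n => sigma_process (arrivals W n)
  | Residual n => sigma_fun (residual W n)
  | Service n i => sigma_fun (service W n i)
  | Reduction n i => sigma_fun (reduction W n i)
  | Idle n => sigma_fun (idle W n)
  | Batch n => sigma_fun (batch W n)
  end.

Lemma sigma_fun_measurable d' (U : measurableType d') (Y : {RV P >-> U}) :
  sigma_fun Y `<=` measurable.
Proof. by move=> _ [A mA <-]; exact: measurable_funP. Qed.

Lemma sigma_funI d' (U : measurableType d') (Y : {RV P >-> U}) : setI_closed (sigma_fun Y).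
Proof.
move=> _ _ [A mA <-] [B mB <-]; exists (A `&` B); first exact: measurableI.
by rewrite !setTI.
Qed.

Lemma sigma_funT d' (U : measurableType d') (Y : {RV P >-> U}) : sigma_fun Y setT.
Proof. by exists setT => //; rewrite setTI. Qed.

Lemma source_algebra_measurable j : source_algebra j `<=` measurable.
Proof.
case: j => [n|n|n i|n i|n|n] /=; try exact: sigma_fun_measurable.
apply: smallest_sub; first exact: sigma_algebra_measurable.
by move=> A [t t0 At]; apply: (sigma_fun_measurable At).
Qed.

Lemma source_algebraI j : setI_closed (source_algebra j).
Proof.
case: j => [n|n|n i|n i|n|n] /=; try exact: sigma_funI.
by move=> A B; exact: (@measurableI _ (g_sigma_algebraType _)).
Qed.

Lemma source_algebraT j : source_algebra j setT.
Proof.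
case: j => [n|n|n i|n i|n|n] /=; try exact: sigma_funT.
exact: (@measurableT _ (g_sigma_algebraType _)).
Qed.

(* The arrivals first, then the durations and the reductions alternately. *)
Definition cycle_source j : source :=
  if j is i.+1 then
    if odd i then Reduction 0 i./2 else if i./2 is m.+1 then Service 0 m else Residual 0
  else Arrivals 0.

Lemma cycle_source_odd i : cycle_source i.*2.+1 = if i is m.+1 then Service 0 m else Residual 0.
Proof. by rewrite /cycle_source odd_double doubleK. Qed.

Lemma cycle_source_even i : cycle_source i.*2.+2 = Reduction 0 i.
Proof. by rewrite /cycle_source /= odd_double/= uphalf_double. Qed.

Lemma cycle_source_inj : injective cycle_source.
Proof.
have src j : [\/ j = 0%N, exists i, j = i.*2.+1 | exists i, j = i.*2.+2].
  case: j => [|j]; first exact: Or31.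
  rewrite -(odd_double_half j); case: (odd j); rewrite ?add1n ?add0n.
    by apply: Or33; exists j./2.
  by apply: Or32; exists j./2.
move=> a b.
case: (src a) => [->|[i ->]|[i ->]]; case: (src b) => [->|[j ->]|[j ->]] //;
  rewrite ?cycle_source_even ?cycle_source_odd //.
- by case: j.
- by case: i.
- by case: i => [|i]; case: j => [|j]// [->].
- by case: i.
- by case: j.
- by move=> [->].
Qed.

Definition cycle_algebra j := source_algebra (cycle_source j).

Lemma cycle_algebra_independent n (A : nat -> set T) : (forall i, cycle_algebra i (A i)) ->
  P (\bigcap_(i < n) A i) = (\prod_(i < n) P (A i))%E.
Proof.
move=> AG; have := @driver_independent _ _ _ _ _ _ W n (cycle_source \o val)
  (inj_comp cycle_source_inj val_inj) (fun i => A i) (fun i => AG i).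
move=> <-; congr (P _).
by apply/seteqP; split => w h i ni; [exact: (h i (ltn_ord i))|exact: (h (Ordinal ni))].
Qed.

Definition duration i : {RV P >-> R} := if i is m.+1 then service W 0 m else residual W 0.

Lemma duration_algebra i A : measurable A -> cycle_algebra i.*2.+1 (duration i @^-1` A).
Proof.
by move=> mA; rewrite /cycle_algebra cycle_source_odd; case: i => [|i]/=;
   exists A => //; rewrite setTI.
Qed.

Lemma reduction_algebra i A : measurable A -> cycle_algebra i.*2.+2 (reduction W 0 i @^-1` A).
Proof. by move=> mA; rewrite /cycle_algebra cycle_source_even; exists A => //; rewrite setTI. Qed.

Lemma arrivals_algebra (t : R) A : 0 <= t -> measurable A ->
  cycle_algebra 0 (arrivals W 0 t @^-1` A).
Proof.
move=> t0 mA; apply: sub_sigma_algebra; exists t => //.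
by exists A => //; rewrite setTI.
Qed.

(** The product has one factor for each of the sources 1, ..., 2 n. *)
Lemma mean_prod_services n (phi : nat -> R -> R) (chi : nat -> nat -> R) :
  (forall i, measurable_fun setT (phi i)) ->
  (forall i y, 0 <= phi i y) -> (forall i k, 0 <= chi i k) ->
  (\int[P]_w (\prod_(i < n) (phi i (duration i w) * chi i (reduction W 0 i w)))%:E =
   \prod_(i < n) (\int[P]_w (phi i (duration i w))%:E *
                  \int[P]_w (chi i (reduction W 0 i w))%:E))%E.
Proof.
move=> mphi phi0 chi0.
pose f j w : R := if j is i.+1 then
  if odd i then chi i./2 (reduction W 0 i./2 w) else phi i./2 (duration i./2 w) else 1.
have f_odd i : f i.*2.+1 = fun w => phi i (duration i w).
  by rewrite /f odd_double doubleK.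
have f_even i : f i.*2.+2 = fun w => chi i (reduction W 0 i w).
  by rewrite /f /= odd_double/= uphalf_double.
have prodE (U : Type) (idx : U) (op : Monoid.law idx) (F : nat -> U) :
    \big[op/idx]_(j < n.*2.+1) F j =
    op (F 0%N) (\big[op/idx]_(i < n) op (F i.*2.+1) (F i.*2.+2)).
  elim: n => [|m IH]; first by rewrite big_ord_recr/= !big_ord0 Monoid.mul1m Monoid.mulm1.
  by rewrite doubleS big_ord_recr/= big_ord_recr/= IH big_ord_recr/= !Monoid.mulmA.
have mf i : (i < n.*2.+1)%N -> forall A, measurable A -> cycle_algebra i (f i @^-1` A).
  case: i => [|i] _ A mA.
    rewrite /f (_ : _ @^-1` A = if 1 \in A then setT else set0).
      by case: ifP => _; [exact: source_algebraT|exact: (@measurable0 _ (g_sigma_algebraType _))].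
    case: ifPn => h; apply/seteqP; split => w //=; last by move/negP: h; rewrite inE.
    by rewrite inE in h.
  rewrite -(odd_double_half i); case: (odd i); rewrite ?add1n ?add0n.
    by rewrite f_even; exact: (@reduction_algebra i./2 (chi i./2 @^-1` A)).
  rewrite f_odd; apply: (@duration_algebra i./2 (phi i./2 @^-1` A)).
  by rewrite -[X in measurable X]setTI; exact: mphi.
have f0 i w : 0 <= f i w by case: i => [|i] //; rewrite /f; case: odd.
have E := @independent_prod _ T R P cycle_algebra
  (fun i => @source_algebra_measurable _) (fun i => @source_algebraI _)
  (fun i => @source_algebraT _) cycle_algebra_independent n.*2.+1 f mf f0.
transitivity (\int[P]_w (\prod_(i < n.*2.+1) f i w)%:E)%E.
  apply: eq_integral => w _; congr EFin; rewrite (prodE _ _ _ (fun j => f j w)) [f 0%N w]/f.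
  by rewrite [RHS]mul1r; apply: eq_bigr => i _; rewrite f_odd f_even.
rewrite E (prodE _ _ _ (fun j => \int[P]_w (f j w)%:E)%E).
have -> : (\int[P]_w (f 0%N w)%:E = 1%:E)%E.
  by have := expectation_cst P 1; rewrite unlock; apply.
by rewrite [LHS]mul1e; apply: eq_bigr => i _; rewrite f_odd f_even.
Qed.

Let p j := j == 0%N.
Let q j := j != 0%N.

(** The space with the sigma-algebra of the arrivals, respectively of the sources
    1, ..., n. *)
Definition arrivals_type n := g_sigma_algebraType (cylinders cycle_algebra p n.+1).
Definition services_type n := g_sigma_algebraType (cylinders cycle_algebra q n.+1).

Lemma freeze_arrivals n (f : T -> T -> R) :
  measurable_fun setT (fun z : arrivals_type n * services_type n => f z.1 z.2) ->
  (forall w v, 0 <= f w v) ->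
  (\int[P]_w (f w w)%:E = \int[P]_v \int[P]_w (f w v)%:E)%E.
Proof.
move=> mf f0.
have := @freezing _ T R P (cylinders cycle_algebra p n.+1) (cylinders cycle_algebra q n.+1)
  _ _ _ _ _ _ _ (fun z => (f z.1 z.2)%:E).
apply => //.
- by apply: cylinders_measurable => i; exact: source_algebra_measurable.
- by apply: cylinders_measurable => i; exact: source_algebra_measurable.
- by apply: cylindersI => i; exact: source_algebraI.
- by apply: cylindersI => i; exact: source_algebraI.
- by apply: cylindersT => i; exact: source_algebraT.
- by apply: cylindersT => i; exact: source_algebraT.
- move=> A B; apply: cylinders_independent.
  + by move=> i; exact: source_algebraI.
  + by move=> *; exact: cycle_algebra_independent.
  + by move=> i; rewrite andbN.
- exact/measurable_EFinP.
- by move=> z; rewrite lee_fin.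
Qed.

Lemma measurable_arrivals n (t : R) : 0 <= t ->
  measurable_fun setT (arrivals W 0 t : arrivals_type n -> nat).
Proof.
move=> t0; apply: (@measurable_cylinders _ _ cycle_algebra _ p _ 0%N) => //.
- by move=> i; exact: source_algebraT.
- by move=> A mA; exact: arrivals_algebra.
Qed.

Lemma measurable_duration n i : (i.*2.+1 <= n)%N ->
  measurable_fun setT (duration i : services_type n -> R).
Proof.
move=> hi; apply: (@measurable_cylinders _ _ cycle_algebra _ q _ i.*2.+1) => //.
- by move=> j; exact: source_algebraT.
- by move=> A mA; exact: duration_algebra.
Qed.

Lemma measurable_reduction n i : (i.*2.+2 <= n)%N ->
  measurable_fun setT (reduction W 0 i : services_type n -> nat).
Proof.
move=> hi; apply: (@measurable_cylinders _ _ cycle_algebra _ q _ i.*2.+2) => //.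
- by move=> j; exact: source_algebraT.
- by move=> A mA; exact: reduction_algebra.
Qed.

End sources.

(** * Services and arrivals *)

Section services.
Context d (T : measurableType d) (R : realType) (P : probability T R) (M : model P)
  (x : R) (W : driver M x).
Local Notation A := (arrivals W 0).
Local Notation D := (reduction W 0).
Local Notation H := (duration W).
Let HA := arrivalsP W 0.

Definition service_time n w : R := \sum_(i < n) pos_part (H i) w.

Definition arrived i w : nat := (A (service_time i.+1 w) w - A (service_time i w) w)%N.

Definition history n w : seq (nat * nat) := mkseq (fun i => (arrived i w, D i w)) n.

Definition discount s n w : R := expR (- (s * service_time n w)).

Lemma service_time_ge0 n w : 0 <= service_time n w.
Proof. by apply: sumr_ge0 => i _; exact: pos_part_ge0. Qed.

Lemma service_timeS n w : service_time n.+1 w = service_time n w + pos_part (H n) w.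
Proof. by rewrite /service_time big_ord_recr. Qed.

Lemma service_time_nd w : {homo service_time^~ w : i j / (i <= j)%N >-> i <= j}.
Proof.
by apply/nondecreasing_seqP => n; rewrite service_timeS lerDl pos_part_ge0.
Qed.

Lemma measurable_service_time_sub n N : (n.*2 <= N)%N ->
  measurable_fun setT (service_time n : services_type W N -> R).
Proof.
move=> nN; rewrite /service_time.
rewrite (_ : (fun w => _) = fun w => \sum_(i <- index_enum 'I_n) pos_part (H i) w)//.
apply: measurable_sum => i; apply: measurable_pos_part.
by apply: measurable_duration; have := ltn_ord i; lia.
Qed.

Lemma measurable_service_time n : measurable_fun setT (service_time n).
Proof.
rewrite /service_time.
rewrite (_ : (fun w => _) = fun w => \sum_(i <- index_enum 'I_n) pos_part (H i) w)//.
by apply: measurable_sum => i; apply: measurable_pos_part; exact: measurable_funP.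
Qed.

Lemma measurable_discount s n : measurable_fun setT (discount s n).
Proof.
apply: measurableT_comp => //; apply: measurableT_comp => //.
by apply: measurable_funM => //; exact: measurable_service_time.
Qed.

Lemma discount_itv s n w : 0 <= s -> 0 < discount s n w <= 1.
Proof.
by move=> s0; rewrite expR_gt0/= -expR0 ler_expR oppr_le0 mulr_ge0// service_time_ge0.
Qed.

Lemma discountE s n w : discount s n w = \prod_(i < n) expR (- (s * pos_part (H i) w)).
Proof.
rewrite /discount; elim: n => [|n IH].
  by rewrite /service_time !big_ord0 mulr0 oppr0 expR0.
by rewrite service_timeS mulrDr opprD expRD IH big_ord_recr.
Qed.

Lemma measurable_arrivals_at (tau : T -> R) : measurable_fun setT tau ->
  (forall w, 0 <= tau w) -> measurable_fun setT (fun w => A (tau w) w).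
Proof.
move=> mtau tau0.
have m := measurable_process_at (fun t _ => measurable_funP (A t))
  (cp_nondecreasing HA) (cp_right_continuous HA) mtau tau0.
have mdiag : measurable_fun setT (fun w : T => (w, w)).
  by apply: measurable_fun_pair; exact: measurable_id.
exact: (measurableT_comp m mdiag).
Qed.

Lemma measurable_arrived i : measurable_fun setT (arrived i).
Proof.
by apply: measurable_fun_subn; apply: measurable_arrivals_at;
  [exact: measurable_service_time|exact: service_time_ge0
  |exact: measurable_service_time|exact: service_time_ge0].
Qed.

Lemma prod_natb n (b : nat -> bool) :
  \prod_(i < n) (b i)%:R = [forall i : 'I_n, b i]%:R :> R.
Proof.
have [/forallP h|/forallPn[i hi]] := boolP [forall i : 'I_n, b i].
  by rewrite big1// => i _; rewrite h.
by rewrite (bigD1 i)//= (negbTE hi) mul0r.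
Qed.

(** Given the service times, the numbers of arrivals during the services are
    independent, since the arrivals have independent increments. *)
Lemma mean_history s n (c : nat -> nat * nat) : 0 <= s ->
  mean P (fun w => discount s n w *
    \prod_(i < n) ((arrived i w == (c i).1)%:R * (D i w == (c i).2)%:R)) =
  \prod_(i < n) (coef A (H i) s (c i).1 * fine (P [set w | D i w = (c i).2])).
Proof.
move=> s0; pose N := n.*2.
pose inc i v w : nat := (A (service_time i.+1 v) w - A (service_time i v) w)%N.
pose f w v : R := discount s n v *
  \prod_(i < n) ((inc i v w == (c i).1)%:R * (D i v == (c i).2)%:R).
have mst i : (i <= n)%N -> measurable_fun setT (service_time i : services_type W N -> R).
  by move=> iN; apply: measurable_service_time_sub; rewrite leq_double.
have mA i : (i <= n)%N ->
    measurable_fun setT (fun z : arrivals_type W N * services_type W N => A (service_time i z.2) z.1).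
  move=> iN.
  refine (@measurable_process_at _ _ (arrivals_type W N) (services_type W N) R
    (fun t w => A t w) _ _ _ (service_time i) _ _).
  - exact: (fun t => @measurable_arrivals _ _ _ _ _ _ W N t).
  - exact: (cp_nondecreasing HA).
  - exact: (cp_right_continuous HA).
  - exact: mst.
  - exact: service_time_ge0.
have mf : measurable_fun setT (fun z : arrivals_type W N * services_type W N => f z.1 z.2).
  apply: measurable_funM.
    apply: (measurableT_comp _ (@measurable_snd _ _ _ _)).
    rewrite (_ : discount s n = fun v => expR (- s * service_time n v)); last first.
      by apply/funext => v; rewrite /discount mulNr.
    apply: measurableT_comp => //; apply: measurable_funM => //.
    exact: (mst n (leqnn n)).
  rewrite (_ : (fun z => _) = fun z : arrivals_type W N * services_type W N =>
     \prod_(i <- index_enum 'I_n) ((inc i z.2 z.1 == (c i).1)%:R * (D i z.2 == (c i).2)%:R))//.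
  apply: measurable_prod => i _; apply: measurable_funM; apply: measurable_natb.
    apply: measurable_fun_eqn; last exact: measurable_cst.
    by apply: measurable_fun_subn; apply: mA => //; rewrite ltnW.
  apply: measurable_fun_eqn; last exact: measurable_cst.
  apply: (measurableT_comp _ (@measurable_snd _ _ _ _)).
  by apply: measurable_reduction; have := ltn_ord i; rewrite /N; lia.
have f0 w v : 0 <= f w v.
  by rewrite mulr_ge0 ?expR_ge0// prodr_ge0// => i _; rewrite mulr_ge0.
rewrite /mean (freeze_arrivals mf f0).
have inner v : (\int[P]_w (f w v)%:E = (\prod_(i < n)
    (expR (- (s * pos_part (H i) v)) * poisson_mass A (pos_part (H i) v) (c i).1 *
     (D i v == (c i).2)%:R))%:E)%E.
  pose B := \bigcap_(i < n) [set w | inc i v w = (c i).1].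
  pose C := discount s n v * \prod_(i < n) (D i v == (c i).2)%:R.
  have C0 : 0 <= C by rewrite mulr_ge0 ?expR_ge0// prodr_ge0.
  have mB : measurable B.
    apply: bigcap_measurableType => i _.
    by apply: measurable_fiber; apply: measurable_fun_subn; exact: measurable_funP.
  transitivity (\int[P]_w (C * \1_B w)%:E)%E.
    apply: eq_integral => w _; congr EFin; rewrite /f /C -mulrA; congr (_ * _).
    rewrite big_split/= mulrC; congr (_ * _).
    rewrite (prod_natb n (fun i => inc i v w == (c i).1)) indicE.
    congr (_%:R); congr nat_of_bool; apply/forallP/idP => [h|].
      by rewrite inE => i ni; apply/eqP; exact: (h (Ordinal ni)).
    by move=> /set_mem h i; apply/eqP; exact: (h i (ltn_ord i)).
  rewrite ge0_integralZl_real// integral_indic// setIT.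
  rewrite [X in (_ * X)%E](_ : _ = (\prod_(i < n)
      poisson_mass A (service_time i.+1 v - service_time i v) (c i).1)%:E); last first.
    apply: (@frozen_increments _ _ _ _ _ _ _ HA n (service_time^~ v) (fun i => (c i).1)).
      exact: service_time_ge0.
    exact: service_time_nd.
  rewrite -EFinM /C discountE -!big_split/=; congr EFin; apply: eq_bigr => i _.
  by rewrite service_timeS [_ + _ - _]addrAC subrr add0r; ring.
under eq_integral do rewrite inner.
rewrite (@mean_prod_services _ _ _ _ _ _ W n
  (fun i y => expR (- (s * Num.max y 0)) * poisson_mass A (Num.max y 0) (c i).1)
  (fun i k => (k == (c i).2)%:R)); last 3 first.
- by move=> i; exact: (measurable_coef_fun HA s (c i).1).
- by move=> i y; rewrite mulr_ge0 ?expR_ge0// poisson_mass_ge0.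
- by [].
rewrite (eq_bigr (fun i : 'I_n =>
   (coef A (H i) s (c i).1 * fine (P [set w | D i w = (c i).2]))%:E)).
  by rewrite prodEFin.
move=> i _; rewrite EFinM; congr (_ * _)%E.
  apply: integral_mean => w; exact: coef_fun_itv (pos_part_ge0 _ _).
have mD := measurable_funP (D i); rewrite fineK ?fin_num_measure//; last exact: measurable_fiber.
exact: integral_fiber.
Qed.

Lemma history_eq n c w : size c = n -> (history n w == c)%:R =
  \prod_(i < n) ((arrived i w == (nth (0, 0)%N c i).1)%:R *
                 (D i w == (nth (0, 0)%N c i).2)%:R) :> R.
Proof.
move=> sc; rewrite (eq_bigr (fun i : 'I_n =>
  ((arrived i w, D i w) == nth (0, 0)%N c i)%:R)); last first.
  move=> i _; case: (nth _ c i) => k l /=.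
  by rewrite xpair_eqE -mulnb natrM.
rewrite (prod_natb n (fun i => (arrived i w, D i w) == nth (0, 0)%N c i)).
congr (_%:R); congr nat_of_bool; apply/eqP/forallP => [<- i|h].
  by rewrite nth_mkseq.
apply: (@eq_from_nth _ (0, 0)%N); first by rewrite size_mkseq.
move=> i; rewrite size_mkseq => ni; rewrite nth_mkseq//.
by apply/eqP; exact: (h (Ordinal ni)).
Qed.

Lemma measurable_history n c : measurable [set w | history n w = c].
Proof.
have [sc|sc] := eqVneq (size c) n; last first.
  rewrite (_ : [set w | _] = set0)//; apply/seteqP; split => w //= h.
  by move: sc; rewrite -h size_mkseq eqxx.
rewrite (_ : [set w | _] = \bigcap_(i < n)
  ([set w | arrived i w = (nth (0, 0)%N c i).1] `&` [set w | D i w = (nth (0, 0)%N c i).2])).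
  apply: bigcap_measurableType => i _; apply: measurableI.
    by apply: measurable_fiber; exact: measurable_arrived.
  by apply: measurable_fiber; exact: measurable_funP.
apply/seteqP; split => w /=.
  by move=> <- i /= ni; rewrite nth_mkseq.
move=> h; apply: (@eq_from_nth _ (0, 0)%N); first by rewrite size_mkseq.
move=> i; rewrite size_mkseq => ni; rewrite nth_mkseq//.
by have [/= -> ->] := h i ni; case: (nth _ _ _).
Qed.

Lemma measurable_of_history n d' (U : measurableType d') (g : seq (nat * nat) -> U) :
  measurable_fun setT (fun w => g (history n w)).
Proof.
move=> _ C _; rewrite setTI.
exact: (measurable_preimage_countable (g @^-1` C) (measurable_history n)).
Qed.

(** Summation of the preceding formula over the histories that satisfy Q. *)
Lemma mean_next_service s n k l (Q : pred (seq (nat * nat))) : 0 <= s ->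
  mean P (fun w => discount s n.+1 w * (arrived n w == k)%:R * (D n w == l)%:R *
                   (Q (history n w))%:R) =
  coef A (H n) s k * fine (P [set w | D n w = l]) *
  mean P (fun w => discount s n w * (Q (history n w))%:R).
Proof.
move=> s0; set a := coef _ _ _ _; set b := fine _.
have a0 : 0 <= a by exact: coef_ge0.
have b0 : 0 <= b by exact: fine_ge0.
have d01 m w := discount_itv m w s0.
have mK : measurable_fun setT (fun w => (arrived n w == k)%:R : R).
  apply: measurable_natb; apply: measurable_fun_eqn; last exact: measurable_cst.
  exact: measurable_arrived.
have mD : measurable_fun setT (fun w => (D n w == l)%:R : R).
  apply: measurable_natb; apply: measurable_fun_eqn; last exact: measurable_cst.
  exact: measurable_funP.
pose f w := discount s n.+1 w * (arrived n w == k)%:R * (D n w == l)%:R.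
pose g w := a * b * discount s n w.
have f0 w : 0 <= f w by rewrite !mulr_ge0// ltW// (andP (d01 _ _)).1.
have g0 w : 0 <= g w by rewrite !mulr_ge0// ltW// (andP (d01 _ _)).1.
have mf : measurable_fun setT f.
  by apply: measurable_funM => //; apply: measurable_funM => //; exact: measurable_discount.
have mg : measurable_fun setT g by apply: measurable_funM => //; exact: measurable_discount.
have bound1 (p q : R) (z : bool) : 0 <= p <= q -> 0 <= p * z%:R <= q.
  by case: z; rewrite ?mulr1// mulr0 lexx => /andP[/le_trans h /h].
have dd m w : 0 <= discount s m w <= 1 by have /andP[/ltW -> ->] := d01 m w.
have meanZ (h : T -> R) : measurable_fun setT h -> (forall w, 0 <= h w <= 1) ->
    (\int[P]_w (a * b * h w)%:E)%E = (a * b * mean P h)%:E.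
  move=> mh h01; rewrite ge0_integralZl_real ?mulr_ge0//.
    by rewrite (@integral_mean _ _ _ P h 1 h01) EFinM.
  by move=> w; have /andP[] := h01 w.
have fiber c : (\int[P]_w (f w * (history n w == c)%:R)%:E =
                \int[P]_w (g w * (history n w == c)%:R)%:E)%E.
  have mh : measurable_fun setT (fun w => (history n w == c)%:R : R).
    apply: measurable_natb; apply: (measurable_fun_bool true); rewrite setTI.
    rewrite (_ : _ @^-1` _ = [set w | history n w = c]); first exact: measurable_history.
    by apply/seteqP; split => w /= /eqP.
  have [sc|sc] := eqVneq (size c) n; last first.
    have h w : (history n w == c) = false.
      by apply/negP => /eqP e; move: sc; rewrite -e size_mkseq eqxx.
    by apply: eq_integral => w _; rewrite h !mulr0.
  transitivity (a * b * mean P (fun w => discount s n w * (history n w == c)%:R))%:E; last first.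
    rewrite -meanZ//; first by apply: eq_integral => w _; rewrite /g !mulrA.
      by apply: measurable_funM => //; exact: measurable_discount.
    by move=> w; exact: bound1.
  rewrite (@integral_mean _ _ _ P (fun w => f w * (history n w == c)%:R) 1); last first.
    by move=> w; rewrite /f; do 3 apply: (bound1).
  congr EFin.
  pose c' i := nth (0, 0)%N (rcons c (k, l)) i.
  have c'i (i : 'I_n) : c' i = nth (0, 0)%N c i by rewrite /c' nth_rcons sc ltn_ord.
  have c'n : c' n = (k, l) by rewrite /c' nth_rcons sc ltnn eqxx.
  have := mean_history n.+1 c' s0; rewrite big_ord_recr/= c'n/= => e1.
  have := mean_history n c' s0 => e2.
  rewrite -/a -/b -e2 mulrC in e1.
  rewrite [LHS](_ : _ = mean P (fun w => discount s n.+1 w *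
    \prod_(i < n.+1) ((arrived i w == (c' i).1)%:R * (D i w == (c' i).2)%:R))).
    rewrite e1; congr (_ * _); congr (mean P); apply/funext => w.
    rewrite (history_eq w sc); congr (_ * _).
    by apply: eq_bigr => i _; rewrite c'i.
  congr (mean P); apply/funext => w; rewrite (history_eq w sc) /f big_ord_recr/= c'n/=.
  under [in RHS]eq_bigr do rewrite c'i.
  by rewrite -!mulrA; congr (_ * _); rewrite mulrA mulrC.
have := eq_integral_fibers Q (measurable_history n) mf mg f0 g0 fiber.
rewrite (@integral_mean _ _ _ P (fun w => f w * (Q (history n w))%:R) 1); last first.
  by move=> w; rewrite /f; do 3 apply: (bound1).
move=> h; apply: EFin_inj; rewrite [LHS]h -meanZ.
- by apply: eq_integral => w _; rewrite /g !mulrA.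
- apply: measurable_funM; first exact: measurable_discount.
  exact: (measurable_of_history n (fun c => (Q c)%:R : R)).
- by move=> w; exact: bound1.
Qed.

End services.

(** * The embedded chain *)

Section mean_lemmas.
Context d (T : measurableType d) (R : realType) (P : probability T R).

Lemma mean_scale (c C : R) (h : T -> R) : 0 <= c -> measurable_fun setT h ->
  (forall w, 0 <= h w <= C) -> mean P (fun w => c * h w) = c * mean P h.
Proof.
move=> c0 mh hC; have h0 w : 0 <= h w by have /andP[] := hC w.
by rewrite {1}/mean ge0_integralZl_real// (integral_mean P hC).
Qed.

Lemma mean_add (C : R) (g h : T -> R) : measurable_fun setT g -> measurable_fun setT h ->
  (forall w, 0 <= g w <= C) -> (forall w, 0 <= h w <= C) ->
  mean P (fun w => g w + h w) = mean P g + mean P h.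
Proof.
move=> mg mh gC hC; rewrite {1}/mean.
under eq_integral do rewrite EFinD.
rewrite ge0_integralD//.
- by rewrite (integral_mean P gC) (integral_mean P hC).
- by move=> w _; rewrite lee_fin; have /andP[] := gC w.
- exact/measurable_EFinP.
- by move=> w _; rewrite lee_fin; have /andP[] := hC w.
- exact/measurable_EFinP.
Qed.

Lemma cvg_mean_fibers (X : T -> nat) (h : T -> R) (C : R) :
  measurable_fun setT X -> measurable_fun setT h -> (forall w, 0 <= h w <= C) ->
  series (fun k => mean P (fun w => h w * (X w == k)%:R)) @ \oo --> mean P h.
Proof.
move=> mX mh hC; have h0 w : 0 <= h w by have /andP[] := hC w.
apply: (ge0_integral_series (h := fun k w => h w * (X w == k)%:R)).
- move=> k; apply: measurable_funM => //; apply: measurable_natb.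
  by apply: measurable_fun_eqn => //; exact: measurable_cst.
- by move=> k w; rewrite mulr_ge0.
- move=> w; apply: cvg_near_cst; near=> n.
  rewrite /series/= sum_indicator (_ : (X w < n)%N) ?mulr1//.
  by near: n; exact: nbhs_infty_gt.
- by rewrite (integral_mean P hC) ltry.
Unshelve. all: by end_near.
Qed.

Lemma cvg_seriesZ (c l : R) (v : nat -> R) : series v @ \oo --> l ->
  series (fun i => c * v i) @ \oo --> c * l.
Proof.
move=> vl; have -> : series (fun i => c * v i) = fun n => c * series v n.
  by apply/funext => n; rewrite /series/= mulr_sumr.
by apply: cvgM => //; exact: cvg_cst.
Qed.

End mean_lemmas.

Section chain.
Context d (T : measurableType d) (R : realType) (P : probability T R) (M : model P)
  (x : R) (W : driver M x) (B r : nat).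
Local Notation A := (arrivals W 0).
Local Notation D := (reduction W 0).
Local Notation H := (duration W).
Local Notation lam := (m_lam M).
Let HA := arrivalsP W 0.
Hypothesis hr : (0 < r <= B.+1)%N.

Definition content n w : nat := level B r (arrived W ^~ w) (D ^~ w) n.

(** As a function of the history, the content is independent of the next service. *)
Definition history_content (c : seq (nat * nat)) : nat :=
  foldl (fun j kd => if j == 0%N then 0%N else (minn (j + kd.1) B.+1 - kd.2)%N) r c.

Lemma content_history n w : content n w = history_content (history W n w).
Proof.
rewrite /content; elim: n => [//|n IH] /=.
by rewrite /history mkseqS /history_content foldl_rcons -/(history_content _) -IH.
Qed.

Lemma content_le n w : (content n w <= B.+1)%N.
Proof.
rewrite /content; case: n => [|n] /=; first by case/andP: hr.
by case: ifP => // _; rewrite (leq_trans (leq_subr _ _))// geq_minr.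
Qed.

Lemma measurable_content_fun n d' (U : measurableType d') (g : nat -> U) :
  measurable_fun setT (fun w => g (content n w)).
Proof.
under eq_fun do rewrite content_history.
exact: (measurable_of_history W n (g \o history_content)).
Qed.

Lemma reduction_mass n l : fine (P [set w | D n w = l]) = geometric_mass lam l.
Proof.
have e : P [set w | D n w = l] = P [set w | m_delta M w = l].
  exact: (reductionP W 0 n (A := [set l])).
rewrite e; case: l {e} => [|l]; last by rewrite delta_geometric.
rewrite (_ : [set w | _] = set0) ?measure0//.
by apply/seteqP; split => w //= h; have := delta_gt0 M w; rewrite h.
Qed.

Hypotheses (x0 : 0 <= x) (Fx : distrfun (m_eta M) x < 1).
Variable s : R.
Hypothesis s0 : 0 < s.
Let s0' : 0 <= s := ltW s0.
Local Notation a := (service_coef M A s).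
Local Notation f := (laplace P (m_eta M) s).
Local Notation Z := (discount W s).
Local Notation value := (busy_level lam a f B).

Let f01 : 0 < f < 1.
Proof.
have /andP[-> _] := laplace_itv (eta_pos M) s0'.
by rewrite laplace_lt1//; exact: eta_gt0.
Qed.

Let d0 : char_coef lam a 0 != 0.
Proof. by rewrite gt_eqF// (char_coef0_gt0 HA). Qed.

Let scale_series_ge0 : 0 <= series (scale_seq lam a) B.
Proof.
apply: series_ge0 => i; exact: (scale_ge0 HA i s0' (zero_free_c_fun HA s0')).
Qed.

Let drain_gt0 : 0 < 1 + (1 - f) * ((1 - lam) * series (scale_seq lam a) B).
Proof.
apply: ltr_wpDr; last exact: ltr01.
have /andP[_ /ltW f1] := f01; have := lam_lt1 M => /ltW l1.
by rewrite !mulr_ge0// subr_ge0.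
Qed.

Let value_ge0 j : 0 <= value j.
Proof.
case: j => [|j]//=; rewrite /busy mulr_ge0//; first by rewrite invr_ge0 ltW.
have /andP[/ltW f0 /ltW f1] := f01.
by rewrite addr_ge0// mulr_ge0 ?subr_ge0// -(resolvent_fresh HA s0') (resolvent_fresh_ge0 HA).
Qed.

Let vmax : R := \sum_(j < B.+2) value j.

Let value_itv j : 0 <= value j <= vmax.
Proof.
rewrite value_ge0/=; have -> : value j = value (minn j B.+1).
  case: j => [//|j]; rewrite /minn; case: ltnP => // jB /=.
  by have /eqP -> : (B.+1 - j.+1 == 0)%N; rewrite ?subnn.
have jB : (minn j B.+1 < B.+2)%N by rewrite ltnS geq_minr.
rewrite /vmax (bigD1 (Ordinal jB))//= lerDl; apply: sumr_ge0 => i _; exact: value_ge0.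
Qed.

Let Z01 n w : 0 <= Z n w <= 1.
Proof. by have /andP[/ltW -> ->] := discount_itv W n w s0'. Qed.

Let bound (p q c C : R) : 0 <= p <= C -> 0 <= q <= c -> 0 <= p * q <= C * c.
Proof. by move=> /andP[p0 pC] /andP[q0 qc]; rewrite mulr_ge0//= ler_pM. Qed.

Let bool01 (b : bool) : 0 <= (b%:R : R) <= 1. Proof. by case: b; rewrite ?lexx ler01. Qed.

Let mZ n : measurable_fun setT (Z n). Proof. exact: measurable_discount. Qed.

Let mterm n m (Q : pred nat) :
  measurable_fun setT (fun w => Z n w * value (content n w) * (Q (content m w))%:R).
Proof.
apply: measurable_funM; last exact: (measurable_content_fun m (fun l => (Q l)%:R : R)).
by apply: measurable_funM => //; exact: measurable_content_fun.
Qed.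

Let term_itv n w (b : bool) : 0 <= Z n w * value (content n w) * b%:R <= vmax.
Proof. by rewrite -[vmax]mulr1 -[vmax]mul1r; do 2?apply: bound. Qed.

(** The average over the reduction is [cvg_service_end], the one over the arrivals
    during the service is [cvg_service_start]. *)
Lemma mean_transition n j g : (0 < j <= B.+1)%N ->
  series (coef A (H n) s) @ \oo --> g ->
  mean P (fun w => Z n.+1 w * value (content n.+1 w) * (content n w == j)%:R) =
  busy lam a f B (coef A (H n) s) g (B.+1 - j) *
  mean P (fun w => Z n w * (content n w == j)%:R).
Proof.
move=> jB ug; set m := mean P (fun w => Z n w * _); set u := coef A (H n) s in ug *.
have /andP[j0 jB1] := jB.
pose F w := Z n.+1 w * value (content n.+1 w) * (content n w == j)%:R.
have mF : measurable_fun setT F := mterm n.+1 n (pred1 j).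
have F01 w : 0 <= F w <= vmax := term_itv n.+1 w _.
have mA k : measurable_fun setT (fun w => (arrived W n w == k)%:R : R).
  apply: measurable_natb; apply: measurable_fun_eqn; last exact: measurable_cst.
  exact: measurable_arrived.
have mD l : measurable_fun setT (fun w => (D n w == l)%:R : R).
  apply: measurable_natb; apply: measurable_fun_eqn; last exact: measurable_cst.
  exact: measurable_funP.
have arrivals_step k : mean P (fun w => F w * (arrived W n w == k)%:R) =
    m * (u k * transit lam a f B (B.+1 - j - k)).
  have c1 := @cvg_mean_fibers _ _ _ P (D n) (fun w => F w * (arrived W n w == k)%:R)
    (vmax * 1) (measurable_funP (D n)) (measurable_funM mF (mA k))
    (fun w => bound (F01 w) (bool01 _)).
  pose j' := minn (j + k) B.+1.
  have j'B : (0 < j' <= B.+1)%N by rewrite /j' leq_min addn_gt0 j0/= geq_minr.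
  have c2 := @cvg_seriesZ _ (m * u k) _ _ (cvg_service_end d0 (lt0r_neq0 drain_gt0)
    (lam_ge0 M) (lam_lt1 M) j'B).
  rewrite mulrA (_ : B.+1 - j - k = B.+1 - j')%N; last by rewrite /j'; lia.
  apply: (cvg_unique _ c1) => //.
  rewrite (_ : (fun l => _) = fun i => m * u k * (geometric_mass lam i * value (j' - i)))//.
  apply/funext => l.
  have := mean_next_service W n k l (fun c => history_content c == j) s0'.
  rewrite reduction_mass => e.
  transitivity (mean P (fun w => value (j' - l) * (Z n.+1 w * (arrived W n w == k)%:R *
      (D n w == l)%:R * (history_content (history W n w) == j)%:R))).
    congr (mean P); apply/funext => w; rewrite /F -content_history.
    case: (eqVneq (content n w) j) => [cj|]; last by rewrite !mulr0 !mul0r.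
    case: (eqVneq (arrived W n w) k) => [ak|]; last by rewrite !(mulr0, mul0r).
    case: (eqVneq (D n w) l) => [dl|]; last by rewrite !(mulr0, mul0r).
    have -> : content n.+1 w = (j' - l)%N.
      by rewrite /content /= -/(content n w) cj gtn_eqF// ak dl.
    by rewrite !mulr1 mulrC.
  rewrite (@mean_scale _ _ _ _ _ (1 * 1 * 1 * 1))//.
  - rewrite e -/u; under [X in _ * (_ * mean _ X)]eq_fun do rewrite -content_history.
    by rewrite -/m; ring.
  - apply: measurable_funM; last first.
      exact: (measurable_of_history W n (fun c => (history_content c == j)%:R : R)).
    by apply: measurable_funM => //; apply: measurable_funM.
  - by move=> w; do 3?apply: bound.
have c1 := @cvg_mean_fibers _ _ _ P (arrived W n) F _ (measurable_arrived W n) mF F01.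
have c2 := cvg_service_start d0 (lt0r_neq0 drain_gt0) (lam_ge0 M) (lam_lt1 M)
  (m := B.+1 - j) _ ug.
have {}c2 h := @cvg_seriesZ _ m _ _ (c2 h).
rewrite [RHS]mulrC; apply: (cvg_unique _ c1) => //.
rewrite (_ : (fun k => _) = fun k => m * (u k * transit lam a f B (B.+1 - j - k))).
  by apply: c2; lia.
exact/funext.
Qed.

(** Discounted probability that service n, counted from 0, ends the busy period;
    [remaining n] is the part of the value that is left when n services are over. *)
Definition end_mass n : R :=
  mean P (fun w => Z n.+1 w * ((0 < content n w)%N && (content n.+1 w == 0%N))%:R).

Definition remaining n : R :=
  mean P (fun w => Z n w * value (content n w) * (0 < content n w)%N%:R).

Let split_next n :
  mean P (fun w => Z n.+1 w * value (content n.+1 w) * (0 < content n w)%N%:R) =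
  end_mass n + remaining n.+1.
Proof.
rewrite /end_mass /remaining -(@mean_add _ _ _ P (vmax + 1 * 1)).
- congr (mean P); apply/funext => w.
  have [c0|] := posnP (content n w).
    have -> : content n.+1 w = 0%N by rewrite /content /= -/(content n w) c0.
    by rewrite !mulr0 addr0.
  by case: (content n.+1 w) => [|j] _ /=; rewrite !(mulr0, mulr1, addr0, add0r).
- apply: measurable_funM => //; under eq_fun do rewrite -mulnb natrM.
  apply: measurable_funM; first exact: (measurable_content_fun n (fun l => (0 < l)%N%:R : R)).
  exact: (measurable_content_fun n.+1 (fun l => (l == 0%N)%:R : R)).
- exact: (mterm n.+1 n.+1 (leq 1)).
- move=> w; have /andP[-> h] := bound (Z01 n.+1 w)
    (bool01 ((0 < content n w)%N && (content n.+1 w == 0%N))).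
  apply: (le_trans h); rewrite lerDr.
  by have /andP[/le_trans h0 /h0] := value_itv 0.
- move=> w; have /andP[-> h] := term_itv n.+1 w (0 < content n.+1 w)%N.
  by apply: (le_trans h); rewrite lerDl mulr1 ler01.
Qed.

Let coef_service m : coef A (H m.+1) s = a.
Proof. by apply/funext => k; apply: (coef_same_law HA) => C mC; exact: serviceP. Qed.

Let coef_sum (Y : {RV P >-> R}) : P [set w | Y w <= 0] = 0%E ->
  series (coef A Y s) @ \oo --> laplace P Y s.
Proof.
move=> Y0; have := coef_series HA Y0 s0' (t := 1).
rewrite normr1 lexx => /(_ isT).
rewrite (_ : cumulant _ _ _ 1 = 0) ?subr0; last first.
  rewrite /cumulant (_ : (fun w => 1 ^+ _) = cst 1); last by apply/funext => w; rewrite expr1n.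
  by rewrite expectation_cst/= subrr mulr0.
rewrite (_ : scaled 1 _ = coef A Y s)//.
by apply/funext => k; rewrite /scaled expr1n mul1r.
Qed.

Lemma remaining_step n : remaining n.+1 = end_mass n.+1 + remaining n.+2.
Proof.
rewrite -split_next /remaining.
pose g1 w := Z n.+1 w * value (content n.+1 w) * (0 < content n.+1 w)%N%:R.
pose g2 w := Z n.+2 w * value (content n.+2 w) * (0 < content n.+1 w)%N%:R.
have mg1 : measurable_fun setT g1 := mterm n.+1 n.+1 (leq 1).
have mg2 : measurable_fun setT g2 := mterm n.+2 n.+1 (leq 1).
have g101 w : 0 <= g1 w <= vmax := term_itv n.+1 w _.
have g201 w : 0 <= g2 w <= vmax := term_itv n.+2 w _.
have mc : measurable_fun setT (content n.+1) := measurable_content_fun n.+1 id.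
have c1 := @cvg_mean_fibers _ _ _ P _ _ _ mc mg1 g101.
have c2 := @cvg_mean_fibers _ _ _ P _ _ _ mc mg2 g201.
apply: (cvg_unique _ c1) => //.
rewrite (_ : (fun k => mean P (fun w => g1 w * _)) =
  (fun k => mean P (fun w => g2 w * (content n.+1 w == k)%:R)))//.
apply/funext => -[|j].
  congr (mean P); apply/funext => w; rewrite /g1 /g2.
  by case: (content n.+1 w) => [|k]; rewrite !(mulr0, mul0r).
have [jB|jB] := leqP j.+1 B.+1; last first.
  have ne w : (content n.+1 w == j.+1) = false.
    by apply/negbTE; rewrite neq_ltn (leq_ltn_trans (content_le _ _)).
  by congr (mean P); apply/funext => w; rewrite ne !mulr0.
have := @mean_transition n.+1 j.+1 f jB.
rewrite [duration _ _]/= coef_service => /(_ (coef_sum (eta_pos M))) e.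
transitivity (mean P (fun w => value j.+1 * (Z n.+1 w * (content n.+1 w == j.+1)%:R))).
  congr (mean P); apply/funext => w; rewrite /g1.
  by case: eqVneq => [->|]; rewrite !(mulr0, mulr1)//= mulrC.
rewrite (@mean_scale _ _ _ _ _ (1 * 1))//; last 2 first.
- by apply: measurable_funM => //; exact: (measurable_content_fun n.+1 (fun l => (l == j.+1)%:R : R)).
- by move=> w; exact: bound.
rewrite [RHS](_ : _ = mean P (fun w => Z n.+2 w * value (content n.+2 w) *
  (content n.+1 w == j.+1)%:R)); first by rewrite e.
congr (mean P); apply/funext => w; rewrite /g2.
by case: (eqVneq (content n.+1 w) j.+1) => [->|]; rewrite !(mulr0, mulr1).
Qed.

Lemma remaining_start : end_mass 0 + remaining 1 =
  busy lam a f B (residual_coef M A s x) (laplace P (m_eta_res M x) s) (B.+1 - r).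
Proof.
rewrite -split_next.
have := @mean_transition 0 r (laplace P (m_eta_res M x) s) hr.
have -> : coef A (H 0) s = residual_coef M A s x.
  by apply/funext => k; apply: (coef_same_law HA) => C mC; exact: residual0P.
move=> /(_ (coef_sum (eta_res_pos x0 Fx))) e.
have [r0 _] := andP hr.
transitivity (mean P (fun w => Z 1 w * value (content 1 w) * (content 0 w == r)%:R)).
  by congr (mean P); apply/funext => w; rewrite /content/= eqxx r0.
rewrite e (_ : (fun w => _) = cst 1) ?mean_cst ?mulr1//.
apply/funext => w.
by rewrite /content eqxx mulr1 /discount /service_time big_ord0 mulr0 oppr0 expR0.
Qed.

Lemma mean_discount n : mean P (Z n.+1) = laplace P (m_eta_res M x) s * f ^+ n.
Proof.
pose phi (i : nat) (y : R) : R := expR (- (s * Num.max y 0)).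
have mphi i : measurable_fun setT (phi i).
  apply: measurableT_comp => //; apply: measurableT_comp => //.
  by apply: measurable_funM => //; apply: measurable_maxr.
have E (Y Y' : {RV P >-> R}) : (forall C, measurable C -> P (Y @^-1` C) = P (Y' @^-1` C)) ->
    P [set w | Y' w <= 0] = 0%E -> (\int[P]_w (phi 0%N (Y w))%:E = (laplace P Y' s)%:E)%E.
  move=> YY Y0; rewrite (integral_same_law (Y := Y') (f := fun y => (phi 0%N y)%:E))//.
  - rewrite laplace_pos_part//; apply: (@integral_mean _ _ _ P _ 1) => w.
    rewrite expR_ge0/= -expR0 ler_expR oppr_le0 mulr_ge0// le_max lexx orbT.
    by [].
  - exact/measurable_EFinP.
  - by move=> y; rewrite lee_fin expR_ge0.
have one : (\int[P]_w 1%:E = 1%:E :> \bar R)%E by have := expectation_cst P 1; rewrite unlock.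
rewrite /mean.
transitivity (fine (\int[P]_w (\prod_(i < n.+1) (phi i (H i w) * 1))%:E)).
  congr fine; apply: eq_integral => w _; rewrite discountE; congr EFin.
  by apply: eq_bigr => i _; rewrite mulr1.
rewrite (@mean_prod_services _ _ _ _ _ _ W n.+1 phi (fun _ _ => 1))//; last first.
  by move=> i y; exact: expR_ge0.
rewrite big_ord_recl/= one mule1 (E _ (m_eta_res M x)); last 2 first.
- by move=> C mC; exact: residual0P.
- exact: eta_res_pos.
rewrite (eq_bigr (fun=> f%:E)); last first.
  move=> i _; rewrite /= mule1; apply: (E _ (m_eta M)); last exact: eta_pos.
  by move=> C mC; exact: serviceP.
rewrite prodEFin -EFinM/=; congr (_ * _).
by rewrite big_const card_ord; elim: n => [//|n IH]; rewrite exprS /= IH.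
Qed.

(** The value is bounded and the discount decreases geometrically in the mean. *)
Lemma remaining_cvg0 : (fun n => remaining n.+1) @ \oo --> 0.
Proof.
have /andP[/ltW f0 f1] := f01.
have vm0 : 0 <= vmax by have /andP[/le_trans h0 /h0] := value_itv 0.
apply: (@squeeze_cvgr _ _ _ _ (cst 0) (fun n => vmax * f ^+ n)).
- apply: nearW => n; apply/andP; split.
    by apply: mean_ge0 => w; have /andP[] := term_itv n.+1 w (0 < content n.+1 w)%N.
  apply: (@le_trans _ _ (mean P (fun w => vmax * Z n.+1 w))).
    apply: (@mean_le _ _ _ _ _ _ (vmax * 1)) => w.
    + by have /andP[] := term_itv n.+1 w (0 < content n.+1 w)%N.
    + have /andP[z0 z1] := Z01 n.+1 w; have /andP[v0 v1] := value_itv (content n.+1 w).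
      rewrite [vmax * _]mulrC -[leRHS]mulr1.
      by apply: ler_pM => //; [exact: mulr_ge0|exact: ler_wpM2l|case: (0 < _)%N].
    + by apply: ler_wpM2l => //; have /andP[] := Z01 n.+1 w.
  rewrite (@mean_scale _ _ _ _ _ 1)//; apply: ler_wpM2l => //.
  rewrite mean_discount ler_piMl ?exprn_ge0//.
  by have /andP[] := laplace_itv (eta_res_pos x0 Fx) s0'.
- exact: cvg_cst.
- rewrite -[X in _ --> X](mulr0 vmax); apply: cvgM; first exact: cvg_cst.
  by apply: cvg_expr; rewrite ger0_norm.
Qed.

(** Nothing of the initial value is left in the limit. *)
Lemma end_mass_series : series end_mass @ \oo -->
  busy lam a f B (residual_coef M A s x) (laplace P (m_eta_res M x) s) (B.+1 - r).
Proof.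
rewrite -(cvg_shiftn 1) -remaining_start.
have -> : (fun n => series end_mass (n + 1)%N) =
   (fun n => end_mass 0 + remaining 1 - remaining n.+1).
  apply/funext => n; rewrite addn1; elim: n => [|n IH].
    by rewrite /series/= big_nat1 addrK.
  by rewrite seriesSr IH remaining_step [remaining n.+1]remaining_step; ring.
have := cvgB (cvg_cst (end_mass 0 + remaining 1)) remaining_cvg0.
by rewrite subr0; apply.
Qed.

End chain.

Arguments content : simpl never.

(** * The busy period as a function of the paths *)

Lemma nneseries_finite {R : realType} (u : nat -> R) n : (forall i, (n <= i)%N -> u i = 0) ->
  (\sum_(i <oo) (u i)%:E = (\sum_(0 <= i < n) u i)%:E)%E.
Proof.
move=> un; apply/cvg_lim => //; apply: cvg_near_cst.
near=> m; rewrite sumEFin (big_cat_nat (n := n))//=; last by near: m; exact: nbhs_infty_ge.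
rewrite [X in _ + X]big1_seq ?addr0// => i.
by rewrite /= mem_index_iota => /andP[ni _]; exact: un.
Unshelve. all: by end_near.
Qed.

Section busy_period_path.
Context d (T : measurableType d) (R : realType) (P : probability T R) (M : model P)
  (x : R) (W : driver M x) (B r : nat) (w : T).

Lemma first_below1_ge0 (p : R -> R) : (0 <= first_below1 p)%E.
Proof. by apply: le_ereal_inf_tmp => z /= [t [t0 _] <-]; rewrite lee_fin. Qed.

Lemma first_below1_le (p : R -> R) t : 0 <= t -> p t < 1 -> (first_below1 p <= t%:E)%E.
Proof. by move=> t0 pt; apply: ereal_inf_lbound; exists t. Qed.

Lemma cycle_idle_ge0 : (forall n, 0 < idle W n w) -> forall n, 0 <= cycle_idle W w n.
Proof. by move=> i0 [|n]//=; exact: ltW. Qed.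

Lemma cycle_begin_nd : (forall n, 0 < idle W n w) ->
  {homo cycle_begin W B r w : m n / (m <= n)%N >-> (m <= n)%E}.
Proof.
move=> i0; apply/nondecreasing_seqP => n; rewrite /cycle_begin big_nat_recr//=.
rewrite leeDl// adde_ge0 ?first_below1_ge0// lee_fin.
exact: cycle_idle_ge0.
Qed.

Lemma cycle_begin1 : cycle_begin W B r w 1 = first_below1 (cycle_content W B r w 0).
Proof. by rewrite /cycle_begin big_nat1 add0e. Qed.

(** The queue is empty at the end of the first cycle, since an idle period
    of positive length follows. *)
Lemma busy_period_first : (forall n, 0 < idle W n w) ->
  busy_period W B r w = first_below1 (cycle_content W B r w 0).
Proof.
move=> i0; set tau := first_below1 _; have tau0 : (0 <= tau)%E := first_below1_ge0 _.
have cyc m t : (cycle_begin W B r w m <= t%:E < cycle_begin W B r w m.+1)%E ->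
    current_cycle W B r w t = m.
  move=> /andP[mt tm]; rewrite /current_cycle; case: xgetP => [n -> /andP[nt tn]|/(_ m)]; last first.
    by move=> h; exfalso; apply: h; rewrite /= mt tm.
  apply/eqP; rewrite eqn_leq; apply/andP; split; rewrite leqNgt; apply/negP => /(cycle_begin_nd i0) h.
    by have := lt_le_trans tm (le_trans h nt); rewrite ltxx.
  by have := lt_le_trans tn (le_trans h mt); rewrite ltxx.
apply/eqP; rewrite eq_le; apply/andP; split; last first.
  apply: le_ereal_inf_tmp => z /= [t [t0 qt] <-]; rewrite leNgt; apply/negP => ttau.
  have c0 : current_cycle W B r w t = 0%N.
    by apply: cyc; rewrite cycle_begin1 ttau andbT /cycle_begin big_geq// lee_fin.
  move: qt; rewrite /queue c0 /cycle_begin big_geq//= !subr0 ltNge t0/= => q0.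
  have : (tau <= t%:E)%E by apply: first_below1_le => //; rewrite q0 ltr01.
  by rewrite leNgt ttau.
have [->|taufin] := eqVneq tau +oo%E; first exact: leey.
have taufn : tau \is a fin_num by rewrite ge0_fin_numE// lt_neqAle taufin leey.
have c1 : current_cycle W B r w (fine tau) = 1%N.
  apply: cyc; rewrite fineK// cycle_begin1 lexx/= /cycle_begin big_nat_recr//= big_nat1 add0e.
  rewrite -/tau; apply: (@lt_le_trans _ _ (tau + (idle W 1 w)%:E)%E).
    by rewrite -(fineK taufn) -EFinD lte_fin ltrDl.
  by rewrite leeD2l// leeDl// first_below1_ge0.
apply: ereal_inf_lbound; exists (fine tau); rewrite ?fineK//.
split; first exact: fine_ge0.
rewrite /queue c1 cycle_begin1 -/tau subrr/=.
by rewrite i0.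
Qed.

Local Notation H := (duration W).
Local Notation content := (content W B r).

Hypothesis hr : (0 < r <= B.+1)%N.

(** On such paths the first cycle is described by its embedded chain. *)
Definition regular_path : Prop :=
  [/\ forall n, 0 < idle W n w, forall i, 0 < H i w,
      forall t : R, exists n, t < service_time W n w &
      forall n, exists2 u : R, 0 <= u < service_time W n.+1 w &
        arrivals W 0 u w = arrivals W 0 (service_time W n.+1 w) w].

Hypothesis reg : regular_path.

Lemma epoch_service_time : epoch (residual W 0 w) (fun i => service W 0 i w) = service_time W ^~ w.
Proof.
have [_ H0 _ _] := reg; apply/funext => -[|n]; first by rewrite /service_time big_ord0.
rewrite /service_time big_ord_recl /epoch big_mkord; congr (_ + _).
  by rewrite /pos_part max_l// ltW//; exact: (H0 0%N).
by apply: eq_bigr => i _; rewrite /pos_part max_l// ltW//; exact: (H0 i.+1).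
Qed.

Lemma busy_period_ends n : (0 < content n w)%N -> content n.+1 w = 0%N ->
  busy_period W B r w = (service_time W n.+1 w)%:E.
Proof.
have [i0 H0 unb nj] := reg => cn cS.
rewrite busy_period_first//= -[service_time W _ w]/((service_time W ^~ w) n.+1) -epoch_service_time.
apply: first_below1_level; rewrite ?epoch_service_time//.
- exact: (cp_start (arrivalsP W 0)).
- by move=> t u; exact: (cp_nondecreasing (arrivalsP W 0)).
- exact: (H0 0%N).
- by move=> i; exact: (H0 i.+1).
Qed.

Lemma busy_period_infinite : (forall n, (0 < content n w)%N) -> busy_period W B r w = +oo%E.
Proof.
have [i0 H0 unb nj] := reg => cn; rewrite busy_period_first//=.
apply: first_below1_infty; rewrite ?epoch_service_time//.
- exact: (cp_start (arrivalsP W 0)).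
- by move=> t u; exact: (cp_nondecreasing (arrivalsP W 0)).
- exact: (H0 0%N).
- by move=> i; exact: (H0 i.+1).
Qed.

End busy_period_path.

Section busy_period_sum.
Context d (T : measurableType d) (R : realType) (P : probability T R) (M : model P)
  (x : R) (W : driver M x) (B r : nat).
Local Notation content := (content W B r).
Hypothesis hr : (0 < r <= B.+1)%N.

Lemma content_cases w : (forall n, (0 < content n w)%N) \/
  exists2 n, content n.+1 w = 0%N & forall i, (0 < content i w)%N = (i <= n)%N.
Proof.
have [ex|nex] := pselect (exists n, content n w == 0%N); last first.
  by left => n; rewrite lt0n; apply/negP => h; apply: nex; exists n.
right; case: (ex_minnP ex) => -[|n] /eqP cn nmin.
  by move: hr; rewrite -[r]/(content 0 w) cn.
exists n => // i; have [ni|ni] := leqP i n.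
  by rewrite lt0n; apply/negP => /nmin; rewrite ltnNge ni.
apply/negP => ci; have := level_antitone ni ci.
by rewrite -[level _ _ _ _ _]/(content n.+1 w) cn.
Qed.

(** A measurable function that agrees with the busy period on regular paths. *)
Definition busy_sum w : \bar R :=
  (\sum_(n <oo) (pos_part (duration W n) w * (0 < content n w)%N%:R)%:E)%E.

Lemma busy_sum_ge0 w : (0 <= busy_sum w)%E.
Proof. by apply: nneseries_ge0 => n _ _; rewrite lee_fin mulr_ge0// pos_part_ge0. Qed.

Lemma measurable_busy_sum : measurable_fun setT busy_sum.
Proof.
apply: ge0_emeasurable_sum => n w.
  by move=> _ _; rewrite lee_fin mulr_ge0// pos_part_ge0.
apply/measurable_EFinP; apply: measurable_funM.
  by apply: measurable_pos_part; exact: measurable_funP.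
exact: (measurable_content_fun W B r n (fun l => (0 < l)%N%:R : R)).
Qed.

Lemma busy_sumE w : regular_path W w -> busy_sum w = busy_period W B r w.
Proof.
move=> reg; have [_ H0 unb _] := reg.
case: (content_cases w) => [pos|[n cn cE]].
  rewrite busy_period_infinite//; apply/cvg_lim => //.
  rewrite (_ : (fun n => _) = fun n => (service_time W n w)%:E); last first.
    apply/funext => n; rewrite sumEFin /service_time big_mkord; congr EFin.
    by apply: eq_bigr => i _; rewrite pos mulr1.
  apply/cvgeryP/cvgryPge => C; have [n hn] := unb C; near=> m.
  apply: (le_trans (ltW hn)); apply: service_time_nd; near: m.
  exact: nbhs_infty_ge.
rewrite (@busy_period_ends _ _ _ _ _ _ W B r w hr reg n) ?cE//.
rewrite /busy_sum (@nneseries_finite _ _ n.+1); last first.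
  by move=> i ni; rewrite cE leqNgt ni mulr0.
rewrite /service_time big_mkord; congr EFin.
by apply: eq_bigr => i _; rewrite cE -ltnS ltn_ord mulr1.
Unshelve. all: by end_near.
Qed.

Lemma elaplace_busy_period s w : regular_path W w ->
  (elaplace (busy_period W B r) s w)%:E =
  (\sum_(n <oo) (discount W s n.+1 w *
     ((0 < content n w)%N && (content n.+1 w == 0%N))%:R)%:E)%E.
Proof.
move=> reg; case: (content_cases w) => [pos|[n cn cE]].
  rewrite /elaplace busy_period_infinite// ltxx mulr0; apply/esym/cvg_lim => //.
  apply: cvg_near_cst; apply: nearW => m; rewrite big1// => i _.
  by rewrite [_ == 0%N]negbTE ?andbF ?mulr0// -lt0n pos.
rewrite /elaplace (@busy_period_ends _ _ _ _ _ _ W B r w hr reg n) ?cE//= ltry mulr1.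
rewrite (@nneseries_finite _ _ n.+1); last first.
  by move=> i ni; rewrite cE leqNgt ni mulr0.
rewrite big_nat_recr//= cE cn leqnn eqxx mulr1 big1_seq ?add0r// => i.
rewrite mem_index_iota/= => ni; rewrite [_ == 0%N]negbTE ?andbF ?mulr0//.
by rewrite -lt0n cE.
Qed.

End busy_period_sum.

Section regular_paths.
Context d (T : measurableType d) (R : realType) (P : probability T R) (M : model P)
  (x : R) (W : driver M x).
Hypotheses (x0 : 0 <= x) (Fx : distrfun (m_eta M) x < 1).
Local Notation A := (arrivals W 0).
Local Notation H := (duration W).
Let HA := arrivalsP W 0.

Lemma ae_gt0 (Y : {RV P >-> R}) : P (Y @^-1` `]-oo, 0]%classic) = 0%E ->
  {ae P, forall w, 0 < Y w}.
Proof.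
move=> Y0; exists (Y @^-1` `]-oo, 0]%classic); split => //.
  by rewrite -[X in measurable X]setTI; exact: (measurable_funP Y measurableT).
by move=> w /= /negP; rewrite -leNgt in_itv/=.
Qed.

Let itv0E (Y : {RV P >-> R}) : Y @^-1` `]-oo, 0]%classic = [set w | Y w <= 0].
Proof. by apply/seteqP; split => w /=; rewrite in_itv. Qed.

Lemma ae_duration_gt0 i : {ae P, forall w, 0 < H i w}.
Proof.
apply: ae_gt0; case: i => [|i] /=.
  by rewrite residual0P// itv0E eta_res_pos.
by rewrite serviceP// itv0E eta_pos.
Qed.

Lemma ae_idle_gt0 n : {ae P, forall w, 0 < idle W n w}.
Proof.
apply: ae_gt0; rewrite idleP// /exponential_prob -integral_itv_bndo_bndc; last first.
  apply/measurable_EFinP; apply: measurable_funTS; exact: measurable_exponential_pdf.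
apply: integral0_eq => y; rewrite /= in_itv/= => y0.
by rewrite lt0_exponential_pdf.
Qed.

(** E[exp (- T_n)] tends to 0 for the nth service time T_n, while it is at least
    exp (- K) times the probability that no service time exceeds K. *)
Lemma ae_unbounded : {ae P, forall w, forall t : R, exists n, t < service_time W n w}.
Proof.
pose N K := \bigcap_n [set w | service_time W n.+1 w <= K].
have mN K : measurable (N K).
  apply: bigcapT_measurable => n.
  by apply: measurable_sublevel; exact: measurable_service_time.
have f0 : 0 <= laplace P (m_eta M) 1 < 1.
  by have /andP[/ltW -> _] := laplace_itv (eta_pos M) (@ler01 R); exact: laplace_lt1 (eta_gt0 M) ltr01.
have PN K : P (N K) = 0%E.
  have lim0 : (fun n => expR K * (laplace P (m_eta_res M x) 1 * laplace P (m_eta M) 1 ^+ n))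
      @ \oo --> (0 : R).
    rewrite -[X in _ --> X](mulr0 (expR K)); apply: cvgM; first exact: cvg_cst.
    rewrite -[X in _ --> X](mulr0 (laplace P (m_eta_res M x) 1)); apply: cvgM; first exact: cvg_cst.
    by apply: cvg_expr; have /andP[f0' f1] := f0; rewrite ger0_norm.
  have : fine (P (N K)) <= 0.
    apply: (cvgr_to_ge lim0); apply: nearW => n.
    rewrite -(mean_discount W x0 Fx (@ltr01 R)) -ler_pdivrMl ?expR_gt0// -expRN.
    have <- : mean P (fun w => expR (- K) * \1_(N K) w) = expR (- K) * fine (P (N K)).
      rewrite (@mean_scale _ _ _ _ _ 1) ?expR_ge0//.
        by rewrite /mean integral_indic// setIT.
      by move=> w; rewrite indicE; case: (_ \in _); rewrite ?lexx ler01.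
    apply: (@mean_le _ _ _ _ _ _ 1) => w.
    - by rewrite mulr_ge0// expR_ge0.
    - rewrite indicE; case: (boolP (w \in N K)) => [/set_mem /(_ n Logic.I)/= h|_].
        by rewrite mulr1 ler_expR lerN2 mul1r.
      by rewrite mulr0 expR_ge0.
    - by have /andP[] := discount_itv W n.+1 w (@ler01 R).
  by move=> h; apply/eqP; rewrite eq_le measure_ge0 andbT -(fineK (fin_num_measure P _ (mN K))) lee_fin.
have : {ae P, forall w, forall K : nat, ~ N K%:R w}.
  apply: ae_foralln => K; exists (N K%:R); split; [exact: mN|exact: PN|].
  by move=> w /= /contrapT.
apply: filterS => w nN t.
have [K tK] : exists K : nat, t <= K%:R.
  by exists (Num.bound `|t|); rewrite (le_trans (ler_norm t))// ltW// archi_boundP.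
apply: contrapT => /forallNP h; apply: (nN K) => n _ /=.
by rewrite (le_trans _ tK)// leNgt; apply/negP; exact: h.
Qed.

(** The arrivals do not jump at the end of a service, which is independent
    of them. *)
Lemma ae_no_jump n : {ae P, forall w, 0 < H n w ->
  exists2 u : R, 0 <= u < service_time W n.+1 w & A u w = A (service_time W n.+1 w) w}.
Proof.
pose c m : R := m.+1%:R / m.+2%:R; pose tau := service_time W n.+1; pose N := n.+1.*2.
have c01 m : 0 < c m < 1.
  by rewrite divr_gt0//= ltr_pdivrMr// mul1r ltr_nat.
pose E := [set z : T * T | forall m, A (tau z.2 * c m) z.1 <> A (tau z.2) z.1].
have tau0 v : 0 <= tau v := service_time_ge0 W n.+1 v.
have mtau : measurable_fun setT (tau : services_type W N -> R).
  exact: measurable_service_time_sub.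
have mA (g : R) : 0 <= g -> measurable_fun setT
    (fun z : arrivals_type W N * services_type W N => A (tau z.2 * g) z.1).
  move=> g0.
  refine (@measurable_process_at _ _ (arrivals_type W N) (services_type W N) R
    (fun t w => A t w) _ _ _ (fun v => tau v * g) _ _).
  - exact: (fun t => @measurable_arrivals _ _ _ _ _ _ W N t).
  - exact: (cp_nondecreasing HA).
  - exact: (cp_right_continuous HA).
  - by apply: measurable_funM.
  - by move=> v; rewrite mulr_ge0.
have c0' m : 0 <= c m by have /andP[/ltW] := c01 m.
have mE : measurable (E : set (arrivals_type W N * services_type W N)).
  apply: (measurable_all_neq (fun m => mA _ (c0' m))).
  rewrite (_ : (fun z => _) = fun z : arrivals_type W N * services_type W N =>
     A (tau z.2 * 1) z.1); first exact: mA.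
  by apply/funext => z; rewrite mulr1.
have mEs (t : T -> R) : measurable_fun setT t -> (forall w, 0 <= t w) ->
    measurable [set w | forall m, A (t w * c m) w <> A (t w) w].
  move=> mt t0; apply: measurable_all_neq => [m|]; last exact: measurable_arrivals_at.
  apply: (@measurable_arrivals_at _ _ _ _ _ _ W (fun w => t w * c m)).
    by apply: measurable_funM.
  by move=> w; rewrite mulr_ge0.
have z0 : (\int[P]_w (\1_E (w, w))%:E = 0)%E.
  rewrite (@freeze_arrivals _ _ _ _ _ _ W N (fun w v => \1_E (w, v))).
  - apply: integral0_eq => v _.
    have [t0|t0] := ltP 0 (tau v); last first.
      apply: integral0_eq => w _; rewrite indicE memNset//= => h; apply: (h 0%N).
      have -> : tau v = 0 by apply/eqP; rewrite eq_le t0 tau0.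
      by rewrite mul0r.
    rewrite -[RHS](no_fixed_jump HA t0) -[in RHS](setIT [set w | _]) -integral_indic//.
    exact: (mEs (cst (tau v)) (measurable_cst _) (fun=> tau0 v)).
  - rewrite (_ : (fun z => _) = \1_E); last by apply/funext => -[].
    exact: measurable_indic.
  - by [].
have mE' : measurable [set w | E (w, w)].
  by apply: (mEs tau) => //; exact: measurable_service_time.
exists [set w | E (w, w)]; split => //.
  rewrite -[RHS]z0 -[in LHS](setIT [set w | _]) -integral_indic//.
move=> w /= h m e; apply: h => H0; exists (tau w * c m); last by [].
have t0 : 0 < tau w by rewrite /tau service_timeS ltr_wpDl ?service_time_ge0// lt_max H0.
have /andP[c0 c1] := c01 m.
by rewrite mulr_ge0 ?ltW//= -[ltRHS]mulr1 ltr_pM2l.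
Qed.

Lemma ae_regular_path : {ae P, forall w, regular_path W w}.
Proof.
have h1 : {ae P, forall w, forall n, 0 < idle W n w} by apply: ae_foralln; exact: ae_idle_gt0.
have h2 : {ae P, forall w, forall i, 0 < H i w} by apply: ae_foralln; exact: ae_duration_gt0.
have h3 := ae_unbounded.
have h4 := ae_foralln ae_no_jump.
apply: filterS3 h1 h2 (filterI h3 h4) => w i0 H0 [unb nj]; split => // n.
exact: nj.
Qed.

End regular_paths.

(** * Transform and mean of the busy period *)

Section slopes.
Context d (T : measurableType d) (R : realType) (P : probability T R).

Lemma expectation_pos_part (Y : {RV P >-> R}) : P [set w | Y w <= 0] = 0%E ->
  ('E_P[Y] = \int[P]_w (pos_part Y w)%:E)%E.
Proof.
move=> Y0; rewrite unlock; apply: ae_eq_integral => //.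
- exact/measurable_EFinP/measurable_funP.
- by apply/measurable_EFinP; apply: measurable_pos_part; exact: measurable_funP.
- by apply: filterS (ae_pos_part Y0) => w h _; rewrite /= h.
Qed.

Lemma cvg_laplace_slope (Y : {RV P >-> R}) : P [set w | Y w <= 0] = 0%E ->
  (fun n => (2 ^+ n * (1 - laplace P Y (2 ^- n)))%:E) @ \oo --> 'E_P[Y]%E.
Proof.
move=> Y0; have mY : measurable_fun setT (pos_part Y).
  by apply: measurable_pos_part; exact: measurable_funP.
have := @laplace_slope _ _ _ P (fun w => (pos_part Y w)%:E) _ _.
rewrite -expectation_pos_part// => h; apply: cvg_trans (h _ _); last 2 first.
- exact/measurable_EFinP.
- by move=> w; rewrite lee_fin pos_part_ge0.
apply: near_eq_cvg; apply: nearW => n.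
have -> : (\int[P]_w (elaplace (fun w => (pos_part Y w)%:E) (2 ^- n) w)%:E =
           (laplace P Y (2 ^- n))%:E)%E.
  rewrite laplace_pos_part// -(@integral_mean _ _ _ P _ 1).
    by apply: eq_integral => w _; rewrite /elaplace ltry mulr1.
  move=> w; rewrite expR_ge0/= -expR0 ler_expR oppr_le0 mulr_ge0 ?pos_part_ge0//.
by rewrite -EFinB -EFinM.
Qed.

Lemma fin_num_mean_eta (M : model P) : 'E_P[m_eta M]%E \is a fin_num.
Proof.
rewrite ge0_fin_numE ?eta_mean//.
by apply: expectation_ge0 => w; rewrite ltW// eta_gt0.
Qed.

Lemma mean_res_lty (M : model P) (x : R) : 0 <= x -> distrfun (m_eta M) x < 1 ->
  ('E_P[m_eta_res M x] < +oo)%E.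
Proof.
move=> x0 Fx.
have mY : measurable_fun setT (pos_part (m_eta_res M x)).
  by apply: measurable_pos_part; exact: measurable_funP.
pose Y : {RV P >-> R} := HB.pack_for {mfun T >-> R} (pos_part (m_eta_res M x))
  (isMeasurableFun.Build _ _ _ _ (pos_part (m_eta_res M x)) mY).
have Y0 := eta_res_pos x0 Fx.
have -> : 'E_P[m_eta_res M x]%E = 'E_P[Y]%E.
  transitivity (\int[P]_w (pos_part (m_eta_res M x) w)%:E)%E; last by rewrite unlock.
  exact: expectation_pos_part.
pose F u := distrfun (m_eta M) u.
have Fx' : 1 - F x != 0 by rewrite subr_eq0 gt_eqF.
have le_meas (Z : {RV P >-> R}) (u : R) : measurable [set w | Z w <= u].
  by apply: measurable_sublevel; exact: measurable_funP.
have tail (Z : {RV P >-> R}) (u : R) : P [set w | u < Z w] = (1 - P [set w | (Z w <= u)%R])%E.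
  rewrite -probability_setC//; congr (P _); apply/seteqP; split => w /=; rewrite ltNge.
    by move/negP.
  by move/negP.
apply: (@le_lt_trans _ _ ('E_P[m_eta M] * ((1 - F x)^-1)%:E)%E).
  apply: (@mean_residual _ _ _ P (m_eta M) Y x) => //.
  - by move=> w; rewrite ltW// eta_gt0.
  - by move=> w; exact: pos_part_ge0.
  - by rewrite invr_ge0 subr_ge0 ltW.
  - move=> u u0.
    have -> : [set w | u < Y w] = [set w | u < m_eta_res M x w].
      by apply/seteqP; split => w /=; rewrite /pos_part lt_max (ltNge u 0) u0 orbF.
    rewrite !tail eta_resP//.
    have -> : P [set w | m_eta M w <= x + u] = (F (x + u))%:E.
      rewrite /F /distrfun fineK.
        by rewrite /cdf; congr (P _); apply/seteqP; split => w /=; rewrite in_itv.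
      by rewrite fin_num_measure.
    rewrite -!EFinB -EFinM; congr EFin; rewrite -/(F _) -/(F x).
    by field.
by rewrite -(fineK (fin_num_mean_eta M)) -EFinM ltry.
Qed.

Lemma fin_num_mean_res (M : model P) (x : R) : 0 <= x -> distrfun (m_eta M) x < 1 ->
  'E_P[m_eta_res M x]%E \is a fin_num.
Proof.
move=> x0 Fx.
rewrite ge0_fin_numE ?mean_res_lty// (expectation_pos_part (eta_res_pos x0 Fx)).
by apply: ge0_integral_real => w; exact: pos_part_ge0.
Qed.

End slopes.

Section busy_period_transform.
Context d (T : measurableType d) (R : realType) (P : probability T R) (M : model P)
  (x : R) (W : driver M x) (B r : nat).
Hypotheses (hr : (0 < r <= B.+1)%N) (x0 : 0 <= x) (Fx : distrfun (m_eta M) x < 1).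
Local Notation A := (arrivals W 0).
Local Notation lam := (m_lam M).
Local Notation lap := (laplace P (m_eta M)).
Local Notation lapx := (laplace P (m_eta_res M x)).
Let HA := arrivalsP W 0.

Definition busy_transform s : R :=
  (lapx s + (1 - lap s) * resolvent_sum M s x (B%:Z - r%:Z)) /
  (lap s + (1 - lap s) * fine (mean_resolvent_sum M B s)).

Lemma busy_transformE s : 0 <= s -> busy_transform s =
  busy lam (service_coef M A s) (lap s) B (residual_coef M A s x) (lapx s) (B.+1 - r).
Proof.
move=> s0; rewrite /busy_transform /busy /drain mulrC (mean_resolvent_sumE HA)//=.
rewrite resolvent_sumE// (resolventE HA s0 (zero_free_c_fun HA s0) x0 Fx).
by congr (_^-1 * _); rewrite /scale; ring.
Qed.

Lemma busy_period_transform s : 0 < s ->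
  (\int[P]_w (elaplace (busy_period W B r) s w)%:E = (busy_transform s)%:E)%E.
Proof.
move=> s0; have s0' := ltW s0.
pose h n w := discount W s n.+1 w *
  ((0 < content W B r n w)%N && (content W B r n.+1 w == 0%N))%:R.
have h01 n w : 0 <= h n w <= 1.
  have /andP[z0 z1] := discount_itv W n.+1 w s0'.
  by rewrite /h; case: (_ && (_ == _)); rewrite ?mulr0 ?lexx ?ler01// mulr1 ltW.
have mh n : measurable_fun setT (h n).
  apply: measurable_funM; first exact: measurable_discount.
  under eq_fun do rewrite -mulnb natrM.
  apply: measurable_funM; first exact: (measurable_content_fun W B r n (fun l => (0 < l)%N%:R : R)).
  exact: (measurable_content_fun W B r n.+1 (fun l => (l == 0%N)%:R : R)).
rewrite (@ge0_ae_eq_integral_nonmeasurable _ _ _ P _ (fun w => \sum_(n <oo) (h n w)%:E)%E).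
- rewrite integral_nneseries//; last 2 first.
  + by move=> n; exact/measurable_EFinP.
  + by move=> n w _; rewrite lee_fin; have /andP[] := h01 n w.
  rewrite busy_transformE//; apply/cvg_lim => //.
  under eq_fun do under eq_bigr do rewrite (@integral_mean _ _ _ P _ 1 (h01 _)).
  under eq_fun do rewrite sumEFin.
  apply: cvg_EFin; first by near=> n.
  exact: (@end_mass_series _ _ _ _ _ _ W B r hr x0 Fx s s0).
- by move=> w; rewrite lee_fin mulr_ge0// expR_ge0.
- by move=> w; apply: nneseries_ge0 => n _ _; rewrite lee_fin; have /andP[] := h01 n w.
- apply: ge0_emeasurable_sum => n.
    by move=> w _ _; rewrite lee_fin; have /andP[] := h01 n w.
  by move=> _; exact/measurable_EFinP.
- apply: filterS (ae_regular_path W x0 Fx) => w; exact: elaplace_busy_period.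
Unshelve. all: by end_near.
Qed.

Lemma ae_busy_sum : {ae P, forall w, busy_period W B r w = busy_sum W B r w}.
Proof. by apply: filterS (ae_regular_path W x0 Fx) => w reg; rewrite busy_sumE. Qed.

Lemma busy_sum_transform s : 0 < s ->
  (\int[P]_w (elaplace (busy_sum W B r) s w)%:E = (busy_transform s)%:E)%E.
Proof.
move=> s0; rewrite -busy_period_transform//; apply/esym.
apply: ge0_ae_eq_integral_nonmeasurable.
- by move=> w; rewrite lee_fin mulr_ge0// expR_ge0.
- by move=> w; rewrite lee_fin mulr_ge0// expR_ge0.
- apply/measurable_EFinP; apply: measurable_elaplace; exact: measurable_busy_sum.
- by apply: filterS ae_busy_sum => w; rewrite /elaplace => ->.
Qed.

Lemma busy_period_ge0 w : (0 <= busy_period W B r w)%E.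
Proof. by apply: le_ereal_inf_tmp => z /= [t [t0 _] <-]; rewrite lee_fin. Qed.

(** The difference quotients of the transform along s = 2^-n are expressed by those
    of eta and of eta_x. *)
Lemma integral_busy_sum : (\int[P]_w busy_sum W B r w =
  (fine 'E_P[m_eta_res M x] - fine 'E_P[m_eta M] + fine 'E_P[m_eta M] *
   (fine (mean_resolvent_sum M B 0) - resolvent_sum M 0 x (B%:Z - r%:Z)))%:E)%E.
Proof.
pose h n : R := 2 ^- n.
have h0 n : 0 < h n by rewrite invr_gt0 exprn_gt0.
have slope := laplace_slope (P := P) (measurable_busy_sum W B r) (busy_sum_ge0 W B r).
apply: (cvg_unique _ slope) => //.
pose u n : R := 2 ^+ n * (1 - lap (h n)).
pose v n : R := 2 ^+ n * (1 - lapx (h n)).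
have fin_eta := fin_num_mean_eta M; have fin_res := fin_num_mean_res x0 Fx.
have cu : u @ \oo --> fine 'E_P[m_eta M]%E.
  by have c := cvg_laplace_slope (eta_pos M); rewrite -(fineK fin_eta) in c; exact: (fine_cvg c).
have cv : v @ \oo --> fine 'E_P[m_eta_res M x]%E.
  have c := cvg_laplace_slope (eta_res_pos x0 Fx).
  by rewrite -(fineK fin_res) in c; exact: (fine_cvg c).
pose ES n := fine (mean_resolvent_sum M B (h n)).
pose S n := resolvent_sum M (h n) x (B%:Z - r%:Z).
have cES : ES @ \oo --> fine (mean_resolvent_sum M B 0).
  rewrite (mean_resolvent_sumE HA)//=.
  rewrite (_ : ES = fun n => 1 + (1 - lam) * series (scale M A (h n)) B); last first.
    by apply/funext => n; rewrite /ES (mean_resolvent_sumE HA)//= ltW.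
  apply: cvgD; first exact: cvg_cst.
  apply: cvgM; first exact: cvg_cst.
  by apply: cvg_series_coef => k; exact: (cvg_scale_half HA).
have cS : S @ \oo --> resolvent_sum M 0 x (B%:Z - r%:Z).
  rewrite resolvent_sumE// (_ : S = fun n => series (resolvent M (h n) x) (B.+1 - r)%N).
    exact: (cvg_resolvent_half HA x0 Fx).
  by apply/funext => n; rewrite /S resolvent_sumE.
have cf : (fun n => h n * u n) @ \oo --> 0.
  by rewrite -[X in _ --> X](mul0r (fine 'E_P[m_eta M]%E)); apply: cvgM => //; exact: cvg_half.
have hu n : h n * u n = 1 - lap (h n) by rewrite /u mulrA mulVf ?mul1r// gt_eqF// exprn_gt0.
have den n : lap (h n) + (1 - lap (h n)) * ES n = 1 + h n * u n * (ES n - 1).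
  by rewrite hu; ring.
have den_gt0 n : 0 < lap (h n) + (1 - lap (h n)) * ES n.
  have /andP[l0 l1] := laplace_itv (eta_pos M) (ltW (h0 n)).
  rewrite ltr_wpDr// mulr_ge0 ?subr_ge0// /ES (mean_resolvent_sumE HA _ (ltW (h0 n)))/=.
  rewrite addr_ge0// mulr_ge0 ?subr_ge0 ?(ltW (lam_lt1 M))//.
  apply: series_ge0 => k.
  exact: (scale_ge0 HA k (ltW (h0 n)) (zero_free_c_fun HA (ltW (h0 n)))).
rewrite (_ : (fun n => _) = fun n =>
  (((v n - u n) + u n * (ES n - S n)) / (1 + h n * u n * (ES n - 1)))%:E); last first.
  apply/funext => n; rewrite busy_sum_transform// /busy_transform -/(ES n) -/(S n).
  rewrite -den -EFinB -EFinM; congr EFin; rewrite /u /v -/(h n).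
  by field; rewrite gt_eqF// den_gt0.
apply: cvg_EFin; first by near=> n.
rewrite -[X in _ --> X]divr1; apply: cvgM.
  by apply: cvgD; [exact: cvgB|apply: cvgM => //; exact: cvgB].
apply: cvgV; first by rewrite oner_neq0.
rewrite -[X in _ --> X]addr0; apply: cvgD; first exact: cvg_cst.
rewrite -(mul0r (fine (mean_resolvent_sum M B 0) - 1)); apply: cvgM => //.
by apply: cvgB => //; exact: cvg_cst.
Unshelve. all: by end_near.
Qed.

End busy_period_transform.

Theorem corollary1 (d : measure_display) (T : measurableType d) (R : realType)
    (P : probability T R) (M : model P) (B r : nat) (x s : R)
    (hr : (1 <= r <= B.+1)%N) (hx : 0 <= x) (hF : distrfun (m_eta M) x < 1)
    (hs : 0 < s) (W : driver M x) :
  [/\ (mean_resolvent_sum M B s \is a fin_num)%E,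
      mean_resolvent_sum M B s
        = ((1 - m_lam M)%:E * \sum_(1 <= i <oo)
            (m_lam M ^+ i.-1 * resolvent_sum M s 0 (i%:Z - 1 + B%:Z)%R)%R%:E)%E
    & ('E_P[fun w => (expR (- (s * fine (busy_period W B r w)))
                      * (busy_period W B r w < +oo)%E%:R)%R])%E
        = ((laplace P (m_eta_res M x) s
            + (1 - laplace P (m_eta M) s) * resolvent_sum M s x (B%:Z - r%:Z))
           / (laplace P (m_eta M) s
            + (1 - laplace P (m_eta M) s) * fine (mean_resolvent_sum M B s)))%:E]
  /\ {ae P, forall w, (busy_period W B r w < +oo)%E}
  /\ (\int[P]_w busy_period W B r w
        = 'E_P[m_eta_res M x] - 'E_P[m_eta M]
          + 'E_P[m_eta M] * (mean_resolvent_sum M B 0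
                           - (resolvent_sum M 0 x (B%:Z - r%:Z)%R)%:E))%E
  /\ (\int[P]_w busy_period W B r w < +oo)%E.
Proof.
have HA := arrivalsP W 0.
have fin_eta := fin_num_mean_eta M; have fin_res := fin_num_mean_res hx hF.
have int_busy : (\int[P]_w busy_period W B r w = \int[P]_w busy_sum W B r w)%E.
  apply: ge0_ae_eq_integral_nonmeasurable.
  - exact: busy_period_ge0.
  - exact: busy_sum_ge0.
  - exact: measurable_busy_sum.
  - exact: ae_busy_sum.
have mean_busy := integral_busy_sum W hr hx hF.
split; [split|split; [|split]].
- by rewrite (mean_resolvent_sumE HA)// ltW.
- by rewrite (mean_resolvent_sum_series HA)// ltW.
- by rewrite unlock; exact: busy_period_transform.
- have int_sum : P.-integrable setT (busy_sum W B r).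
    apply/integrableP; split; first exact: measurable_busy_sum.
    under eq_integral do rewrite gee0_abs ?busy_sum_ge0//.
    by rewrite mean_busy ltry.
  have fin_sum := integrable_ae measurableT int_sum.
  apply: filterS2 (ae_busy_sum W hr hx hF) fin_sum => w.
  by move=> -> /(_ Logic.I); rewrite ge0_fin_numE// busy_sum_ge0.
- rewrite int_busy mean_busy !(EFinD, EFinN, EFinM) !fineK//.
  by rewrite (mean_resolvent_sumE HA).
- by rewrite int_busy mean_busy ltry.
Qed.
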